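(* Let $\nu\in C^\infty_c(\mathbb{R}^3)$ with $\mathbf 0\notin\operatorname{Supp}\nu$. Let $X,K,d\ge1$ be integers with $Kd\le X^{9/10}$. Then, for every $\epsilon>0$, $$\operatorname{Var}(X,K;d)=\bigl[N_{\nu^{\otimes2}}(X;d)-\mathfrak{S}(d)\sigma_{\infty,\nu^{\otimes2}}X^3\bigr]+O_\epsilon\bigl(d^{5/3}K^{-2/3+\epsilon}\sigma_{\infty,\nu^{\otimes2}}X^3\bigr)+O\bigl(\|\nu\|_{100,\infty}^2B(\nu)^{5000}\bigr).$$
   Context: Notation. $F_0(\mathbf{y})=y_1^3+y_2^3+y_3^3$; $F(\mathbf{y},\mathbf{z})=F_0(\mathbf{y})-F_0(\mathbf{z})$ on $\mathbb{R}^6$; $F_a=F_0-a$. $e(t)=e^{2\pi it}$, $e_r(t)=e(t/r)$, $\|\mathbf{u}\|=\max_i|u_i|$. $\|f\|_{k,\infty}$ is the maximum over multi-indices of total order $\le k$ of $\sup|\partial^\alpha f|$; for compactly supported $f$ with $\mathbf 0\notin\operatorname{Supp}f$, $B(f)$ is the least integer $B\ge1$ with $B^{-1}\le\|\mathbf{u}\|\le B$ on $\operatorname{Supp}f$. For integers $n\ge1$ and $a$, $T_a(n)=\sum_{u\in(\mathbb{Z}/n\mathbb{Z})^\times}\sum_{\mathbf{y}\in(\mathbb{Z}/n\mathbb{Z})^3}e_n(uF_a(\mathbf{y}))$, and $s_a(K)=\sum_{n\le K}n^{-3}T_a(n)$. For integers $n,d\ge1$, $S^+_{\mathbf 0}(n;d)=\sum_{m\ge1:\operatorname{lcm}(m,d)=n}\sum_{u\in(\mathbb{Z}/m\mathbb{Z})^\times}\sum_{\mathbf{x}=(\mathbf{y},\mathbf{z})\in(\mathbb{Z}/n\mathbb{Z})^6:\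 d\mid F_0(\mathbf{y}),F_0(\mathbf{z})}e_m(uF(\mathbf{x}))$, and $\mathfrak{S}(d)=\sum_{n\ge1}n^{-6}S^+_{\mathbf 0}(n;d)$ (absolutely convergent). For $w\in C^\infty_c(\mathbb{R}^6)$: $\sigma_{\infty,w}=\lim_{\epsilon\to0}(2\epsilon)^{-1}\int_{|F(\mathbf{x})|\le\epsilon}w(\mathbf{x})d\mathbf{x}$ and $N_w(X;d)=\sum_{\mathbf{x}\in\mathbb{Z}^6}w(\mathbf{x}/X)\mathbf{1}_{F(\mathbf{x})=0}\mathbf{1}_{d\mid F_0(\mathbf{y}),F_0(\mathbf{z})}$. Put $\nu^{\otimes2}(\mathbf{y},\mathbf{z})=\nu(\mathbf{y})\nu(\mathbf{z})$. For $a\in\mathbb{R}$, $X>0$: $\sigma_{\infty,a,\nu}(X)=\lim_{\epsilon\to0}(2\epsilon)^{-1}\int_{|F_0(\mathbf{u})-a/X^3|\le\epsilon}\nu(\mathbf{u})\,d\mathbf{u}$. For $a\in\mathbb{Z}$, $N_{a,\nu}(X)=\sum_{\mathbf{y}\in\mathbb{Z}^3:F_0(\mathbf{y})=a}\nu(\mathbf{y}/X)$. Finally $\operatorname{Var}(X,K;d)=\sum_{a\in\mathbb{Z}:\,d\mid a}[N_{a,\nu}(X)-s_a(K)\sigma_{\infty,a,\nu}(X)]^2$. *)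

(* Defs.v *)
From HB Require Import structures.
From mathcomp Require Import all_boot all_order all_algebra.
From mathcomp Require Import complex.
From mathcomp Require Import all_classical all_reals all_analysis.

Set Implicit Arguments.
Unset Strict Implicit.
Unset Printing Implicit Defensive.

Import Order.TTheory GRing.Theory Num.Theory.
Import numFieldNormedType.Exports.

Local Open Scope classical_set_scope.
Local Open Scope ring_scope.
Local Open Scope complex_scope.

(* The library norm of 'rV[R]_n is the sup norm: `|u| is max_i |u_i|. *)
Section TestFunctions.
Context {R : realType} {n : nat}.
Implicit Types (f : 'rV[R]_n -> R) (s : seq 'I_n).

Definition iter_partial s f : 'rV[R]_n -> R :=
  foldr (fun i g => fun x => 'D_(delta_mx 0 i) g x) f s.

Definition smooth f : Prop :=
  forall s, continuous (iter_partial s f) /\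
            forall i x, derivable (iter_partial s f) x (delta_mx 0 i).

Definition Supp f : set 'rV[R]_n := closure [set u | f u != 0].

Definition smooth_compact_supp f : Prop := smooth f /\ compact (Supp f).

Definition multi_partial (alpha : 'I_n -> nat) f : 'rV[R]_n -> R :=
  iter_partial (flatten [seq nseq (alpha i) i | i <- enum 'I_n]) f.

(* For |alpha| <= k every entry of alpha lies in 'I_k.+1. *)
Definition Cnorm (k : nat) f : R :=
  \big[Num.max/0]_(alpha : {ffun 'I_n -> 'I_k.+1}
                    | (\sum_(i < n) alpha i <= k)%N)
    sup (range (fun u => `|multi_partial (fun i => alpha i) f u|)).

Definition supp_bound f (B : nat) : Prop :=
  (1 <= B)%N /\ forall u, Supp f u -> B%:R^-1 <= `|u| <= B%:R.

(* The default value 1 is irrelevant: when Supp f is compact and avoids 0,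
   some B satisfies supp_bound. *)
Definition least_supp_bound f : nat :=
  xget 1%N [set B | supp_bound f B /\
                    forall B', supp_bound f B' -> (B <= B')%N].

End TestFunctions.

Definition F0 {T : pzRingType} (y : 'rV[T]_3) : T := \sum_(i < 3) y 0 i ^+ 3.

Definition Fa {T : pzRingType} (a : T) (y : 'rV[T]_3) : T := F0 y - a.

(* R^6 is split as R^3 x R^3, with x = (y, z). *)
Definition F {T : pzRingType} (x : 'rV[T]_3 * 'rV[T]_3) : T :=
  F0 x.1 - F0 x.2.

Section SingularSeries.
Context {R : realType}.

Definition e (t : R) : R[i] := cos (2 * pi * t) +i* sin (2 * pi * t).

Definition er (r : nat) (t : int) : R[i] := e (t%:~R / r%:R).

(* (Z/nZ)^3 and (Z/nZ)^x are enumerated by representatives in {0, ..., n-1};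
   'Z_n is avoided because 'Z_1 has two elements. *)
Definition repZ {n : nat} (y : 'rV['I_n]_3) : 'rV[int]_3 :=
  map_mx (fun i : 'I_n => (i : nat)%:Z) y.

Definition T_ (a : int) (n : nat) : R[i] :=
  \sum_(u < n | coprime u n) \sum_(y : 'rV['I_n]_3)
    er n ((u : nat)%:Z * Fa a (repZ y)).

Definition s_ (a : int) (K : nat) : R[i] :=
  \sum_(1 <= n < K.+1) n%:R ^- 3 * T_ a n.

Definition Splus0 (n d : nat) : R[i] :=
  \sum_(1 <= m < n.+1 | lcmn m d == n)
    \sum_(u < m | coprime u m)
      \sum_(x : 'rV['I_n]_3 * 'rV['I_n]_3
             | (d %| F0 (repZ x.1))%Z && (d %| F0 (repZ x.2))%Z)
        er m ((u : nat)%:Z * F (repZ x.1, repZ x.2)).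

(* R[i]^o carries the usual topology of the complex numbers. *)
Definition sing_series (d : nat) : R[i] :=
  limn ((fun N => \sum_(1 <= n < N.+1) n%:R ^- 6 * Splus0 n d) : nat -> R[i]^o).

End SingularSeries.

(* The library's sigma-finiteness instance for product measures is only
   inferred for products of subprobabilities, so it is provided here for the
   Lebesgue measures on R^2, R^3 and R^6. *)
Section LebesgueProducts.
Local Open Scope ereal_scope.

Lemma sigma_finite_product d1 d2 (T1 : measurableType d1)
    (T2 : measurableType d2) (R : realType)
    (m1 : {sigma_finite_measure set T1 -> \bar R})
    (m2 : {sigma_finite_measure set T2 -> \bar R}) :
  sigma_finite setT (m1 \x m2).
Proof.
have /sigma_finiteP[F [TF ndF Foo]] := sigma_finiteT m1.
have /sigma_finiteP[G [TG ndG Goo]] := sigma_finiteT m2.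
exists (fun n => F n `*` G n).
  rewrite -setXTT TF TG predeqE => -[x y]; split.
    move=> [/= [n _ Fnx] [k _ Gky]]; exists (maxn n k) => //; split.
    - by move: x Fnx; exact/subsetPset/ndF/leq_maxl.
    - by move: y Gky; exact/subsetPset/ndG/leq_maxr.
  by move=> [n _ []/= ? ?]; split; exists n.
move=> k; have [? ?] := Foo k; have [? ?] := Goo k.
split; first exact: measurableX.
by rewrite product_measure1E// lte_mul_pinfty// ge0_fin_numE.
Qed.

Definition lebesgue2 (R : realType) :=
  @lebesgue_measure R \x @lebesgue_measure R.

HB.instance Definition _ (R : realType) := Measure.on (@lebesgue2 R).
HB.instance Definition _ (R : realType) :=
  Measure_isSigmaFinite.Build _ _ _ (@lebesgue2 R)
    (sigma_finite_product lebesgue_measure lebesgue_measure).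

Definition lebesgue3 (R : realType) := @lebesgue2 R \x @lebesgue_measure R.

HB.instance Definition _ (R : realType) := Measure.on (@lebesgue3 R).
HB.instance Definition _ (R : realType) :=
  Measure_isSigmaFinite.Build _ _ _ (@lebesgue3 R)
    (sigma_finite_product (@lebesgue2 R) lebesgue_measure).

Definition lebesgue6 (R : realType) := @lebesgue3 R \x @lebesgue3 R.

HB.instance Definition _ (R : realType) := Measure.on (@lebesgue6 R).
HB.instance Definition _ (R : realType) :=
  Measure_isSigmaFinite.Build _ _ _ (@lebesgue6 R)
    (sigma_finite_product (@lebesgue3 R) (@lebesgue3 R)).

End LebesgueProducts.

Section Variance.
Context {R : realType}.

Definition row3 (t : R * R * R) : 'rV[R]_3 :=
  \row_(i < 3) tnth [tuple t.1.1; t.1.2; t.2] i.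

Definition sigma_inf (w : 'rV[R]_3 * 'rV[R]_3 -> R) : R :=
  lim ((fun eps : R =>
    (2 * eps)^-1 *
    \int[@lebesgue6 R]_(x in
           [set x | `|F (row3 x.1, row3 x.2)| <= eps])
      w (row3 x.1, row3 x.2)) @ 0^'+).

Definition sigma_inf_a (a : R) (nu : 'rV[R]_3 -> R) (X : R) : R :=
  lim ((fun eps : R =>
    (2 * eps)^-1 *
    \int[@lebesgue3 R]_(t in [set t | `|F0 (row3 t) - a / X ^+ 3| <= eps])
      nu (row3 t)) @ 0^'+).

Definition scale (X : R) (y : 'rV[int]_3) : 'rV[R]_3 :=
  X^-1 *: map_mx intr y.

(* \sum_(_ \in _) is 0 on infinitely supported families; for compactly supported
   weights and X > 0 the sums over Z, Z^3 and Z^6 below are finite. *)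
Definition N_w (w : 'rV[R]_3 * 'rV[R]_3 -> R) (X : R) (d : nat) : R :=
  \sum_(x \in [set x : 'rV[int]_3 * 'rV[int]_3 |
                 [/\ F x = 0, (d %| F0 x.1)%Z & (d %| F0 x.2)%Z]])
    w (scale X x.1, scale X x.2).

Definition N_a (a : int) (nu : 'rV[R]_3 -> R) (X : R) : R :=
  \sum_(y \in [set y : 'rV[int]_3 | F0 y = a]) nu (scale X y).

Definition tensor2 (nu : 'rV[R]_3 -> R) (x : 'rV[R]_3 * 'rV[R]_3) : R :=
  nu x.1 * nu x.2.

(* Complex-valued only because T_ is written as a sum of complex exponentials. *)
Definition Var (nu : 'rV[R]_3 -> R) (X K d : nat) : R[i] :=
  \sum_(a \in [set a : int | (d %| a)%Z])
    ((N_a a nu X%:R)%:C -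
     s_ a K * (sigma_inf_a a%:~R nu X%:R)%:C) ^+ 2.

End Variance.

(* Main.v *)
(* Write [g] for the density of the push-forward of [nu] under [F0], so that
   [sigma_inf_a a nu X = g (a / X^3)], and expand the square in [Var]: it equals
   [N_w - 2 C + Q], where [C] is a sum over integer points [y] of the smooth
   weight [nu * g(F0)] against [s_(F0 y)], and [Q] is a sum over integers [a] of
   [g^2] against [s_a^2].  Since [s_a] is a short sum of additive characters of
   small conductor, splitting into residue classes and comparing Riemann sums
   with integrals (an error of arbitrarily high order, because the weights are
   smooth and compactly supported) gives [C] and [Q] as [sigma_inf X^3] times
   finite sums of products of normalised cubic Gauss sums over pairs of
   fractions [r1/D], [r2/D] with [d (r1 + r2)/D] integral.  The singular series
   is the same sum with another cut-off on the denominators; all three differ by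
   at most a tail of [sum |Gamma|^2], which the bounds for cubic Gauss sums make
   [O((K/d)^(-2/3+eps))].

   Regularity of [g] away from the origin, including at critical values of
   [F0], comes from the vector field [Vf] with [Vf . grad F0 = 1]: integrating
   by parts along it trades derivatives of [g] for the operator [Lop]. *)

(* The exponent 2/3 comes from the cubes. For n = a b^2 c^3 a normalised cubic sum is at most about
   a^(-1/2) b^-1 c^-1, so its sixth moment over the residues mod n is about n a^-3 b^-6 c^-6. Summed
   over n > K, the pure cubes dominate and leave the sum of c^-3 over c > K^(1/3). The hypothesis Kd
   <= X^(9/10) is what makes the Riemann sums nearly exact: the mesh of the cross term is at most
   X^(-1/10), every derivative of the weight gains one more such factor, and 50 of them beat K^2 X^3
   <= X^5. Hence the last error term contains no power of X. That term is an explicit power of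
   B(nu), so no constant may depend on the weight. Smoothness is therefore measured by classes in
   which one derivative costs a fixed power of B, and all constants are chosen before B and nu. The
   obstacle on the analytic side is that derivatives of the density in t must be taken under
   integrals of functions that are not smooth in t. This is done with truncated powers of F0 - t and
   Taylor remainders bounded by h^2 locally uniformly. *)
Require Import Defs.
From mathcomp Require Import all_boot all_order all_algebra.
From mathcomp Require Import complex.
From mathcomp Require Import all_classical all_reals all_analysis.
From mathcomp Require Import measurable_realfun.
From mathcomp Require Import ring lra zify.

Import Order.TTheory GRing.Theory Num.Theory.
Import numFieldNormedType.Exports.

Set Implicit Arguments.
Unset Strict Implicit.
Unset Printing Implicit Defensive.

Local Open Scope classical_set_scope.
Local Open Scope ring_scope.
Local Open Scope complex_scope.

(** * Additive characters *)

Section Modulus.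
Context {R : realType}.
Implicit Types z w : R[i].

Notation cabs := ComplexField.Normc.normc.

Lemma normcE' z : `|z| = (cabs z)%:C.
Proof. by rewrite normc_def; case: z. Qed.

Lemma cabsM z w : cabs (z * w) = cabs z * cabs w.
Proof. exact: ComplexField.Normc.normcM. Qed.

Lemma cabsD z w : cabs (z + w) <= cabs z + cabs w.
Proof. by rewrite -lecR rmorphD/= -!normcE' ler_normD. Qed.

Lemma cabsN z : cabs (- z) = cabs z.
Proof. by apply: complexI; rewrite -!normcE' normrN. Qed.

Lemma cabsB z w : cabs (z - w) <= cabs z + cabs w.
Proof. by rewrite -(cabsN w) cabsD. Qed.

Lemma cabs_ge0 z : 0 <= cabs z.
Proof. by rewrite -ler0c -normcE' normr_ge0. Qed.

Lemma cabs_real (x : R) : cabs x%:C = `|x|.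
Proof. by rewrite /= expr0n addr0 sqrtr_sqr. Qed.

Lemma cabs0 : cabs (0 : R[i]) = 0.
Proof. by rewrite -[0]/(0%:C) cabs_real normr0. Qed.

Lemma cabs1 : cabs (1 : R[i]) = 1.
Proof. by rewrite -[1]/(1%:C) cabs_real normr1. Qed.

Lemma cabs_nat n : cabs (n%:R : R[i]) = n%:R.
Proof. by rewrite -(rmorph_nat (real_complex R)) cabs_real ger0_norm. Qed.

Lemma cabsX z n : cabs (z ^+ n) = cabs z ^+ n.
Proof. by elim: n => [|n IH]; rewrite ?cabs1// !exprS cabsM IH. Qed.

Lemma cabsV z : cabs z^-1 = (cabs z)^-1.
Proof. by apply: complexI; rewrite -normcE' normfV normcE' fmorphV. Qed.

Lemma cabs_sum (I : Type) (r : seq I) (P : pred I) (F : I -> R[i]) :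
  cabs (\sum_(i <- r | P i) F i) <= \sum_(i <- r | P i) cabs (F i).
Proof.
elim/big_rec2: _ => [|i y1 y2 _ le]; first by rewrite cabs0.
by rewrite (le_trans (cabsD _ _))// lerD2l.
Qed.

End Modulus.
Notation cabs := ComplexField.Normc.normc.

Section Exponentials.
Context {R : realType}.
Local Notation e := (@e R).
Local Notation er := (@er R).

Lemma eD (s t : R) : e (s + t) = e s * e t.
Proof.
rewrite /Defs.e mulrDr cosD sinD; apply/eqP; rewrite eq_complex /=.
by rewrite !eqxx/= addrC eqxx.
Qed.

Lemma e0 : e 0 = 1.
Proof. by rewrite /Defs.e mulr0 cos0 sin0. Qed.

Lemma e_nat (n : nat) : e n%:R = 1.
Proof.
elim: n => [|n IH]; first exact: e0.
rewrite -natr1 eD IH mul1r /Defs.e mulr1.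
by rewrite mulr_natl cos2pi sin2pi.
Qed.

Lemma eN (t : R) : e (- t) = Num.conj (e t).
Proof. by rewrite /Defs.e mulrN cosN sinN. Qed.

Lemma e_int (n : int) : e n%:~R = 1.
Proof.
case: n => n; first exact: e_nat.
by rewrite NegzE mulrNz eN e_nat; apply/eqP; rewrite eq_complex/= oppr0 !eqxx.
Qed.

Lemma cabs_e (t : R) : cabs (e t) = 1.
Proof. by rewrite /= cos2Dsin2 sqrtr1. Qed.

Lemma e_neq1 (t : R) : 0 < t < 1 -> e t != 1.
Proof.
move=> /andP[t0 t1]; rewrite /Defs.e eq_complex /= negb_and.
apply/orP; left.
have -> : 2 * pi * t = (pi * t) *+ 2 by rewrite -mulrnAl mulr_natl.
rewrite cos_mulr2n.
have : 0 < sin (pi * t).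
  apply: sin_gt0_pi; rewrite ?mulr_gt0 ?pi_gt0//.
  by rewrite gtr_pMr ?pi_gt0.
have := cos2Dsin2 (pi * t : R).
move: (cos _) (sin _) => c s E s0; apply/eqP => H.
have s2 : 0 < s ^+ 2 by rewrite exprn_gt0.
lra.
Qed.

Lemma erD (n : nat) (a b : int) : er n (a + b) = er n a * er n b.
Proof. by rewrite /Defs.er intrD mulrDl eD. Qed.

Lemma er0 (n : nat) : er n 0 = 1.
Proof. by rewrite /Defs.er mul0r e0. Qed.

Lemma cabs_er (n : nat) (a : int) : cabs (er n a) = 1.
Proof. exact: cabs_e. Qed.

Lemma er_dvd (n : nat) (a : int) : (n%:Z %| a)%Z -> er n a = 1.
Proof.
case: n => [|n]; first by rewrite /Defs.er invr0 mulr0 e0.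
move=> /dvdzP[q ->]; rewrite /Defs.er intrM -pmulrn.
by rewrite mulfK ?pnatr_eq0// e_int.
Qed.

Lemma er_eqmod (n : nat) (a b : int) :
  (n%:Z %| a - b)%Z -> er n a = er n b.
Proof. by move=> /er_dvd h; rewrite -[a](subrK b) erD h mul1r. Qed.

Lemma er_scale (k n : nat) (a : int) : (0 < k)%N ->
  er (k * n) (k%:Z * a) = er n a.
Proof.
move=> k0; rewrite /Defs.er intrM natrM -pmulrn.
by rewrite -mulf_div divff ?mul1r// pnatr_eq0 -lt0n.
Qed.

Lemma erX (n : nat) (a : int) (k : nat) : er n (a * k%:Z) = er n a ^+ k.
Proof.
elim: k => [|k IH]; first by rewrite mulr0 er0.
by rewrite -natz -natr1 natz mulrDr mulr1 erD IH exprSr.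
Qed.

Lemma erN (n : nat) (a : int) : er n (- a) = Num.conj (er n a).
Proof. by rewrite /Defs.er mulrNz mulNr eN. Qed.

Lemma er_neq1 (n : nat) (a : int) : (0 < n)%N -> ~~ (n%:Z %| a)%Z ->
  er n a != 1.
Proof.
move=> n0 ndv.
have n0z : n%:Z != 0 by lia.
rewrite (@er_eqmod n a (a %% n%:Z)%Z); last first.
  by rewrite {1}(divz_eq a n) addrK dvdz_mull.
have h0 := modz_ge0 a n0z.
have h1 : (a %% n%:Z)%Z != 0 by apply/negP => /eqP/dvdz_mod0P; apply/negP.
have h2 : (a %% n%:Z < n%:Z)%Z by rewrite ltz_pmod.
apply: e_neq1; apply/andP; split.
  by rewrite divr_gt0 ?ltr0n// ltr0z lt0r h1.
by rewrite ltr_pdivrMr ?ltr0n// mul1r pmulrn ltr_int.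
Qed.

Lemma er_geom (n : nat) (a : int) : (0 < n)%N ->
  \sum_(u < n) er n (a * (u : nat)%:Z) = if (n%:Z %| a)%Z then n%:R else 0.
Proof.
move=> n0; case: ifPn => h.
  rewrite (eq_bigr (fun=> 1)) ?sumr_const ?card_ord// => u _.
  by rewrite er_dvd// dvdz_mulr.
have := er_neq1 n0 h; set w := er n a => w1.
rewrite (eq_bigr (fun u : 'I_n => w ^+ u)); last by move=> u _; rewrite erX.
have : (w - 1) * \sum_(i < n) w ^+ i = 0.
  by rewrite -subrX1 -erX er_dvd ?subrr// dvdz_mull.
by move/eqP; rewrite mulf_eq0 subr_eq0 (negPf w1) => /eqP.
Qed.

End Exponentials.

(** * Cubic Gauss sums *)

Section PeriodicSums.
Context {V : nmodType}.

Definition mod_periodic (q : nat) (f : int -> V) :=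
  forall a b : int, (q%:Z %| a - b)%Z -> f a = f b.

(** Incongruent and q in number, the values [h i] form a complete residue system, so reduction mod q
    is a bijection onto the indices. Shifts, reflections, dilations and Chinese remainder
    coordinates are all instances. *)
Lemma sum_residues (q : nat) (f : int -> V) (I : finType) (h : I -> int) :
  (0 < q)%N -> mod_periodic q f -> #|I| = q ->
  (forall i j, (q%:Z %| h i - h j)%Z -> i = j) ->
  \sum_i f (h i) = \sum_(y < q) f (y : nat)%:Z.
Proof.
move=> q0 pf cI hinj.
have q0z : q%:Z != 0 by lia.
have lt i : (`|h i %% q%:Z|%Z < q)%N.
  have := ltz_pmod (h i) (_ : 0 < q%:Z); have := modz_ge0 (h i) q0z; lia.
pose phi i := Ordinal (lt i).
have phiE i : (phi i : nat)%:Z = (h i %% q%:Z)%Z.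
  by rewrite /phi/= gez0_abs// modz_ge0.
have phi_inj : injective phi.
  move=> i j ij; apply: hinj.
  have /eqP : (h i %% q%:Z)%Z = (h j %% q%:Z)%Z by rewrite -!phiE ij.
  by rewrite eqz_mod_dvd.
have phi_bij : bijective phi by apply: inj_card_bij => //; rewrite card_ord cI.
rewrite [RHS](reindex phi)/=; last exact: onW_bij.
apply: eq_bigr => i _; rewrite gez0_abs ?modz_ge0//; apply: pf.
by rewrite {1}(divz_eq (h i) q%:Z) addrK dvdz_mull.
Qed.

Lemma dvdz_lt_eq (q : nat) (a b : nat) :
  (a < q)%N -> (b < q)%N -> (q%:Z %| a%:Z - b%:Z)%Z -> a = b.
Proof.
move=> aq bq; rewrite -eqz_mod_dvd => /eqP.
by rewrite !modz_small ?lez_nat ?ltz_nat//= => -[].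
Qed.

Lemma sum_shift (q : nat) (f : int -> V) (c : int) : (0 < q)%N ->
  mod_periodic q f -> \sum_(y < q) f ((y : nat)%:Z + c) = \sum_(y < q) f (y : nat)%:Z.
Proof.
move=> q0 pf.
apply: (@sum_residues q f 'I_q (fun y : 'I_q => (y : nat)%:Z + c)) => //.
  by rewrite card_ord.
move=> i j /=; rewrite opprD addrACA subrr addr0 => h; apply: val_inj.
exact: (dvdz_lt_eq (ltn_ord i) (ltn_ord j) h).
Qed.

Lemma sum_blocks (q k : nat) (f : int -> V) : (0 < q)%N -> (0 < k)%N ->
  \sum_(y < q * k) f (y : nat)%:Z =
  \sum_(y < q) \sum_(t < k) f ((y : nat)%:Z + q%:Z * (t : nat)%:Z).
Proof.
move=> q0 k0; rewrite pair_bigA/=.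
(* [f] itself need not be periodic; its periodic extension from [0, qk) is, and agrees with [f] at
   every point that occurs. *)
pose f' (a : int) := f (a %% (q * k)%:Z)%Z.
have pf : mod_periodic (q * k) f'.
  by move=> a b; rewrite -eqz_mod_dvd => /eqP h; rewrite /f' h.
have f'E (a : nat) : (a < q * k)%N -> f' a%:Z = f a%:Z.
  by move=> h; rewrite /f' modz_small// lez_nat ltz_nat.
transitivity (\sum_(y < q * k) f' (y : nat)%:Z).
  by apply: eq_bigr => y _; rewrite f'E.
rewrite -(@sum_residues (q * k) f' ('I_q * 'I_k)%type
  (fun yt : 'I_q * 'I_k => (yt.1 : nat)%:Z + q%:Z * (yt.2 : nat)%:Z)) ?muln_gt0 ?q0//.
- apply: eq_bigr => -[y t] _ /=; rewrite -PoszM -PoszD f'E//.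
  have := ltn_ord y; have := ltn_ord t; nia.
- by rewrite card_prod !card_ord.
- move=> [y t] [y' t'] /= h.
  have E : (y + q * t = y' + q * t')%N.
    apply: (@dvdz_lt_eq (q * k)); last by rewrite !PoszD !PoszM.
      have := ltn_ord y; have := ltn_ord t; nia.
    have := ltn_ord y'; have := ltn_ord t'; nia.
  have hy := ltn_ord y; have hy' := ltn_ord y'.
  have yy : (y = y' :> nat).
    have /(congr1 (modn^~ q)) := E.
    by rewrite ![(_ + q * _)%N]addnC ![(q * _)%N]mulnC !modnMDl !modn_small.
  congr pair; apply: val_inj => //=.
  move: E; rewrite yy => /addnI/eqP; rewrite eqn_pmul2l// => /eqP //.
Qed.

Lemma sum_multiple_period (q k : nat) (f : int -> V) : (0 < q)%N -> (0 < k)%N ->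
  mod_periodic q f ->
  \sum_(y < q * k) f (y : nat)%:Z = (\sum_(y < q) f (y : nat)%:Z) *+ k.
Proof.
move=> q0 k0 pf; rewrite sum_blocks// -sumrMnl; apply: eq_bigr => y _.
rewrite (eq_bigr (fun=> f (y : nat)%:Z)) ?sumr_const ?card_ord// => t _.
by apply: pf; rewrite addrC addKr dvdz_mulr.
Qed.

End PeriodicSums.

(** * Complete cubic sums and their size at prime moduli *)

Section CubicSums.
Context {R : realType}.
Local Notation er := (@er R).

Definition cubic_sum (v : int) (q : nat) : R[i] :=
  \sum_(y < q) er q (v * (y : nat)%:Z ^+ 3).

Lemma cubic_sumE (v : int) (q : nat) :
  cubic_sum v q = \sum_(y < q) er q (v * (y : nat)%:Z ^+ 3).
Proof. by []. Qed.

Lemma dvdz_exp_sub (q : int) (a b : int) n :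
  (q %| a - b)%Z -> (q %| a ^+ n - b ^+ n)%Z.
Proof. by move=> h; rewrite subrXX dvdz_mulr. Qed.

Lemma er_cube_periodic (q : nat) (v : int) :
  mod_periodic q (fun y => er q (v * y ^+ 3)).
Proof.
move=> a b h /=; apply: er_eqmod.
by rewrite -mulrBr dvdz_mull// dvdz_exp_sub.
Qed.

Lemma cubic_sum_eqmod (q : nat) (v w : int) : (q%:Z %| v - w)%Z ->
  cubic_sum v q = cubic_sum w q.
Proof.
move=> h; apply: eq_bigr => y _; apply: er_eqmod.
by rewrite -mulrBl dvdz_mulr.
Qed.

Lemma cubic_sum_scale (k q : nat) (v : int) : (0 < k)%N -> (0 < q)%N ->
  cubic_sum (k%:Z * v) (k * q) = k%:R * cubic_sum v q.
Proof.
move=> k0 q0; rewrite /cubic_sum.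
rewrite (eq_bigr (fun y : 'I_(k * q) => er q (v * (y : nat)%:Z ^+ 3))); last first.
  by move=> y _; rewrite -mulrA er_scale.
rewrite mulnC (@sum_multiple_period _ q k (fun y => er q (v * y ^+ 3)))//.
  by rewrite mulr_natl.
exact: er_cube_periodic.
Qed.

Lemma coprime_dvdz (m n : nat) (a : int) : coprime m n ->
  (m%:Z %| n%:Z * a)%Z -> (m%:Z %| a)%Z.
Proof. by move=> co; rewrite Gauss_dvdzr// /coprimez -coprimeE. Qed.

(** Residues mod mn are written n y + m t; the mixed terms of the cube are multiples of mn, which
    separates the two exponentials. *)
Lemma cubic_sum_crt (m n : nat) (v : int) :
  (0 < m)%N -> (0 < n)%N -> coprime m n ->
  cubic_sum v (m * n) = cubic_sum (v * n%:Z ^+ 2) m * cubic_sum (v * m%:Z ^+ 2) n.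
Proof.
move=> m0 n0 co.
rewrite {1}/cubic_sum.
rewrite -(@sum_residues _ (m * n) (fun y => er (m * n) (v * y ^+ 3)) ('I_m * 'I_n)%type
  (fun yt : 'I_m * 'I_n => n%:Z * (yt.1 : nat)%:Z + m%:Z * (yt.2 : nat)%:Z)) ?muln_gt0 ?m0//.
- rewrite /cubic_sum big_distrlr/= pair_bigA/=; apply: eq_bigr => -[y t] _ /=.
  set Y := (y : nat)%:Z; set T := (t : nat)%:Z.
  transitivity (er (n * m) (n%:Z * (v * n%:Z ^+ 2 * Y ^+ 3))
               * er (m * n) (m%:Z * (v * m%:Z ^+ 2 * T ^+ 3))).
    rewrite [X in er X _ * _]mulnC -erD; apply: er_eqmod.
    apply/dvdzP; exists (v * 3 * Y * T * (n%:Z * Y + m%:Z * T)).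
    rewrite PoszM; ring.
  by rewrite !er_scale.
- exact: er_cube_periodic.
- by rewrite card_prod !card_ord.
- move=> [y t] [y' t'] /= h.
  have hm : (m%:Z %| n%:Z * ((y : nat)%:Z - (y' : nat)%:Z))%Z.
    have : (m%:Z %| n%:Z * (y : nat)%:Z + m%:Z * (t : nat)%:Z -
             (n%:Z * (y' : nat)%:Z + m%:Z * (t' : nat)%:Z))%Z.
      by apply: dvdz_trans h; rewrite PoszM dvdz_mulr.
    have -> : n%:Z * (y : nat)%:Z + m%:Z * (t : nat)%:Z -
             (n%:Z * (y' : nat)%:Z + m%:Z * (t' : nat)%:Z) =
      n%:Z * ((y : nat)%:Z - (y' : nat)%:Z) + m%:Z * ((t : nat)%:Z - (t' : nat)%:Z) by ring.
    rewrite rpredDr; [exact: id|exact: dvdz_mulr].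
  have hn : (n%:Z %| m%:Z * ((t : nat)%:Z - (t' : nat)%:Z))%Z.
    have : (n%:Z %| n%:Z * (y : nat)%:Z + m%:Z * (t : nat)%:Z -
             (n%:Z * (y' : nat)%:Z + m%:Z * (t' : nat)%:Z))%Z.
      by apply: dvdz_trans h; rewrite PoszM dvdz_mull.
    have -> : n%:Z * (y : nat)%:Z + m%:Z * (t : nat)%:Z -
             (n%:Z * (y' : nat)%:Z + m%:Z * (t' : nat)%:Z) =
      m%:Z * ((t : nat)%:Z - (t' : nat)%:Z) + n%:Z * ((y : nat)%:Z - (y' : nat)%:Z) by ring.
    rewrite rpredDr; [exact: id|exact: dvdz_mulr].
  congr pair; apply: val_inj => /=.
    exact: (dvdz_lt_eq (ltn_ord y) (ltn_ord y') (coprime_dvdz co hm)).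
  apply: (dvdz_lt_eq (ltn_ord t) (ltn_ord t')); apply: coprime_dvdz hn.
  by rewrite coprime_sym.
Qed.

Lemma card_cube_roots (p : nat) (a c : int) : prime p -> ~~ (p%:Z %| a)%Z ->
  (#|[pred x : 'I_p | (p%:Z %| (a * (x : nat)%:Z ^+ 3 - c)%R)%Z]| <= 3)%N.
Proof.
move=> pr pa.
have ch : p \in [pchar 'F_p] by exact: pchar_Fp.
have dvE (z : int) : ((z%:~R : 'F_p) == 0) = (p%:Z %| z)%Z.
  case: z => n; first by rewrite -pmulrn -(dvdn_pcharf ch).
  rewrite NegzE mulrNz oppr_eq0 -pmulrn -(dvdn_pcharf ch).
  by [].
pose P : {poly 'F_p} := a%:~R *: 'X^3 - c%:~R%:P.
have a0 : (a%:~R : 'F_p) != 0 by rewrite dvE.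
have sP : size P = 4%N.
  rewrite /P size_polyDl ?size_scale ?size_polyXn//.
  by rewrite size_polyN size_polyC; case: eqP.
set A := [pred x : 'I_p | _].
pose s := [seq ((x : nat)%:R : 'F_p) | x : 'I_p <- enum A].
have : (size s < size P)%N.
  apply: max_poly_roots; first by rewrite -size_poly_eq0 sP.
    apply/allP => z /mapP[x]; rewrite mem_enum inE => xA ->.
    rewrite -dvE rmorphB rmorphM rmorphXn/= -pmulrn in xA.
    by rewrite rootE /P hornerD hornerN hornerC hornerZ hornerXn.
  rewrite map_inj_uniq ?enum_uniq// => x y /eqP xy; apply: val_inj.
  apply: (dvdz_lt_eq (ltn_ord x) (ltn_ord y)).
  by rewrite -dvE intrD mulrNz -!pmulrn subr_eq0.
by rewrite sP size_map -cardE ltnS.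
Qed.



Lemma cabs_sqr (z : R[i]) : ((cabs z) ^+ 2)%:C = z * z^*.
Proof. by rewrite rmorphXn/= -normcE' sqr_normc. Qed.

(** Orthogonality in r counts the pairs with x^3 = y^3 mod p, at most three for each x. *)
Lemma cubic_sum_moment (p : nat) : prime p ->
  \sum_(r < p) cabs (cubic_sum (r : nat)%:Z p) ^+ 2 <= 3 * p%:R ^+ 2 :> R.
Proof.
move=> pr; have p0 := prime_gt0 pr.
rewrite -lecR rmorph_sum/=.
have -> : \sum_(r < p) (cabs (cubic_sum (r : nat)%:Z p) ^+ 2)%:C =
  \sum_(x < p) \sum_(y < p) \sum_(r < p)
    er p (((x : nat)%:Z ^+ 3 - (y : nat)%:Z ^+ 3) * (r : nat)%:Z).
  transitivity (\sum_(r < p) \sum_(x < p) \sum_(y < p)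
      er p (((x : nat)%:Z ^+ 3 - (y : nat)%:Z ^+ 3) * (r : nat)%:Z)).
    apply: eq_bigr => r _; rewrite cabs_sqr /cubic_sum rmorph_sum big_distrlr/=.
    apply: eq_bigr => x _; apply: eq_bigr => y _.
    by rewrite -erN -erD; congr er; ring.
  rewrite exchange_big/=; apply: eq_bigr => x _.
  by rewrite exchange_big.
have H (x : 'I_p) : \sum_(y < p) \sum_(r < p)
    er p (((x : nat)%:Z ^+ 3 - (y : nat)%:Z ^+ 3) * (r : nat)%:Z) <= (3 * p%:R)%:C.
  under eq_bigr => y _ do rewrite er_geom//.
  rewrite -big_mkcond/= sumr_const mulr_natl rmorphMn/= rmorph_nat.
  apply: ler_wpMn2l; first exact: ler0n.
  have np1 : ~~ (p%:Z %| 1)%Z.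
    by rewrite dvdzE/= dvdn1 neq_ltn prime_gt1// orbT.
  apply: leq_trans (card_cube_roots ((x : nat)%:Z ^+ 3) pr np1).
  apply: subset_leq_card; apply/fintype.subsetP => y; rewrite !inE => h.
  by rewrite mul1r -opprB rpredN.
apply: le_trans (ler_sum _ (fun x _ => H x)) _.
rewrite sumr_const card_ord -rmorphMn lecR/=.
by rewrite -mulr_natr -mulrA -expr2.
Qed.

Lemma cubic_sum_twist (p : nat) (v c : int) : prime p -> ~~ (p%:Z %| c)%Z ->
  cubic_sum (v * c ^+ 3) p = cubic_sum v p.
Proof.
move=> pr pc; have p0 := prime_gt0 pr.
rewrite /cubic_sum -(@sum_residues _ p (fun y => er p (v * y ^+ 3)) 'I_p
  (fun y : 'I_p => c * (y : nat)%:Z)) ?card_ord//.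
- by apply: eq_bigr => y _; congr er; ring.
- exact: er_cube_periodic.
- move=> i j; rewrite -mulrBr Gauss_dvdzr; last first.
    by rewrite /coprimez /gcdz/= (eqP (_ : coprime p `|c|)) // prime_coprime.
  by move=> h; apply: val_inj; exact: (dvdz_lt_eq (ltn_ord i) (ltn_ord j)).
Qed.

(** An averaging argument in place of Weil's bound: |S| is constant along v c^3, and each residue is
    hit by at most 3 values of c, so (p - 1)|S|^2 is at most 3 times the second moment 3 p^2. Then p
    <= 2 (p - 1) turns 9 into 18. *)
Lemma cubic_sum_prime (p : nat) (v : int) : prime p -> ~~ (p%:Z %| v)%Z ->
  cabs (cubic_sum v p) ^+ 2 <= 18 * p%:R :> R.
Proof.
move=> pr pv; have p0 := prime_gt0 pr; have p1 := prime_gt1 pr.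
set Sv := cabs _ ^+ 2.
pose phi (r : int) : R := cabs (cubic_sum r p) ^+ 2.
have phip : mod_periodic p phi by move=> a b h; rewrite /phi (cubic_sum_eqmod h).
have H1 : (p.-1)%:R * Sv <= 3 * \sum_(r < p) phi (r : nat)%:Z.
  have -> : (p.-1)%:R * Sv =
      \sum_(c < p | ~~ (p%:Z %| (c : nat)%:Z)%Z) phi (v * (c : nat)%:Z ^+ 3).
    rewrite (eq_bigr (fun=> Sv)); last first.
      by move=> c hc; rewrite /phi cubic_sum_twist.
    rewrite sumr_const mulr_natl; congr (_ *+ _).
    rewrite (eq_card (B := predC1 (Ordinal p0))); first by rewrite cardC1 card_ord.
    move=> c; rewrite !inE /= unfold_in dvdzE/= -val_eqE/=.
    case: (posnP c) => [->|c0]; first by rewrite dvdn0.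
    by rewrite gtnNdvd// -lt0n c0.
  have -> : \sum_(c < p | ~~ (p%:Z %| (c : nat)%:Z)%Z) phi (v * (c : nat)%:Z ^+ 3) =
    \sum_(c < p | ~~ (p%:Z %| (c : nat)%:Z)%Z)
      \sum_(r < p | (p%:Z %| v * (c : nat)%:Z ^+ 3 - (r : nat)%:Z)%Z) phi (r : nat)%:Z.
    apply: eq_bigr => c _.
    have pz : p%:Z != 0 by lia.
    have lt : (`|(v * (c : nat)%:Z ^+ 3) %% p%:Z|%Z < p)%N.
      have := ltz_pmod (v * (c : nat)%:Z ^+ 3) (_ : 0 < p%:Z).
      have := modz_ge0 (v * (c : nat)%:Z ^+ 3) pz; lia.
    have dv : (p%:Z %| v * (c : nat)%:Z ^+ 3 - (v * (c : nat)%:Z ^+ 3 %% p%:Z)%Z)%Z.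
      by rewrite -eqz_mod_dvd modz_mod.
    rewrite (big_pred1 (Ordinal lt))/=.
      by rewrite gez0_abs ?modz_ge0//; apply: phip.
    move=> r; apply/idP/eqP => [h|->]/=; last by rewrite gez0_abs ?modz_ge0.
    apply: val_inj => /=; apply: (dvdz_lt_eq (ltn_ord r) lt).
    rewrite gez0_abs ?modz_ge0//.
    by rewrite -eqz_mod_dvd modz_mod eq_sym eqz_mod_dvd.
  rewrite big_mkcond/= mulr_sumr.
  have -> : \sum_(c < p) (if ~~ (p%:Z %| (c : nat)%:Z)%Z then
       \sum_(r < p | (p%:Z %| v * (c : nat)%:Z ^+ 3 - (r : nat)%:Z)%Z) phi (r : nat)%:Z else 0)
    = \sum_(r < p) \sum_(c < p | ~~ (p%:Z %| (c : nat)%:Z)%Z &&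
         (p%:Z %| v * (c : nat)%:Z ^+ 3 - (r : nat)%:Z)%Z) phi (r : nat)%:Z.
    by rewrite -big_mkcond/= (exchange_big_dep xpredT).
  apply: ler_sum => r _; rewrite sumr_const -[_ *+ _]mulr_natl.
  rewrite ler_wpM2r ?sqr_ge0// ler_nat.
  apply: leq_trans (card_cube_roots (r : nat)%:Z pr pv).
  by apply: subset_leq_card; apply/fintype.subsetP => y; rewrite !inE => /andP[].
have H2 := cubic_sum_moment pr.
have H3 : (p.-1)%:R * Sv <= 9 * p%:R ^+ 2.
  by apply: le_trans H1 _; rewrite [9](_ : _ = 3 * 3) -?mulrA ?ler_pM2l//; ring.
have pp : p%:R <= 2 * (p.-1)%:R :> R by rewrite -natrM ler_nat; lia.
have p0R : 0 < p%:R :> R by rewrite ltr0n.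
have S0 : 0 <= Sv by rewrite sqr_ge0.
rewrite -(ler_pM2l p0R); nra.
Qed.

End CubicSums.

Lemma dvdz_prime_mul (p : nat) (a b : int) : prime p ->
  (p%:Z %| a * b)%Z = (p%:Z %| a)%Z || (p%:Z %| b)%Z.
Proof. by move=> pr; rewrite !dvdzE/= abszM Euclid_dvdM. Qed.

Lemma dvdz_prime_exp (p : nat) (a : int) n : prime p -> (0 < n)%N ->
  (p%:Z %| a ^+ n)%Z = (p%:Z %| a)%Z.
Proof. by move=> pr n0; rewrite !dvdzE/= abszX Euclid_dvdX// n0 andbT. Qed.

Lemma prime_dvd3 (p : nat) : prime p -> (p%:Z %| 3)%Z = (p == 3).
Proof. by move=> pr; rewrite dvdzE/= dvdn_prime2. Qed.

Lemma dvdz_3vsq (p : nat) (v y : int) : prime p -> p != 3 ->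
  ~~ (p%:Z %| v)%Z -> (p%:Z %| v * 3 * y ^+ 2)%Z = (p%:Z %| y)%Z.
Proof.
move=> pr p3 pv.
rewrite (dvdz_prime_mul (v * 3))// (dvdz_prime_mul v)// dvdz_prime_exp//.
by rewrite prime_dvd3// (negPf p3) (negPf pv).
Qed.

(** * Reduction of the exponent at prime powers *)

Section PrimePowers.
Context {R : realType}.
Local Notation er := (@er R).
Local Notation cubic_sum := (@cubic_sum R).

(** With A = pM and y replaced by y + A t, the two divisibility hypotheses make the cube linear in t
    modulo A T. The sum over t then vanishes unless T divides 3 v y^2, that is unless y = p b. *)
Lemma cubic_sum_step (p M T : nat) (v : int) :
  (0 < p)%N -> (0 < M)%N -> (0 < T)%N ->
  (p * M * T %| 3 * (p * M) ^ 2)%N -> (p * M * T %| (p * M) ^ 3)%N ->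
  (forall y : int, (T%:Z %| v * 3 * y ^+ 2)%Z = (p%:Z %| y)%Z) ->
  cubic_sum v (p * M * T) =
  T%:R * \sum_(b < M) er (p * M * T) (p%:Z ^+ 3 * (v * (b : nat)%:Z ^+ 3)).
Proof.
move=> p0 M0 T0 d2 d3 H; rewrite !cubic_sumE.
set A := (p * M)%N in d2 d3 *; have A0 : (0 < A)%N by rewrite muln_gt0 p0.
rewrite (@sum_blocks _ A T (fun y => er (A * T) (v * y ^+ 3)))//.
have E (y : int) : \sum_(t < T) er (A * T) (v * (y + A%:Z * (t : nat)%:Z) ^+ 3) =
    (if (p%:Z %| y)%Z then T%:R * er (A * T) (v * y ^+ 3) else 0).
  transitivity (er (A * T) (v * y ^+ 3) *
                \sum_(t < T) er T (v * 3 * y ^+ 2 * (t : nat)%:Z)).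
    rewrite mulr_sumr; apply: eq_bigr => t _.
    rewrite -(@er_scale _ A T)// -erD; apply: er_eqmod.
    set s := (t : nat)%:Z.
    have -> : v * (y + A%:Z * s) ^+ 3 - (v * y ^+ 3 + A%:Z * (v * 3 * y ^+ 2 * s))
      = v * y * s ^+ 2 * (3 * A%:Z ^+ 2) + v * s ^+ 3 * A%:Z ^+ 3 by ring.
    by rewrite rpredD// dvdz_mull// -?PoszM -?PoszX.
  by rewrite er_geom// H; case: ifP => _; rewrite ?mulr0// mulrC.
pose f (y : int) : R[i] :=
  if (p%:Z %| y)%Z then T%:R * er (A * T) (v * y ^+ 3) else 0.
transitivity (\sum_(y < p * M) f (y : nat)%:Z); first by apply: eq_bigr => y _; rewrite E.
rewrite (@sum_blocks _ p M f)// {}/f {E}.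
rewrite /A in d2 d3 A0 *; clear A.
case: p p0 d2 d3 H A0 => // p p0 d2 d3 H A0.
rewrite big_ord_recl/= [X in _ + X]big1 ?addr0; last first.
  move=> y _; rewrite big1// => t _; case: ifP => //.
  rewrite rpredDr ?dvdz_mulr// dvdzE/= gtnNdvd//=.
  by rewrite /bump/= add1n ltnS.
rewrite mulr_sumr; apply: eq_bigr => t _; rewrite add0r dvdz_mulr//.
by congr (_ * er _ _); ring.
Qed.

Lemma cubic_sum_sq (p : nat) (v : int) : prime p -> p != 3 ->
  ~~ (p%:Z %| v)%Z -> cubic_sum v (p ^ 2) = p%:R.
Proof.
move=> pr p3 pv; have p0 := prime_gt0 pr.
rewrite expnS expn1 -{1}[p]muln1 (@cubic_sum_step p 1 p)// ?muln1.
- by rewrite big_ord1 expr0n/= !mulr0 er0 mulr1.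
- by rewrite ?muln1 mulnn dvdn_mull.
- by rewrite ?muln1 mulnn dvdn_exp2l.
- by move=> y; apply: dvdz_3vsq.
Qed.

End PrimePowers.

Lemma PoszX (m n : nat) : (m ^ n)%N%:Z = m%:Z ^+ n.
Proof. by elim: n => // n IH; rewrite expnS PoszM IH exprS. Qed.

Section CubicSumBound.
Context {R : realType}.
Local Notation er := (@er R).
Local Notation cubic_sum := (@cubic_sum R).

Lemma cubic_sum_cube (p k : nat) (v : int) : prime p ->
  ~~ (p%:Z %| v)%Z -> cubic_sum v (p ^ k.+3) = p%:R ^+ 2 * cubic_sum v (p ^ k).
Proof.
move=> pr pv; have p0 := prime_gt0 pr.
have pk0 j : (0 < p ^ j)%N by rewrite expn_gt0 p0.
have fin M T : (p * M * T = p ^ k.+3)%N ->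
    T%:R * \sum_(b < M) er (p * M * T) (p%:Z ^+ 3 * (v * (b : nat)%:Z ^+ 3)) =
    T%:R * \sum_(b < M) er (p ^ k) (v * (b : nat)%:Z ^+ 3).
  move=> ->; congr (_ * _); apply: eq_bigr => b _.
  by rewrite -addn3 addnC expnD -PoszX er_scale.
(* For p = 3 the coefficient 3 of the linear term interferes, and the step is taken with T = 9: 9
   divides 3 v y^2 exactly when 3 divides y. *)
have [p3|p3] := eqVneq p 3%N.
  have E : (p ^ k.+3 = p * p ^ k * 9)%N by rewrite p3 !expnS; lia.
  rewrite {1}E (@cubic_sum_step _ p (p ^ k) 9)//.
  - by rewrite fin -?E// -natrX p3.
  - rewrite p3; have := pk0 k; rewrite p3; move: (3 ^ k)%N => x x0.
    by apply/dvdnP; exists x; lia.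
  - rewrite p3; have := pk0 k; rewrite p3; move: (3 ^ k)%N => x x0.
    by apply/dvdnP; exists (x ^ 2)%N; lia.
  - move=> y; rewrite -[9%:Z]/(3 * 3 : int) -mulrA [v * _]mulrCA.
    rewrite dvdz_mul2l// -[3]/(3%:Z) -p3.
    by rewrite dvdz_prime_mul// dvdz_prime_exp// (negPf pv).
(* For other p, T = p supplies one factor p. The second one arises because b runs through p full
   periods of the sum mod p^k. *)
have E : (p ^ k.+3 = p * p ^ k.+1 * p)%N by rewrite !expnS; lia.
rewrite {1}E (@cubic_sum_step _ p (p ^ k.+1) p)//.
- rewrite fin -?E// expr2 -mulrA; congr (_ * _).
  rewrite expnSr (@sum_multiple_period _ (p ^ k) p (fun y => er (p ^ k) (v * y ^+ 3)))//.
    by rewrite mulr_natl.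
  exact: er_cube_periodic.
- rewrite -E -expnS -expnM; apply: dvdn_mull; rewrite dvdn_exp2l//; lia.
- rewrite -E -expnS -expnM dvdn_exp2l//; lia.
- by move=> y; exact: dvdz_3vsq.
Qed.

Definition gabs (v : int) (q : nat) : R := cabs (cubic_sum v q) / q%:R.

Lemma gabs_ge0 v q : 0 <= gabs v q.
Proof. by rewrite /gabs divr_ge0 ?cabs_ge0. Qed.

Lemma gabs_le1 v q : gabs v q <= 1.
Proof.
rewrite /gabs; have [->|q0] := posnP q; first by rewrite invr0 mulr0.
rewrite ler_pdivrMr ?ltr0n// mul1r (le_trans (cabs_sum _ _ _))//.
by under eq_bigr do rewrite cabs_er; rewrite sumr_const card_ord.
Qed.

(** Model size of a normalised cubic sum of modulus a b^2 c^3. The exponent 9/20 is kept below 1/2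
    so that at large primes it swallows the constant of the prime bound. *)
Definition shape3 (a b c : nat) : R :=
  a%:R `^ (- (9 / 20)) * b%:R^-1 * c%:R^-1.

Lemma shape3_ge0 a b c : 0 <= shape3 a b c.
Proof. by rewrite /shape3 !mulr_ge0 ?powR_ge0 ?invr_ge0. Qed.

Lemma shape3M a b c a' b' c' :
  shape3 (a * a') (b * b') (c * c') = shape3 a b c * shape3 a' b' c'.
Proof. by rewrite /shape3 !natrM powRM// !invfM; ring. Qed.

Lemma powR_natr10 (x : R) : 0 <= x -> (x `^ (10^-1)) ^+ 10 = x.
Proof. by move=> x0; rewrite -powR_mulrn ?powR_ge0// -powRrM mulVf ?powRr1// pnatr_eq0. Qed.

(** Once p > 18^10 the constant 18 is below p^(1/10), so 18/p <= p^(-9/10) with no constant left.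
    Only finitely many primes contribute a factor, which keeps a product over the primes of n
    bounded. *)
Lemma gabs_prime_bound : exists2 P0 : nat, (3 <= P0)%N &
  forall p v, prime p -> ~~ (p%:Z %| v)%Z ->
    gabs v p <= (if (p <= P0)%N then P0%:R else 1) * shape3 p 1 1.
Proof.
pose P0 := (18 ^ 10)%N.
have P03 : (3 <= P0)%N by rewrite (@leq_trans (18 ^ 1)) ?leq_exp2l.
have PE : P0%:R = 18 ^+ 10 :> R by rewrite natrX.
(* The body of [P0] is forgotten, so that the unary number 18^10 is never computed. *)
move: P0 P03 PE => P0 P03 PE.
exists P0 => // p v pr pv; have p0 := prime_gt0 pr.
have p1 : 1 <= p%:R :> R by rewrite ler1n.
have pR : 0 < p%:R :> R by rewrite ltr0n.
rewrite /shape3 !invr1 !mulr1; case: leqP => pP.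
  apply: (le_trans (gabs_le1 _ _)); rewrite powRN ler_pdivlMr ?powR_gt0// mul1r.
  apply: (@le_trans _ _ p%:R); last by rewrite ler_nat.
  by rewrite ler1_powR//; lra.
rewrite mul1r -ler_sqr ?nnegrE ?powR_ge0 ?gabs_ge0//.
have H := @cubic_sum_prime R p v pr pv.
have -> : (p%:R `^ (- (9 / 20))) ^+ 2 = p%:R `^ (10^-1) / p%:R :> R.
  rewrite -powR_mulrn ?powR_ge0// -powRrM.
  have -> : - (9 / 20) * 2%:R = 10^-1 - 1 :> R by lra.
  rewrite powRB; first by rewrite powRr1.
  by rewrite lt0r_neq0// implybT.
apply: (@le_trans _ _ (18 * p%:R / p%:R ^+ 2)).
  by rewrite /gabs expr_div_n; apply: ler_wpM2r => //; rewrite invr_ge0 sqr_ge0.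
have -> : 18 * p%:R / p%:R ^+ 2 = 18 / p%:R :> R by field; rewrite lt0r_neq0.
rewrite ler_wpM2r ?invr_ge0//.
rewrite -(@ler_pXn2r _ 10)// ?nnegrE ?powR_ge0//.
by rewrite powR_natr10 ?ler0n// -PE ler_nat ltnW.
Qed.

Lemma gabs_mul (m n : nat) (v : int) : (0 < m)%N -> (0 < n)%N -> coprime m n ->
  gabs v (m * n) = gabs (v * n%:Z ^+ 2) m * gabs (v * m%:Z ^+ 2) n.
Proof.
move=> m0 n0 co; rewrite /gabs cubic_sum_crt// cabsM natrM invfM; ring.
Qed.

(** The exponent is lowered by 3 at a time, each step moving one p into c; a remainder 1 puts p into
    a, a remainder 2 puts it into b. *)
Lemma gabs_pp_bound : exists2 P0 : nat, (3 <= P0)%N &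
  forall p v k, prime p -> ~~ (p%:Z %| v)%Z ->
    exists abc : nat * nat * nat,
      [/\ (0 < abc.1.1)%N, (0 < abc.1.2)%N & (0 < abc.2)%N] /\
      [/\ (p ^ k = abc.1.1 * abc.1.2 ^ 2 * abc.2 ^ 3)%N &
      gabs v (p ^ k) <= (if (p <= P0)%N then P0%:R else 1)
         * shape3 abc.1.1 abc.1.2 abc.2].
Proof.
have [P0 P03 H] := gabs_prime_bound; exists P0 => // p v k pr pv.
have p0 := prime_gt0 pr.
have P01 : 1 <= P0%:R :> R by rewrite ler1n; lia.
have K1 : 1 <= (if (p <= P0)%N then P0%:R else 1) :> R by case: ifP.
have sh1 : shape3 1 1 1 = 1 by rewrite /shape3 powR1 !invr1 !mulr1.
elim/ltn_ind: k => -[|[|[|k]]] IH.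
- exists (1, 1, 1)%N; split=> //; split=> //=.
  by rewrite sh1 mulr1 expn0 (le_trans (gabs_le1 _ _)).
- exists (p, 1, 1)%N; split=> //; split; first by rewrite /= !exp1n !muln1.
  by rewrite expn1; apply: H.
- exists (1, p, 1)%N; split=> //; split; first by rewrite /= exp1n mul1n muln1.
  rewrite /= /shape3 powR1 invr1 mul1r mulr1.
  (* The modulus 9 falls under the small primes, because 3 <= P0. *)
  have [p3|p3] := eqVneq p 3%N.
    rewrite (le_trans (gabs_le1 _ _))// ler_pdivlMr ?ltr0n// mul1r.
    by rewrite {1}p3; case: ifP => [_|]; rewrite ?ler_nat// p3 P03.
  rewrite /gabs cubic_sum_sq// cabs_nat natrX expr2 invfM mulrA divff ?pnatr_eq0 -?lt0n//.
  by rewrite ler_wpM2r// invr_ge0.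
- have [|[[a b] c] /= [[a0 b0 c0] [E B]]] := IH k; first by lia.
  exists (a, b, p * c)%N; split=> /=; first by rewrite muln_gt0 p0.
  split; first by rewrite -addn3 expnD E expnMn; lia.
  have -> : shape3 a b (p * c) = p%:R^-1 * shape3 a b c.
    by rewrite /shape3 natrM invfM; ring.
  have -> : gabs v (p ^ k.+3) = p%:R^-1 * gabs v (p ^ k).
    rewrite /gabs cubic_sum_cube// cabsM cabsX cabs_nat -addn3 expnD natrM invfM.
    rewrite natrX [(p ^ 3)%:R]natrX; field.
    by rewrite -natrX !pnatr_eq0 -!lt0n expn_gt0 p0.
  by rewrite [leRHS]mulrCA; apply: ler_wpM2l => //; rewrite invr_ge0.
Qed.

Lemma gabs_bound : exists2 K : R, 0 < K &
  forall (n : nat) v, (0 < n)%N -> coprimez v n%:Z ->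
    exists abc : nat * nat * nat,
      [/\ (0 < abc.1.1)%N, (0 < abc.1.2)%N & (0 < abc.2)%N] /\
      [/\ (n = abc.1.1 * abc.1.2 ^ 2 * abc.2 ^ 3)%N &
      gabs v n <= K * shape3 abc.1.1 abc.1.2 abc.2].
Proof.
have [P0 P03 H] := gabs_pp_bound.
have P01 : 1 <= P0%:R :> R by rewrite ler1n; lia.
exists (P0%:R ^+ P0.+1); first by rewrite exprn_gt0// (lt_le_trans ltr01).
(* The induction strips the least prime factor, and [s] bounds the remaining primes from below. A
   prime p <= P0 costs one factor P0 and raises [s] to p + 1, so the exponent P0 + 1 - s
   suffices. *)
suff G : forall (n : nat) (s : nat) v, (0 < n)%N -> coprimez v n%:Z ->
    (forall p, prime p -> (p %| n)%N -> (s <= p)%N) ->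
    exists abc : nat * nat * nat,
      [/\ (0 < abc.1.1)%N, (0 < abc.1.2)%N & (0 < abc.2)%N] /\
      [/\ (n = abc.1.1 * abc.1.2 ^ 2 * abc.2 ^ 3)%N &
      gabs v n <= P0%:R ^+ (P0.+1 - s) * shape3 abc.1.1 abc.1.2 abc.2].
  move=> n v n0 co; have := G n 0%N v n0 co; rewrite subn0; apply.
  by move=> p _ _.
elim/ltn_ind => n IH s v n0 co Hs.
have [->|n1] := eqVneq n 1%N.
  exists (1, 1, 1)%N; split=> //; split=> //=.
  rewrite /shape3 powR1 !invr1 !mulr1 (le_trans (gabs_le1 _ _))//.
  by rewrite exprn_ege1.
have {}n1 : (1 < n)%N by lia.
have pr := pdiv_prime n1; have pd := pdiv_dvd n; set p := pdiv n in pr pd.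
have p0 := prime_gt0 pr; have p1 := prime_gt1 pr.
have nE := partnC p n0; rewrite p_part in nE.
set k := logn p n in nE; set m := (n`_p^')%N in nE.
have k0 : (0 < k)%N by rewrite logn_gt0 mem_primes pr n0 pd.
have com : coprime (p ^ k) m by rewrite /k -p_part coprime_partC.
have m0 : (0 < m)%N by rewrite part_gt0.
have mn : (m < n)%N.
  by rewrite -nE -[X in (X < _)%N]mul1n ltn_mul2r m0/= -(expn0 p) ltn_exp2l.
have cop : coprime p m by move: com; rewrite coprime_pexpl.
have cov : coprime `|v| n by [].
have pv : ~~ (p%:Z %| v)%Z.
  by rewrite dvdzE/= -prime_coprime// coprime_sym (coprime_dvdr pd).
have mdn : (m %| n)%N by rewrite -nE dvdn_mull.
have pv1 : ~~ (p%:Z %| v * m%:Z ^+ 2)%Z.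
  rewrite dvdz_prime_mul// negb_or pv dvdz_prime_exp// dvdzE/= -prime_coprime//.
have [[[a b] c] /= [[a0 b0 c0] [E B]]] := H p (v * m%:Z ^+ 2) k pr pv1.
have com2 : coprimez (v * (p ^ k)%:Z ^+ 2) m%:Z.
  rewrite /coprimez/gcdz abszM abszX/= eqz_nat -/(coprime _ _) coprimeMl.
  by rewrite (coprime_dvdr mdn)//= coprimeXl.
have Hm q : prime q -> (q %| m)%N -> (p.+1 <= q)%N.
  move=> qr qm; rewrite ltn_neqAle; apply/andP; split.
    apply/eqP => pq; move: cop; rewrite prime_coprime// pq qm//.
  by apply: pdiv_min_dvd; rewrite ?prime_gt1// (dvdn_trans qm).
have [[[a' b'] c'] /= [[a0' b0' c0'] [E' B']]] := IH m mn p.+1 _ m0 com2 Hm.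
exists (a * a', b * b', c * c')%N; split=> /=; first by rewrite !muln_gt0 a0 a0' b0 b0' c0 c0'.
split; first by rewrite -nE E {1}E'; lia.
rewrite -nE gabs_mul ?expn_gt0 ?p0// shape3M.
apply: le_trans (ler_pM (gabs_ge0 _ _) (gabs_ge0 _ _) B B') _.
rewrite mulrACA ler_wpM2r ?mulr_ge0 ?shape3_ge0//.
have sp : (s <= p)%N by apply: Hs.
case: leqP => pP.
  by rewrite -exprS; apply: ler_weXn2l => //; lia.
by rewrite mul1r; apply: ler_weXn2l => //; lia.
Qed.

End CubicSumBound.

(** * Sixth moments of cubic sums and their tails *)

Section TailBound.
Context {R : realType}.
Local Notation gabs := (@gabs R).
Local Notation shape3 := (@shape3 R).

(** The integral comparison for a convergent power series in telescoping form, from exp y >= 1 + y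
    and ln (1 - 1/x) <= -1/x. *)
Lemma powR_diff (n : nat) (d : R) : 0 < d ->
  d * n.+2%:R `^ (-1 - d) <= n.+1%:R `^ (- d) - n.+2%:R `^ (- d).
Proof.
move=> d0.
set x : R := n.+2%:R; have x0 : 0 < x by rewrite ltr0n.
have -> : n.+1%:R = x * (1 - x^-1) :> R.
  by rewrite mulrBr mulr1 divff ?lt0r_neq0// /x -[n.+2%:R](natr1 n.+1) addrK.
have x1 : x^-1 < 1 by rewrite invf_lt1// ltr1n.
have y0 : 0 < 1 - x^-1 by rewrite subr_gt0.
rewrite powRM ?(ltW x0) ?(ltW y0)// -[X in _ <= _ - X]mulr1 -mulrBr.
have -> : x `^ (-1 - d) = x `^ (- d) * x^-1.
  rewrite addrC powRD ?lt0r_neq0// ?implybT//.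
  by rewrite powR_inv1// ltW.
rewrite mulrCA ler_wpM2l ?powR_ge0//.
have -> : (1 - x^-1) `^ (- d) = expR (- d * ln (1 - x^-1)).
  by rewrite /powR (gt_eqF y0).
have H := expR_ge1Dx (- d * ln (1 - x^-1)).
have L : ln (1 - x^-1) <= - x^-1 by apply: le_ln1Dx; rewrite ltrN2.
rewrite lerBrDl; apply: le_trans H; rewrite lerD2l mulNr -mulrN ler_pM2l//.
by rewrite lerNr.
Qed.

Lemma pseries (d : R) : 0 < d -> exists2 Z : R, 0 <= Z &
  forall N, \sum_(1 <= n < N.+1) n%:R `^ (-1 - d) <= Z.
Proof.
move=> d0; exists (1 + d^-1); first by rewrite addr_ge0// invr_ge0 ltW.
case=> [|N]; first by rewrite big_geq// addr_ge0// invr_ge0 ltW.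
suff : \sum_(1 <= n < N.+2) n%:R `^ (-1 - d) <= 1 + d^-1 * (1 - N.+1%:R `^ (- d)).
  move/le_trans; apply; rewrite lerD2l; apply: ler_piMr.
    by rewrite invr_ge0 ltW.
  by rewrite gerBl powR_ge0.
elim: N => [|N IH].
  by rewrite big_nat1 !powR1 subrr mulr0 addr0.
rewrite big_nat_recr//=; apply: le_trans (lerD IH (lexx _)) _.
rewrite -addrA lerD2l -lerBrDl -mulrBr.
have -> (a b : R) : 1 - b - (1 - a) = a - b by ring.
by rewrite mulrC ler_pdivlMr// mulrC powR_diff.
Qed.

(** The weight n^x is distributed over a, b^2, c^3; the three hypotheses on x are what makes each of
    the three series converge. The 27/10 is 6 times 9/20. *)
Lemma shape6 a b c (n : nat) (x d : R) :
  (0 < a)%N -> (0 < b)%N -> (0 < c)%N -> n = (a * b ^ 2 * c ^ 3)%N ->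
  x - 27 / 10 <= -1 - d -> 2 * x - 6 <= -1 - d -> 3 * x - 6 <= -1 - d ->
  n%:R `^ x * shape3 a b c ^+ 6 <=
  a%:R `^ (-1 - d) * b%:R `^ (-1 - d) * c%:R `^ (-1 - d).
Proof.
move=> a0 b0 c0 -> Ha Hb Hc.
have pow6 (m : nat) : (m%:R^-1 : R) ^+ 6 = m%:R `^ (- 6).
  by rewrite powR_invn// exprVn.
have D (m : nat) (r s : R) : (0 < m)%N -> m%:R `^ r * m%:R `^ s = m%:R `^ (r + s).
  by move=> m0; rewrite powRD// pnatr_eq0 -lt0n m0 implybT.
have -> : (a * b ^ 2 * c ^ 3)%N%:R `^ x = a%:R `^ x * b%:R `^ (2 * x) * c%:R `^ (3 * x) :> R.
  by rewrite natrM natrM !natrX powRM ?mulr_ge0 ?exprn_ge0// powRM ?exprn_ge0// -!powR_mulrn// -!powRrM.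
rewrite /shape3 !exprMn !pow6 -powR_mulrn ?powR_ge0// -powRrM.
have -> : a%:R `^ x * b%:R `^ (2 * x) * c%:R `^ (3 * x) *
   (a%:R `^ (- (9 / 20) * 6%:R) * b%:R `^ (- 6) * c%:R `^ (- 6)) =
   a%:R `^ (x - 27 / 10) * b%:R `^ (2 * x - 6) * c%:R `^ (3 * x - 6).
  rewrite -!D//.
  have -> : - (9 / 20) * 6%:R = - (27 / 10) :> R by lra.
  ring.
by rewrite !ler_pM ?mulr_ge0 ?powR_ge0//; apply: ler_powR; rewrite ?ler1n.
Qed.

Definition gmass (n : nat) : R :=
  \sum_(u < n | coprime u n) gabs (u : nat)%:Z n ^+ 6.

Lemma gmass_ge0 n : 0 <= gmass n.
Proof. by rewrite sumr_ge0// => u _; rewrite exprn_ge0// gabs_ge0. Qed.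

(** The weight n^(2/3 - ep) and the n residues together give x = 5/3 - ep. Then c has exponent 3 x -
    6 = -1 - 3 ep, so that the cubes limit the power to 2/3, and a has exponent below 5/3 - 27/10 =
    -31/30. These two are the entries of the minimum [d]. *)
Lemma gmass_weighted_sum (ep : R) : 0 < ep -> exists2 C : R, 0 <= C &
  forall N, \sum_(1 <= n < N.+1) n%:R `^ (2 / 3 - ep) * gmass n <= C.
Proof.
move=> ep0; have [K K0 HK] := @gabs_bound R.
pose d : R := Num.min (3 * ep) (1 / 30).
have d0 : 0 < d by rewrite /d lt_min; apply/andP; split; lra.
have d1 : d <= 3 * ep by rewrite /d ge_min lexx.
have d2 : d <= 1 / 30 by rewrite /d ge_min lexx orbT.
have [Z Z0 HZ] := pseries d0.
exists (K ^+ 6 * (Z * Z * Z)); first by rewrite !mulr_ge0 ?exprn_ge0// ltW.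
move=> N.
pose f (m : nat) : R := m%:R `^ (-1 - d).
have f0 m : 0 <= f m by exact: powR_ge0.
pose I := 'I_N.+1.
pose w (a b c : I) := (a * b ^ 2 * c ^ 3)%N.
(* The factorisation of n depends on u, so each term is compared with the sum [T] over all
   factorisations of n; at most n residues then cancel the 1/n. *)
have step (n : nat) : (1 <= n < N.+1)%N ->
    n%:R `^ (2 / 3 - ep) * gmass n <=
    K ^+ 6 * \sum_(a : I) \sum_(b : I) \sum_(c : I)
       (if (0 < w a b c)%N && (w a b c == n) then f a * f b * f c else 0).
  move=> /andP[n1 nN].
  set T := \sum_(a : I) _.
  have T0 : 0 <= T.
    rewrite sumr_ge0// => a _; rewrite sumr_ge0// => b _; rewrite sumr_ge0// => c _.
    by case: ifP => // _; rewrite !mulr_ge0.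
  have nR : 0 < n%:R :> R by rewrite ltr0n.
  have H (u : 'I_n) : coprime u n ->
      n%:R `^ (2 / 3 - ep) * gabs (u : nat)%:Z n ^+ 6 <= K ^+ 6 * T / n%:R.
    move=> cu; have [[[a b] c] /= [[a0 b0 c0] [nE B]]] := HK n (u : nat)%:Z n1 cu.
    have dN m : (m %| n)%N -> (m < N.+1)%N by move/(dvdn_leq n1)/leq_ltn_trans; apply.
    have aN : (a < N.+1)%N by apply: dN; rewrite nE -mulnA dvdn_mulr.
    have bN : (b < N.+1)%N by apply: dN; rewrite nE dvdn_mulr// dvdn_mull// dvdn_exp.
    have cN : (c < N.+1)%N by apply: dN; rewrite nE dvdn_mull// dvdn_exp.
    rewrite ler_pdivlMr// mulrAC.
    have -> : n%:R `^ (2 / 3 - ep) * n%:R = n%:R `^ (5 / 3 - ep) :> R.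
      rewrite -{2}[n%:R](@powRr1 R)// -powRD; first by congr (_ `^ _); lra.
      by rewrite lt0r_neq0// implybT.
    apply: (@le_trans _ _ (n%:R `^ (5 / 3 - ep) * (K * shape3 a b c) ^+ 6)).
      rewrite ler_wpM2l ?powR_ge0// lerXn2r// nnegrE ?gabs_ge0//.
      by rewrite mulr_ge0 ?shape3_ge0// ltW.
    rewrite exprMn mulrCA ler_wpM2l ?exprn_ge0 ?(ltW K0)//.
    apply: le_trans (@shape6 a b c n _ d a0 b0 c0 nE _ _ _) _; [lra|lra|lra|].
    rewrite /T (bigD1 (Ordinal aN))//= (bigD1 (Ordinal bN))//= (bigD1 (Ordinal cN))//=.
    rewrite /w/= -nE n1 eqxx/= -!addrA lerDl !addr_ge0 ?sumr_ge0//.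
    - by move=> c' _; case: ifP => // _; rewrite !mulr_ge0.
    - move=> b' _; rewrite sumr_ge0// => c' _.
      by case: ifP => // _; rewrite !mulr_ge0.
    - move=> a' _; rewrite sumr_ge0// => b' _; rewrite sumr_ge0// => c' _.
      by case: ifP => // _; rewrite !mulr_ge0.
  rewrite /gmass mulr_sumr; apply: le_trans (ler_sum _ H) _.
  apply: (@le_trans _ _ (\sum_(u < n) (K ^+ 6 * T / n%:R))).
    rewrite [leRHS](bigID (fun u : 'I_n => coprime u n))/= lerDl sumr_ge0// => u _.
    by rewrite !mulr_ge0 ?exprn_ge0 ?invr_ge0 ?(ltW K0).
  by rewrite sumr_const card_ord -[leLHS]mulr_natr divfK// lt0r_neq0.
have S0 : \sum_(a : I) (if (0 < a)%N then f a else 0) <= Z.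
  apply: le_trans (HZ N).
  by rewrite big_ord_recl/= add0r big_add1/= big_mkord.
rewrite big_nat_cond; apply: le_trans (ler_sum _ (fun n h => step n (andP h).1)) _.
rewrite -big_nat_cond -mulr_sumr ler_wpM2l ?exprn_ge0 ?(ltW K0)//.
rewrite exchange_big/=; under eq_bigr => a _ do rewrite exchange_big/=.
under eq_bigr => a _ do under eq_bigr => b _ do rewrite exchange_big/=.
pose f' (m : nat) : R := if (0 < m)%N then f m else 0.
have f'0 m : 0 <= f' m by rewrite /f'; case: ifP.
apply: (@le_trans _ _ (\sum_(a : I) \sum_(b : I) \sum_(c : I) f' a * f' b * f' c)).
  apply: ler_sum => a _; apply: ler_sum => b _; apply: ler_sum => c _.
  rewrite -big_mkcond/=.
  case: (posnP (w a b c)) => [->|w0].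
    by rewrite big_pred0// !mulr_ge0.
  have [a0 b0 c0] : [/\ (0 < a)%N, (0 < b)%N & (0 < c)%N].
    by move: w0; rewrite /w !muln_gt0 => /andP[/andP[-> /andP[-> _]] /andP[-> _]].
  rewrite /f' a0 b0 c0.
  rewrite big_const_seq iter_addr addr0 -[leRHS]mulr1n ler_wpMn2l ?mulr_ge0//.
  rewrite (@leq_trans (count_mem (w a b c) (index_iota 1 N.+1)))//.
    by apply: sub_count => n /=; rewrite eq_sym.
  by rewrite count_uniq_mem ?iota_uniq// leq_b1.
under eq_bigr => a _ do under eq_bigr => b _ do rewrite -mulr_sumr.
under eq_bigr => a _ do rewrite -mulr_suml -mulr_sumr.
rewrite -!mulr_suml !ler_pM ?mulr_ge0 ?sumr_ge0//.
Qed.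

(** Rankin's trick: (n/Y)^(2/3 - ep) >= 1 on the range of summation. *)
Lemma gmass_tail (ep : R) : 0 < ep -> ep <= 1 / 2 -> exists2 C : R, 0 <= C &
  forall (Y : R) N, 0 < Y ->
    \sum_(1 <= n < N.+1 | Y <= n%:R) gmass n <= C * Y `^ (- (2 / 3) + ep).
Proof.
move=> ep0 ep1; have [C C0 HC] := gmass_weighted_sum ep0.
exists C => // Y N Y0.
have -> : - (2 / 3) + ep = - (2 / 3 - ep) by lra.
rewrite powRN ler_pdivlMr ?powR_gt0//; apply: le_trans (HC N).
rewrite mulr_suml big_mkcond/= big_nat_cond [leRHS]big_nat_cond.
apply: ler_sum => n /andP[/andP[n1 _] _]; case: ifP => Yn.
  rewrite mulrC ler_wpM2r ?gmass_ge0//; apply: ge0_ler_powR => //; rewrite ?nnegrE ?ler0n ?(ltW Y0)//; lra.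
by rewrite mulr_ge0 ?gmass_ge0// powR_ge0.
Qed.

End TailBound.

(** * The singular series *)

Section FractionsModOne.
Context {R : realType}.
Local Notation er := (@er R).
Local Notation cubic_sum := (@cubic_sum R).
Local Notation gabs := (@gabs R).
Local Notation gmass := (@gmass R).

(* The fraction r/D mod 1 has denominator [den D r]; all fractions below share
   one large denominator D. *)
Definition den (D : nat) (r : int) : nat := (D %/ gcdn D `|r|)%N.

(** The normalised three-variable Gauss sum at the fraction r/D; the variables of [F0] separate,
    whence the cube. *)
Definition Gam (D : nat) (r : int) : R[i] := (cubic_sum r D / D%:R) ^+ 3.

(** Characterises the denominator by its multiples, so that equality of denominators becomes a
    matter of divisibility ([eq_den]). *)
Lemma den_dvd D r m : (0 < D)%N -> (den D r %| m)%N = (D%:Z %| m%:Z * r)%Z.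
Proof.
move=> D0; rewrite dvdzE abszM/= /den.
set g := gcdn D `|r|; have g0 : (0 < g)%N by rewrite gcdn_gt0 D0.
have [gD gr] : (g %| D)%N /\ (g %| `|r|)%N by rewrite dvdn_gcdl dvdn_gcdr.
have co : coprime (D %/ g) (`|r| %/ g).
  rewrite /coprime -(eqn_pmul2r g0) muln_gcdl !divnK// mul1n//.
rewrite -{2}(divnK gD) -{1}(divnK gr) mulnA dvdn_pmul2r//.
by rewrite mulnC Gauss_dvdr.
Qed.

Lemma den_gt0 D r : (0 < D)%N -> (0 < den D r)%N.
Proof.
move=> D0; rewrite /den divn_gt0 ?gcdn_gt0 ?D0// dvdn_leq// dvdn_gcdl//.
Qed.

Lemma den_dvdD D r : (0 < D)%N -> (den D r %| D)%N.
Proof. by move=> D0; rewrite den_dvd// dvdz_mulr. Qed.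

Lemma eq_den D r D' r' : (0 < D)%N -> (0 < D')%N ->
  (forall m : nat, (D%:Z %| m%:Z * r)%Z = (D'%:Z %| m%:Z * r')%Z) ->
  den D r = den D' r'.
Proof.
move=> D0 D0' H; apply/eqP; rewrite eqn_dvd den_dvd// H -den_dvd// dvdnn/=.
by rewrite den_dvd// -H -den_dvd.
Qed.

Lemma den_periodic D : (0 < D)%N -> mod_periodic D (den D).
Proof.
move=> D0 a b ab; apply: eq_den => // m.
by rewrite -[a](subrK b) mulrDr rpredDl// dvdz_mull.
Qed.

Lemma den_scale D n r : (0 < n)%N -> (0 < D)%N -> (n %| D)%N ->
  den D (r * (D %/ n)%N%:Z) = den n r.
Proof.
move=> n0 D0 nD; apply: eq_den => // m.
have q0 : (D %/ n)%N%:Z != 0 by rewrite eqz_nat -lt0n divn_gt0// dvdn_leq.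
have DE : D%:Z = (D %/ n)%N%:Z * n%:Z by rewrite -PoszM divnK.
have -> : (m%:Z * (r * (D %/ n)%N%:Z)) = (D %/ n)%N%:Z * (m%:Z * r) by ring.
by rewrite DE dvdz_mul2l.
Qed.

Lemma den_coprime n (u : nat) : (0 < n)%N -> coprime u n -> den n u%:Z = n.
Proof. by move=> n0; rewrite /den /coprime gcdnC => /eqP/= ->; rewrite divn1. Qed.

(** A fraction of denominator n is u/n in lowest terms, that is r = u (D/n). *)
Lemma sum_den (V : nmodType) (D n : nat) (f : int -> V) :
  (0 < n)%N -> (0 < D)%N -> (n %| D)%N ->
  \sum_(r < D | den D (r : nat)%:Z == n) f (r : nat)%:Z =
  \sum_(u < n | coprime u n) f ((u : nat)%:Z * (D %/ n)%N%:Z).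
Proof.
move=> n0 D0 nD; set q := (D %/ n)%N.
have q0 : (0 < q)%N by rewrite divn_gt0// dvdn_leq.
have DE : (D = n * q)%N by rewrite mulnC divnK.
have lt (u : 'I_n) : (u * q < D)%N by rewrite DE ltn_pmul2r.
pose h (u : 'I_n) := Ordinal (lt u).
pose h' (r : 'I_D) : 'I_n := insubd (Ordinal n0) (r %/ q)%N.
rewrite (reindex h)/=.
  apply: eq_big => u; last by rewrite PoszM.
  rewrite PoszM den_scale//; apply/eqP/idP => [|/den_coprime->//].
  rewrite /den => /(congr1 (muln^~ (gcdn n u))).
  rewrite divnK ?dvdn_gcdl// => /eqP.
  rewrite -{1}[n]muln1 eqn_pmul2l// eq_sym gcdnC => //.
exists h' => [u _|r].
  by apply: val_inj; rewrite /h'/= mulnK// val_insubd ltn_ord.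
rewrite inE => /eqP rn; apply: val_inj => /=.
have DE' : (n * q)%N = D by rewrite DE.
have qr : (q %| r)%N.
  have : (D%:Z %| n%:Z * (r : nat)%:Z)%Z by rewrite -den_dvd// rn.
  by rewrite dvdzE/= -[X in (X %| n * r)%N -> _]DE' dvdn_pmul2l.
by rewrite /h' val_insubd ltn_divLR// -DE ltn_ord divnK.
Qed.

Lemma sum_den_pred (V : nmodType) (D N : nat) (P : pred nat) (f : int -> V) :
  (0 < D)%N -> (forall n, P n -> (0 < n)%N -> (n <= N)%N) ->
  (forall n, (0 < n)%N -> (n <= N)%N -> P n -> (n %| D)%N) ->
  \sum_(r < D | P (den D (r : nat)%:Z)) f (r : nat)%:Z =
  \sum_(1 <= n < N.+1 | P n)
     \sum_(u < n | coprime u n) f ((u : nat)%:Z * (D %/ n)%N%:Z).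
Proof.
move=> D0 PN ND.
rewrite big_mkcond/=.
rewrite (eq_bigr (fun r : 'I_D => \sum_(1 <= n < N.+1 | P n && (den D (r : nat)%:Z == n)) f (r : nat)%:Z)).
  rewrite (exchange_big_dep P)/=; last by move=> r n _ /andP[].
  rewrite big_nat_cond [RHS]big_nat_cond; apply: eq_bigr => n /andP[/andP[n1 nN] Pn].
  rewrite -sum_den//; last exact: ND.
  by apply: eq_bigl => r; rewrite Pn.
move=> r _; have dn0 := den_gt0 (r : nat)%:Z D0.
case: ifPn => Pr.
  rewrite big_mkcond (bigD1_seq (den D (r : nat)%:Z)) ?iota_uniq//=.
    rewrite Pr eqxx/= big1 ?addr0// => n /negPf nr.
    by rewrite eq_sym nr andbF.
  by rewrite mem_index_iota dn0 ltnS PN.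
rewrite big1// => n /andP[Pn /eqP rn]; by rewrite rn Pn in Pr.
Qed.

Lemma Gam_periodic D : mod_periodic D (Gam D).
Proof. by move=> a b ab; rewrite /Gam (cubic_sum_eqmod ab). Qed.

Lemma Gam_scale D n r : (0 < n)%N -> (0 < D)%N -> (n %| D)%N ->
  Gam D (r * (D %/ n)%N%:Z) = Gam n r.
Proof.
move=> n0 D0 nD; set q := (D %/ n)%N.
have q0 : (0 < q)%N by rewrite divn_gt0// dvdn_leq.
have DE : (D = q * n)%N by rewrite divnK.
rewrite /Gam {1 2}DE [r * _]mulrC cubic_sum_scale// natrM invfM.
by rewrite mulrACA divff ?mul1r// pnatr_eq0 -lt0n.
Qed.

Lemma cabs_Gam D r : cabs (Gam D r) = gabs r D ^+ 3.
Proof. by rewrite /Gam cabsX cabsM cabsV cabs_nat. Qed.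

Lemma cabs_Gam_le1 D r : cabs (Gam D r) <= 1.
Proof. by rewrite cabs_Gam exprn_ile1 ?gabs_ge0 ?gabs_le1. Qed.

Lemma Gam_tail (D : nat) (Y : R) : (0 < D)%N ->
  \sum_(r < D | Y <= (den D (r : nat)%:Z)%:R) cabs (Gam D (r : nat)%:Z) ^+ 2 <=
  \sum_(1 <= n < D.+1 | Y <= n%:R) gmass n.
Proof.
move=> D0.
apply: (@le_trans _ _ (\sum_(r < D | (Y <= (den D (r : nat)%:Z)%:R) && (den D (r : nat)%:Z %| D)%N) cabs (Gam D (r : nat)%:Z) ^+ 2)).
  by rewrite le_eqVlt; apply/orP; left; apply/eqP; apply: eq_bigl => r; rewrite den_dvdD ?andbT.
rewrite (@sum_den_pred _ D D (fun n => (Y <= n%:R) && (n %| D)%N) (fun r => cabs (Gam D r) ^+ 2))//.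
- rewrite big_mkcond [leRHS]big_mkcond/= big_nat_cond [leRHS]big_nat_cond.
  apply: ler_sum => n /andP[/andP[n0 nD] _].
  case: ifP => [/andP[-> nd]|_]; last by case: ifP => // _; exact: gmass_ge0.
  apply: ler_sum => u cu.
  by rewrite Gam_scale// cabs_Gam -exprM.
- by move=> n /andP[_ nd] n0; rewrite dvdn_leq.
- by move=> n _ _ /andP[].
Qed.

End FractionsModOne.

(** * Correlations of Gauss sums over pairs of fractions *)

Section PairSums.
Context {R : realType}.
Local Notation er := (@er R).
Local Notation Gam := (@Gam R).
Local Notation gmass := (@gmass R).

(** As a fraction this is b/d - r/D: for b = 0, ..., d - 1 these are the solutions r'/D modulo 1 of
    d (r + r')/D integral. *)
Definition partner (D d : nat) (r : int) (b : nat) : int :=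
  b%:Z * (D %/ d)%N%:Z - r.

(* Pairs of fractions (r/D, r'/D) with d (r + r')/D integral. *)
Definition pair_sum (D d : nat) (P : int -> nat -> bool) : R[i] :=
  d%:R^-1 * \sum_(r < D) \sum_(b < d | P (r : nat)%:Z b)
    Gam D (r : nat)%:Z * Gam D (partner D d (r : nat)%:Z b).

Lemma dvdz_partner D d r b t : (0 < d)%N -> (d %| D)%N -> (d%:Z %| t)%Z ->
  (D%:Z %| t * partner D d r b)%Z = (D%:Z %| t * r)%Z.
Proof.
move=> d0 dD dt; rewrite /partner mulrBr rpredDl ?rpredN//.
rewrite mulrCA dvdz_mull//.
have -> : D%:Z = d%:Z * (D %/ d)%N%:Z by rewrite -PoszM mulnC divnK.
exact: dvdz_mul.
Qed.

(** A multiple of d kills the shift b/d, so each denominator divides d times the other. *)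
Lemma den_partner D d r b : (0 < D)%N -> (0 < d)%N -> (d %| D)%N ->
  (den D r <= d * den D (partner D d r b))%N.
Proof.
move=> D0 d0 dD; apply: dvdn_leq; first by rewrite muln_gt0 d0 den_gt0.
rewrite den_dvd// -(dvdz_partner r b d0 dD); last by rewrite PoszM dvdz_mulr.
by rewrite PoszM -mulrA dvdz_mull// -den_dvd.
Qed.

Lemma den_partner' D d r b : (0 < D)%N -> (0 < d)%N -> (d %| D)%N ->
  (den D (partner D d r b) <= d * den D r)%N.
Proof.
move=> D0 d0 dD; apply: dvdn_leq; first by rewrite muln_gt0 d0 den_gt0.
rewrite den_dvd// (dvdz_partner r b d0 dD); last by rewrite PoszM dvdz_mulr.
by rewrite PoszM -mulrA dvdz_mull// -den_dvd.
Qed.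

Lemma sum_reflect (V : nmodType) (q : nat) (f : int -> V) (c : int) : (0 < q)%N ->
  mod_periodic q f -> \sum_(y < q) f (c - (y : nat)%:Z) = \sum_(y < q) f (y : nat)%:Z.
Proof.
move=> q0 pf.
apply: (@sum_residues V q f 'I_q (fun y : 'I_q => c - (y : nat)%:Z)) => //.
  by rewrite card_ord.
move=> i j /= h; apply: val_inj.
apply: (dvdz_lt_eq (ltn_ord i) (ltn_ord j)).
by rewrite -opprB rpredN; move: h; rewrite opprB addrC addrA subrK.
Qed.

(** The product is split by 2 x y <= x^2 + y^2. For fixed b the partner map is a reflection of Z/D,
    so both squares have the same sum over r, and the d values of b cancel the factor 1/d. *)
Lemma pair_tail (D d : nat) (Y : R) (P : int -> nat -> bool) :
  (0 < D)%N -> (0 < d)%N -> (d %| D)%N ->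
  (forall r b, P r b -> Y <= (den D r)%:R /\ Y <= (den D (partner D d r b))%:R) ->
  cabs (pair_sum D d P) <= \sum_(1 <= n < D.+1 | Y <= n%:R) gmass n.
Proof.
move=> D0 d0 dD HP.
have dR : 0 < d%:R :> R by rewrite ltr0n.
pose phi (r : int) : R := if Y <= (den D r)%:R then cabs (Gam D r) ^+ 2 else 0.
have phi0 r : 0 <= phi r by rewrite /phi; case: ifP => // _; rewrite sqr_ge0.
have phip : mod_periodic D phi.
  by move=> a b ab; rewrite /phi (den_periodic D0 ab) (Gam_periodic ab).
pose S := \sum_(r < D) phi (r : nat)%:Z.
have S_le : S <= \sum_(1 <= n < D.+1 | Y <= n%:R) gmass n.
  by rewrite /S -big_mkcond/= Gam_tail.
apply: le_trans S_le.
rewrite cabsM cabsV cabs_nat mulrC ler_pdivrMr//.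
apply: (@le_trans _ _ (\sum_(r < D) \sum_(b < d)
   (phi (r : nat)%:Z + phi (partner D d (r : nat)%:Z b)) / 2)).
  apply: (le_trans (cabs_sum _ _ _)); apply: ler_sum => r _.
  apply: (le_trans (cabs_sum _ _ _)).
  rewrite big_mkcond; apply: ler_sum => b _; case: ifPn => Pb; last first.
    by rewrite divr_ge0 ?addr_ge0.
  have [h1 h2] := HP _ _ Pb; rewrite /phi h1 h2 cabsM.
  rewrite ler_pdivlMr// -subr_ge0.
  set x := cabs _; set y := cabs _.
  have -> : x ^+ 2 + y ^+ 2 - x * y * 2 = (x - y) ^+ 2 by ring.
  exact: sqr_ge0.
rewrite (eq_bigr (fun r : 'I_D => \sum_(b < d) phi (r : nat)%:Z / 2 +
   \sum_(b < d) phi (partner D d (r : nat)%:Z b) / 2)); last first.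
  by move=> r _; rewrite -big_split/=; apply: eq_bigr => b _; rewrite mulrDl.
rewrite big_split/= [X in _ + X]exchange_big/=.
rewrite [X in X + _](_ : _ = d%:R * (S / 2)); last first.
  rewrite /S mulr_suml mulr_sumr; apply: eq_bigr => r _.
  by rewrite sumr_const card_ord mulr_natl.
rewrite [X in _ + X](_ : _ = d%:R * (S / 2)); last first.
  rewrite (eq_bigr (fun=> S / 2)); first by rewrite sumr_const card_ord mulr_natl.
  by move=> b _; rewrite -mulr_suml /partner (@sum_reflect _ D phi).
by rewrite -mulrDr -splitr mulrC.
Qed.

Lemma pair_sumB (D d : nat) (P Q : int -> nat -> bool) :
  (forall r b, Q r b -> P r b) ->
  pair_sum D d P - pair_sum D d Q = pair_sum D d (fun r b => P r b && ~~ Q r b).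
Proof.
move=> QP; rewrite /pair_sum -mulrBr -sumrB; congr (_ * _).
apply: eq_bigr => r _; rewrite [X in X - _](bigID (fun b : 'I_d => Q (r : nat)%:Z b))/=.
rewrite [X in X + _ - _](eq_bigl (fun b : 'I_d => Q (r : nat)%:Z b)); last first.
  by move=> b; case E : (Q _ _); rewrite ?andbF// (QP _ _ E).
by rewrite addrAC subrr add0r.
Qed.

Definition cross_pairs (D K : nat) (r : int) (b : nat) := (den D r <= K)%N.
Definition square_pairs (D d K : nat) (r : int) (b : nat) :=
  (den D r <= K)%N && (den D (partner D d r b) <= K)%N.
Definition series_pairs (D d N : nat) (r : int) (b : nat) :=
  (lcmn (den D r) d <= N)%N.

(** In a pair counted on one side only, the partner has denominator above K, and then r itself has
    denominator above K/d. *)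
Lemma cross_square_close (D d K : nat) : (0 < D)%N -> (0 < d)%N -> (d %| D)%N ->
  cabs (pair_sum D d (cross_pairs D K) - pair_sum D d (square_pairs D d K)) <=
  \sum_(1 <= n < D.+1 | K%:R / d%:R <= n%:R :> R) gmass n.
Proof.
move=> D0 d0 dD; rewrite pair_sumB; last by move=> r b /andP[].
apply: pair_tail => // r b; rewrite /cross_pairs /square_pairs.
move=> /andP[h1]; rewrite h1/= -ltnNge => h3.
have h2 := den_partner' r b D0 d0 dD.
have dR : 0 < d%:R :> R by rewrite ltr0n.
rewrite !ler_pdivrMr// -!natrM !ler_nat; split; nia.
Qed.

(** Kd <= N makes the cross pairs a subset of the series pairs. The bound does not depend on N,
    which will also give the convergence of the series. *)
Lemma series_cross_close (D d K N : nat) : (0 < D)%N -> (0 < d)%N -> (d %| D)%N ->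
  (K * d <= N)%N ->
  cabs (pair_sum D d (series_pairs D d N) - pair_sum D d (cross_pairs D K)) <=
  \sum_(1 <= n < D.+1 | K%:R / d%:R <= n%:R :> R) gmass n.
Proof.
move=> D0 d0 dD KN; rewrite pair_sumB; last first.
  move=> r b; rewrite /cross_pairs /series_pairs => h.
  apply: leq_trans KN; apply: leq_trans (leq_mul h (leqnn d)).
  by rewrite dvdn_leq ?muln_gt0 ?den_gt0// dvdn_lcm dvdn_mulr ?dvdn_mull.
apply: pair_tail => // r b; rewrite /cross_pairs => /andP[_]; rewrite -ltnNge => h.
have := den_partner r b D0 d0 dD => h1.
have dR : 0 < d%:R :> R by rewrite ltr0n.
rewrite !ler_pdivrMr// -!natrM !ler_nat; split; nia.
Qed.

End PairSums.

Definition mk3 {T : Type} (a b c : T) : 'rV[T]_3 :=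
  \row_(l < 3) tnth [tuple a; b; c] l.

Lemma mk3_eta {T : Type} (y : 'rV[T]_3) :
  y = mk3 (y 0 0) (y 0 1) (y 0 2).
Proof.
apply/rowP => l; rewrite mxE.
by case: l => -[|[|[|//]]] h; rewrite (tnth_nth (y 0 0))/=; congr (y _ _); apply: val_inj.
Qed.

Lemma mk3_inj {T : Type} (a b c a' b' c' : T) :
  mk3 a b c = mk3 a' b' c' -> [/\ a = a', b = b' & c = c'].
Proof.
move=> /rowP E; have := E 0; have := E 1; have := E 2.
by rewrite !mxE !(tnth_nth a)/=.
Qed.

Lemma F0_mk3 {T : pzRingType} (a b c : T) :
  F0 (mk3 a b c) = a ^+ 3 + b ^+ 3 + c ^+ 3.
Proof.
rewrite /F0 !big_ord_recl big_ord0 !mxE !(tnth_nth 0)/= addr0 addrA//.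
Qed.

Lemma map_mk3 {T U : Type} (f : T -> U) (a b c : T) :
  map_mx f (mk3 a b c) = mk3 (f a) (f b) (f c).
Proof.
apply/rowP => l; rewrite !mxE.
by case: l => -[|[|[|//]]] h; rewrite (tnth_nth a) (tnth_nth (f a)).
Qed.

Lemma sum_mk3 (V : nmodType) (T : finType) (f : 'rV[T]_3 -> V) :
  \sum_y f y = \sum_a \sum_b \sum_c f (mk3 a b c).
Proof.
rewrite pair_bigA pair_bigA/= (reindex (fun t : T * T * T => mk3 t.1.1 t.1.2 t.2))//=.
exists (fun y : 'rV[T]_3 => (y 0 0, y 0 1, y 0 2)).
  by move=> [[a b] c] _ /=; rewrite !mxE !(tnth_nth a)/=.
by move=> y _; rewrite [RHS]mk3_eta.
Qed.

(** * The singular series as a limit of pair sums *)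

Section SingularSeriesSums.
Context {R : realType}.
Local Notation er := (@er R).
Local Notation Gam := (@Gam R).
Local Notation gmass := (@gmass R).
Local Notation pair_sum := (@pair_sum R).

Lemma char_sum_cubic (n : nat) (v : int) :
  \sum_(y : 'rV['I_n]_3) er n (v * F0 (repZ y)) = cubic_sum v n ^+ 3.
Proof.
rewrite sum_mk3 /repZ.
under eq_bigr do under eq_bigr do under eq_bigr do
  rewrite map_mk3 F0_mk3 !mulrDr !erD.
under eq_bigr do under eq_bigr do rewrite -mulr_sumr.
under eq_bigr do rewrite -mulr_suml -mulr_sumr.
by rewrite -!mulr_suml -/(cubic_sum _ _) !exprS expr0 mulr1 mulrA.
Qed.

Lemma indicator_er (d : nat) (t : int) : (0 < d)%N ->
  (if (d%:Z %| t)%Z then 1 else 0) = d%:R^-1 * \sum_(b < d) er d ((b : nat)%:Z * t).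
Proof.
move=> d0; under eq_bigr do rewrite mulrC.
rewrite er_geom//; case: ifP => _; last by rewrite mulr0.
by rewrite mulVf// pnatr_eq0 -lt0n.
Qed.

Lemma er_frac (n m : nat) (u : int) : (0 < n)%N -> (m %| n)%N ->
  er n (u * (n %/ m)%N%:Z) = er m u.
Proof.
move=> n0 mn; rewrite -{1}(divnK mn) mulrC er_scale//.
by rewrite divn_gt0 ?(dvdn_gt0 n0)// dvdn_leq.
Qed.

(** The condition d | F0(y) is detected by additive characters mod d, each of which shifts the
    frequency u/m by some b/d. *)
Lemma restricted_char_sum (n m d : nat) (u : int) :
  (0 < n)%N -> (0 < d)%N -> (m %| n)%N -> (d %| n)%N ->
  n%:R ^- 3 * \sum_(y : 'rV['I_n]_3 | (d %| F0 (repZ y))%Z) er m (u * F0 (repZ y)) =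
  d%:R^-1 * \sum_(b < d) Gam n (u * (n %/ m)%N%:Z + (b : nat)%:Z * (n %/ d)%N%:Z).
Proof.
move=> n0 d0 mn dn.
have -> : \sum_(y : 'rV['I_n]_3 | (d %| F0 (repZ y))%Z) er m (u * F0 (repZ y)) =
   d%:R^-1 * \sum_(b < d) \sum_(y : 'rV['I_n]_3)
     er n ((u * (n %/ m)%N%:Z + (b : nat)%:Z * (n %/ d)%N%:Z) * F0 (repZ y)).
  rewrite big_mkcond exchange_big/= mulr_sumr; apply: eq_bigr => y _.
  under eq_bigr => b _ do rewrite mulrDl [_ * _ * F0 _]mulrAC [X in _ + X]mulrAC erD !er_frac//.
  by rewrite -mulr_sumr mulrCA -indicator_er//; case: ifP; rewrite ?mulr1 ?mulr0.
rewrite mulrCA; congr (_ * _); rewrite mulr_sumr; apply: eq_bigr => b _.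
by rewrite char_sum_cubic /Gam expr_div_n mulrC.
Qed.

Definition series_term (D d : nat) (r : int) : R[i] :=
  d%:R^-1 ^+ 2 * \sum_(b1 < d) \sum_(b2 < d)
    Gam D (r + (b1 : nat)%:Z * (D %/ d)%N%:Z) *
    Gam D (- r + (b2 : nat)%:Z * (D %/ d)%N%:Z).

Lemma divn_chain (D n m : nat) : (m %| n)%N -> (n %| D)%N ->
  (n %/ m * (D %/ n) = D %/ m)%N.
Proof. by move=> mn nD; rewrite mulnC muln_divA// divnK. Qed.

Lemma Splus_term (D n d : nat) : (0 < n)%N -> (0 < d)%N -> (0 < D)%N -> (n %| D)%N ->
  n%:R ^- 6 * Splus0 n d =
  \sum_(1 <= m < n.+1 | lcmn m d == n)
    \sum_(u < m | coprime u m) series_term D d ((u : nat)%:Z * (D %/ m)%N%:Z).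
Proof.
move=> n0 d0 D0 nD; rewrite /Splus0 mulr_sumr; apply: eq_bigr => m /eqP mdn.
have mn : (m %| n)%N by rewrite -mdn dvdn_lcml.
have dn : (d %| n)%N by rewrite -mdn dvdn_lcmr.
rewrite mulr_sumr; apply: eq_bigr => u _.
set U := (u : nat)%:Z.
have -> : \sum_(x : 'rV['I_n]_3 * 'rV['I_n]_3
     | (d %| F0 (repZ x.1))%Z && (d %| F0 (repZ x.2))%Z)
     er m (U * F (repZ x.1, repZ x.2)) =
  (\sum_(y : 'rV['I_n]_3 | (d %| F0 (repZ y))%Z) er m (U * F0 (repZ y))) *
  (\sum_(z : 'rV['I_n]_3 | (d %| F0 (repZ z))%Z) er m (- U * F0 (repZ z))).
  rewrite big_distrlr/= pair_big/=; apply: eq_bigr => -[y z] _ /=.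
  by rewrite -erD /F/= mulrBr mulNr.
rewrite (_ : n%:R ^- 6 = n%:R ^- 3 * n%:R ^- 3); last by rewrite -invfM -exprD.
rewrite mulrACA !restricted_char_sum// mulrACA -expr2; congr (_ * _).
rewrite big_distrlr/=; apply: eq_bigr => b1 _; apply: eq_bigr => b2 _.
rewrite -!(@Gam_scale _ D n)// !mulrDl -!mulrA -!PoszM !divn_chain//.
by rewrite mulNr.
Qed.

(** Sorting by m = den r makes the condition lcm(m, d) = n, for some n <= N, a cut-off on r
    alone. *)
Lemma series_partial_sum (D d N : nat) : (0 < d)%N -> (0 < D)%N -> (d %| D)%N ->
  (forall n, (0 < n)%N -> (n <= N)%N -> (n %| D)%N) ->
  \sum_(1 <= n < N.+1) n%:R ^- 6 * Splus0 n d = pair_sum D d (series_pairs D d N).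
Proof.
move=> d0 D0 dD ND.
pose h := series_term D d.
have lcmle m : (0 < m)%N -> (m <= lcmn m d)%N.
  by move=> m0; rewrite dvdn_leq ?lcmn_gt0 ?m0// dvdn_lcml.
transitivity (\sum_(1 <= m < N.+1 | (lcmn m d <= N)%N)
    \sum_(u < m | coprime u m) h ((u : nat)%:Z * (D %/ m)%N%:Z)).
  transitivity (\sum_(1 <= n < N.+1) \sum_(1 <= m < N.+1 | lcmn m d == n)
    \sum_(u < m | coprime u m) h ((u : nat)%:Z * (D %/ m)%N%:Z)).
    rewrite big_nat_cond [RHS]big_nat_cond; apply: eq_bigr => n /andP[/andP[n0 nN] _].
    rewrite (@Splus_term D)//; last exact: ND.
    rewrite [RHS](@big_cat_nat _ _ _ n.+1)//=.
    rewrite [X in _ = _ + X]big1_seq ?addr0//.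
    move=> m /andP[/eqP mdn]; rewrite mem_index_iota => /andP[nm mN].
    have m0 : (0 < m)%N by exact: leq_ltn_trans nm.
    by have := lcmle m m0; rewrite mdn => /(leq_trans nm); rewrite ltnn.
  under eq_bigr do rewrite big_mkcond/=.
  rewrite exchange_big/= [RHS]big_mkcond/= big_nat_cond [RHS]big_nat_cond.
  apply: eq_bigr => m /andP[/andP[m0 mN] _].
  have l0 : (0 < lcmn m d)%N by rewrite lcmn_gt0 m0.
  set Fm := (\sum_(u < m | coprime u m) _).
  case: leqP => lN.
    rewrite (bigD1_seq (lcmn m d)) ?iota_uniq ?mem_index_iota ?l0//=.
    by rewrite eqxx big1 ?addr0// => n /negPf nl; rewrite eq_sym nl.
  rewrite big1_seq// => n; rewrite mem_index_iota => /andP[_ /andP[_ nN]].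
  by case: eqP => // E; move: lN nN; rewrite E ltnS ltnNge => /negPf ->.
rewrite -(@sum_den_pred _ D N (fun m => (lcmn m d <= N)%N) h)//; last 2 first.
- by move=> n h1 n0; exact: leq_trans (lcmle _ n0) h1.
- by move=> n n0 nN _; exact: ND.
set q := ((D %/ d)%N)%:Z.
have qE : D%:Z = d%:Z * q by rewrite -PoszM mulnC divnK.
(* The cut-off sees only lcm(den r, d), which does not change when r/D moves by a multiple of 1/d.
   So r + b1 D/d can be renamed r: the sum over b1 gives d equal copies, and b1 + b2 mod d becomes
   the only shift. *)
pose P (r : int) := (lcmn (den D r) d <= N)%N.
have Pshift (r : int) (b : int) : P (r - b * q) = P r.
  rewrite /P; congr (_ <= _)%N; apply/eqP; rewrite eqn_dvd.
  have E t : (lcmn (den D (r - b * q)) d %| t)%N = (lcmn (den D r) d %| t)%N.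
    rewrite !dvdn_lcm !den_dvd//; case: (boolP (d %| t)%N) => [dt|]; rewrite ?andbF// !andbT.
    rewrite mulrBr rpredDr// rpredN mulrCA dvdz_mull//.
    by rewrite qE dvdz_mul.
  by rewrite E dvdnn -E dvdnn.
rewrite big_mkcond/= /h /series_term.
pose G (b1 : int) (r : int) : R[i] := if P r then
   \sum_(b2 < d) Gam D (r + b1 * q) * Gam D (- r + (b2 : nat)%:Z * q) else 0.
transitivity (d%:R^-1 ^+ 2 * \sum_(b1 < d) \sum_(r < D) G (b1 : nat)%:Z (r : nat)%:Z).
  rewrite exchange_big/= mulr_sumr; apply: eq_bigr => r _.
  rewrite /G -/(P _); case: ifP => _; first by [].
  by rewrite big1 ?mulr0.
have GE (b1 : 'I_d) : \sum_(r < D) G (b1 : nat)%:Z (r : nat)%:Z =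
   \sum_(r < D) \sum_(b < d | P (r : nat)%:Z) Gam D (r : nat)%:Z * Gam D (partner D d (r : nat)%:Z b).
  rewrite -(@sum_shift _ D (G (b1 : nat)%:Z) (- ((b1 : nat)%:Z * q)))//; last first.
    move=> a b ab; rewrite /G /P (den_periodic D0 ab); case: ifP => // _.
    apply: eq_bigr => b2 _; congr (_ * _); apply: Gam_periodic.
      by rewrite opprD addrACA subrr addr0.
    by rewrite opprD addrACA subrr addr0 -opprD rpredN.
  apply: eq_bigr => r _; rewrite /G Pshift; case: ifP => Pr; last by rewrite big_pred0.
  rewrite -mulr_sumr subrK -mulr_sumr; congr (_ * _).
  rewrite -(@sum_shift _ d (fun b => Gam D (b * q - (r : nat)%:Z)) (b1 : nat)%:Z)//.
    by apply: eq_bigr => b _; congr (Gam D _); ring.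
  move=> a b ab; apply: Gam_periodic; rewrite opprD addrACA subrr addr0 -mulrBl.
  by rewrite qE dvdz_mul.
under eq_bigr => b1 _ do rewrite GE.
rewrite /pair_sum; set T := (\sum_(r < D) _).
rewrite sumr_const card_ord -[T *+ d]mulr_natl mulrA; congr (_ * _).
by rewrite expr2 mulfVK// pnatr_eq0 -lt0n.
Qed.


Lemma complex_cauchy_cvg (S : nat -> R[i]) :
  (forall eps : R, 0 < eps -> exists N0, forall N, (N0 <= N)%N ->
     cabs (S N - S N0) < eps) ->
  exists L : R[i], forall eps : R, 0 < eps -> exists N0, forall N, (N0 <= N)%N ->
     cabs (L - S N) < eps.
Proof.
move=> H.
have ReIm (z : R[i]) : `|complex.Re z| <= cabs z /\ `|complex.Im z| <= cabs z.
  case: z => a b /=; rewrite -!sqrtr_sqr; split; apply: ler_wsqrtr.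
    by rewrite lerDl sqr_ge0.
  by rewrite lerDr sqr_ge0.
have cabs_le (z : R[i]) : cabs z <= `|complex.Re z| + `|complex.Im z|.
  rewrite [z in cabs z]complexE; apply: le_trans (cabsD _ _) _.
  by rewrite cabs_real cabsM cabs_real /= expr0n/= add0r expr1n sqrtr1 mul1r.
have part (f : R[i] -> R) : (forall z w, f (z - w) = f z - f w) ->
    (forall z, `|f z| <= cabs z) ->
    exists l : R, (f \o S) @ \oo --> l.
  move=> fB fle; apply/cvg_ex; apply: cauchy_cvg; apply: cauchy_exP => eps eps0.
  have [N0 HN] := H _ eps0; exists (f (S N0)); exists N0 => // n /= nN.
  by rewrite -ball_normE/= distrC -fB (le_lt_trans (fle _))// HN.
have [a Ha] := part (@complex.Re R) (raddfB (@complex.Re R)) (fun z => (ReIm z).1).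
have [b Hb] := part (@complex.Im R) (raddfB (@complex.Im R)) (fun z => (ReIm z).2).
exists (a +i* b) => eps eps0.
have e2 : 0 < eps / 2 by rewrite divr_gt0.
have /cvgrPdist_lt /(_ _ e2) [N1 _ H1] := Ha.
have /cvgrPdist_lt /(_ _ e2) [N2 _ H2] := Hb.
exists (maxn N1 N2) => N; rewrite geq_max => /andP[h1 h2].
apply: le_lt_trans (cabs_le _) _; rewrite (splitr eps) !raddfB/=.
by apply: ltrD; [exact: H1|exact: H2].
Qed.

Lemma sing_series_cvg (d : nat) (L : R[i]) :
  (forall eps : R, 0 < eps -> exists N0, forall N, (N0 <= N)%N ->
     cabs (L - \sum_(1 <= n < N.+1) n%:R ^- 6 * Splus0 n d) < eps) ->
  sing_series d = L.
Proof.
move=> H; rewrite /sing_series; apply: (@cvg_lim R[i]^o); first exact: norm_hausdorff.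
apply/(@cvgrPdist_lt R[i] R[i]^o) => eps eps0.
have E : eps = (complex.Re eps)%:C by rewrite RRe_real// ger0_real// ltW.
have eR : 0 < complex.Re eps by rewrite -ltcR -E.
have [N0 HN] := H _ eR; exists N0 => // N /= NN.
by rewrite normcE' E ltcR; exact: HN.
Qed.

(** One tail bound serves twice: letting K grow in it shows that the partial sums are Cauchy, and at
    the given K it measures their distance from the cross sum. *)
Lemma sing_series_close (ep : R) : 0 < ep -> ep <= 1 / 2 -> exists2 C : R, 0 <= C &
  forall K d D, (0 < K)%N -> (0 < d)%N -> (0 < D)%N -> (d %| D)%N ->
    (forall n, (0 < n)%N -> (n <= K * d)%N -> (n %| D)%N) ->
    cabs (sing_series d - pair_sum D d (cross_pairs D K)) <=
      C * (K%:R / d%:R) `^ (- (2 / 3) + ep).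
Proof.
move=> ep0 ep1; have [C C0 HC] := @gmass_tail R _ ep0 ep1.
exists (4 * C); first by rewrite mulr_ge0.
move=> K0 d D0 K00 d0 D00 dD0 HD0.
pose S N := \sum_(1 <= n < N.+1) n%:R ^- 6 * Splus0 n d : R[i].
pose T K := C * (K%:R / d%:R) `^ (- (2 / 3) + ep).
have dvdfact N n : (0 < n)%N -> (n <= N)%N -> (n %| N`!)%N.
  by move=> n0 nN; rewrite dvdn_fact// n0.
have S_close K D N : (0 < K)%N -> (0 < D)%N -> (d %| D)%N -> (K * d <= N)%N ->
    (forall n, (0 < n)%N -> (n <= N)%N -> (n %| D)%N) ->
    cabs (S N - pair_sum D d (cross_pairs D K)) <= T K.
  move=> K1 D1 dD KN HD; rewrite /S (@series_partial_sum D)//.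
  apply: le_trans (series_cross_close _ _ _ KN) _ => //.
  by apply: HC; rewrite divr_gt0 ?ltr0n.
(* Both partial sums are written over the common denominator N! and compared with the same cross
   sum. *)
have S_diff K N : (0 < K)%N -> (K * d <= N)%N -> cabs (S N - S (K * d)%N) <= 2 * T K.
  move=> K1 KN; have dN : (d <= N)%N by apply: leq_trans KN; rewrite leq_pmull.
  have h1 : cabs (S N - pair_sum N`! d (cross_pairs N`! K)) <= T K.
    by apply: S_close => //; rewrite ?fact_gt0// ?dvdfact// => n *; exact: dvdfact.
  have h2 : cabs (S (K * d)%N - pair_sum N`! d (cross_pairs N`! K)) <= T K.
    apply: S_close => //; rewrite ?fact_gt0// ?dvdfact// => n n0 h; apply: dvdfact => //.
    exact: leq_trans KN.
  rewrite -[S N](subrK (pair_sum N`! d (cross_pairs N`! K))) -addrA.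
  apply: le_trans (cabsD _ _) _; rewrite mulrDl mul1r lerD//.
  by rewrite -cabsN opprB.
(* Since ep <= 1/2 the exponent is at most -1/6, so K = d m with m >= x^6 brings the tail below
   C/x. *)
have T_small (eps : R) : 0 < eps -> exists2 K, (0 < K)%N & 2 * T K < eps.
  move=> e0.
  pose x := (2 * C + 1) / eps.
  have x0 : 0 < x by rewrite divr_gt0// ltr_wpDl ?mulr_ge0.
  pose m := (Num.truncn (x `^ 6)).+1.
  exists (d * m)%N; first by rewrite muln_gt0 d0.
  rewrite /T natrM mulrAC divff ?mul1r ?pnatr_eq0 -?lt0n//.
  have xm : x <= m%:R `^ (6^-1).
    rewrite -[x in X in X <= _](_ : (x `^ 6) `^ 6^-1 = x); last first.
      by rewrite -powRrM divff ?powRr1 ?(ltW x0)// pnatr_eq0.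
    apply: ge0_ler_powR; rewrite ?nnegrE ?powR_ge0// ?invr_ge0//.
    by rewrite ltW// /m truncnS_gt// powR_ge0.
  have m1 : 1 <= m%:R :> R by rewrite ler1n.
  have : m%:R `^ (- (2 / 3) + ep) <= x^-1.
    apply: (@le_trans _ _ (m%:R `^ (- (6^-1)))); first by apply: ler_powR => //; lra.
    by rewrite powRN lef_pV2// posrE powR_gt0// (lt_le_trans ltr01).
  move=> /(ler_wpM2l C0) => h.
  have : 2 * (C * x^-1) < eps.
    rewrite /x invf_div mulrA mulrA ltr_pdivrMr; last by rewrite ltr_wpDl ?mulr_ge0.
    by rewrite [eps * _]mulrC ltr_pM2r// ltrDl.
  by apply: le_lt_trans; rewrite ler_pM2l.
have [L HL] : exists L : R[i], forall eps : R, 0 < eps -> exists N0, forall N, (N0 <= N)%N ->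
     cabs (L - S N) < eps.
  apply: complex_cauchy_cvg => eps eps0; have [K K1 HK] := T_small _ eps0.
  by exists (K * d)%N => N KN; apply: le_lt_trans HK; exact: S_diff.
rewrite (sing_series_cvg HL).
have h1 : cabs (S (K0 * d)%N - pair_sum D0 d (cross_pairs D0 K0)) <= T K0.
  exact: S_close.
have h2 : cabs (L - S (K0 * d)%N) <= 2 * T K0.
  apply/ler_addgt0Pr => eps eps0; have [N1 HN] := HL _ eps0.
  pose N := maxn N1 (K0 * d).
  rewrite -[L](subrK (S N)) -addrA addrC.
  apply: le_trans (cabsD _ _) _; apply: lerD; first by rewrite S_diff// leq_maxr.
  by rewrite ltW// HN// leq_maxl.
rewrite -[L](subrK (S (K0 * d)%N)) -addrA.
apply: le_trans (cabsD _ _) _; apply: le_trans (lerD h2 h1) _.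
rewrite -/(T K0) -mulrA -/(T K0).
have : 0 <= T K0 by rewrite mulr_ge0 ?powR_ge0.
by move: (T K0) => t t0; lra.
Qed.

Lemma cross_square_bound (ep : R) : 0 < ep -> ep <= 1 / 2 -> exists2 C : R, 0 <= C &
  forall K d D, (0 < K)%N -> (0 < d)%N -> (0 < D)%N -> (d %| D)%N ->
    cabs (pair_sum D d (cross_pairs D K) - pair_sum D d (square_pairs D d K)) <=
      C * (K%:R / d%:R) `^ (- (2 / 3) + ep).
Proof.
move=> ep0 ep1; have [C C0 HC] := @gmass_tail R _ ep0 ep1.
exists C => // K d D K0 d0 D0 dD; apply: le_trans (cross_square_close _ D0 d0 dD) _.
by apply: HC; rewrite divr_gt0 ?ltr0n.
Qed.

End SingularSeriesSums.

(** * Smooth weights on an annulus *)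

Section DirectionalDerivatives.
Context {R : realType} {V : normedModType R}.
Implicit Types (f g : V -> R) (u v : V).

(** Directional derivatives become ordinary ones, to which the chain rule and the mean value theorem
    in one variable apply. *)
Lemma is_derive_lineP f u v (t df : R) :
  is_derive (u + t *: v) v f df <-> is_derive t 1 (fun s : R => f (u + s *: v)) df.
Proof.
have E : (fun h : R => h^-1 *: (f (u + (h *: 1 + t) *: v) - f (u + t *: v))) =
         (fun h : R => h^-1 *: (f (h *: v + (u + t *: v)) - f (u + t *: v))).
  apply/funext => h; congr (_ *: (f _ - _)).
  by rewrite [h *: 1]mulr1 scalerDl addrCA.
split=> -[D <-]; split.
- by move: D; rewrite /derivable /= E.
- by rewrite /derive/= E.
- by move: D; rewrite /derivable /= E.
- by rewrite /derive/= E.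
Qed.

Lemma is_deriveM_fun f g u v (df dg : R) : is_derive u v f df -> is_derive u v g dg ->
  is_derive u v (fun x => f x * g x) (f u * dg + g u * df).
Proof. exact: is_deriveM. Qed.

Lemma is_deriveD_fun f g u v (df dg : R) : is_derive u v f df -> is_derive u v g dg ->
  is_derive u v (fun x => f x + g x) (df + dg).
Proof. exact: is_deriveD. Qed.

Lemma is_derive_cst_fun (a : R) u v : is_derive u v (fun=> a) 0.
Proof. exact: is_derive_cst. Qed.

Lemma is_derive_unique f u v (df df' : R) :
  is_derive u v f df -> is_derive u v f df' -> df = df'.
Proof. by move=> [_ <-] [_ <-]. Qed.

Lemma is_derive_comp_real f u v (df : R) (g : R -> R) (dg : R) :
  is_derive u v f df -> is_derive (f u) 1 g dg ->
  is_derive u v (fun x => g (f x)) (dg * df).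
Proof.
move=> hf hg.
have := hf; rewrite -{1}[u]addr0 -[X in _ + X](scale0r v) => /is_derive_lineP hf'.
rewrite -{1}[u]addr0 -[X in _ + X](scale0r v); apply/is_derive_lineP.
pose phi := fun s : R => f (u + s *: v).
have d1 : derivable phi 0 1 by case: hf'.
have d2 : derivable g (phi 0) 1 by rewrite /phi scale0r addr0; case: hg.
have := derive1_comp d1 d2; rewrite /phi scale0r addr0 !derive1E => E.
apply: DeriveDef.
  apply/derivable1_diffP; apply: (@differentiable_comp _ _ _ _ phi g).
    exact/derivable1_diffP.
  exact/derivable1_diffP.
by rewrite E; case: hf' => _ ->; case: hg => _ ->.
Qed.

Lemma is_deriveV_fun f u v (df : R) : f u != 0 -> is_derive u v f df ->
  is_derive u v (fun x => (f x)^-1) (- (f u)^-1 ^+ 2 * df).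
Proof.
move=> fu [h E]; apply: DeriveDef; first exact: derivableV.
by rewrite deriveV// E exprVn.
Qed.

End DirectionalDerivatives.

Section Coordinates.
Context {R : realType}.
Local Notation V := 'rV[R]_3.
Implicit Types (u : V) (i j : 'I_3).

Definition di i : V := delta_mx 0 i.

Lemma is_derive_coord u v j : is_derive u v (fun x : V => x 0 j) (v 0 j).
Proof.
have E : (fun h : R => h^-1 *: ((h *: v + u) 0 j - u 0 j)) @ 0^' --> v 0 j.
  apply: cvg_near_cst; near=> h; have h0 : h != 0 by near: h; exact: nbhs_dnbhs_neq.
  by rewrite !mxE addrK [LHS]mulKf.

split; first exact: (cvgP _ E).
by apply: cvg_lim => //; exact: norm_hausdorff.
Unshelve. all: by end_near. Qed.

Lemma coord_le_norm u j : `|u 0 j| <= `|u|.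
Proof.
rewrite [leRHS]/Num.norm/= mx_normrE.
by apply: le_trans (le_bigmax _ _ (0, j)).
Qed.

Lemma norm_le_coord u (M : R) : 0 <= M -> (forall j, `|u 0 j| <= M) -> `|u| <= M.
Proof.
move=> M0 H; rewrite [leLHS]/Num.norm/= mx_normrE.
apply: bigmax_le => // -[i j] _; rewrite (ord1 i); exact: H.
Qed.

Lemma norm_coord_ex u : exists j, `|u 0 j| = `|u|.
Proof.
have [j _ Hj] := @Order.TotalTheory.arg_maxP _ _ 'I_3 ord0 xpredT (fun j => `|u 0 j|) isT.
exists j; apply/eqP; rewrite eq_le coord_le_norm norm_le_coord// => k.
exact: Hj.
Qed.

Lemma coord_cont j : continuous (fun u : V => u 0 j).
Proof. exact: coord_continuous. Qed.

End Coordinates.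

Section WeightedClass.
Context {R : realType}.
Local Notation V := 'rV[R]_3.
Implicit Types (f g w : V -> R) (u v : V) (i j : 'I_3) (lam N M : R) (k : nat).

Variable B : R.
Hypothesis B1 : 1 <= B.

Definition annulus u := B^-1 <= `|u| <= B.

(* Smoothness up to order k away from 0; on the annulus every derivative costs
   a factor lam. *)
Fixpoint Mu lam k N w : Prop :=
  [/\ forall u, u != 0 -> {for u, continuous w},
      forall u, annulus u -> `|w u| <= N &
      match k with
      | 0%N => True
      | k'.+1 => forall i, exists w', (forall u, u != 0 -> is_derive u (di i) w (w' u)) /\
                  Mu lam k' (lam * N) w'
      end].

Lemma near_neq0 u : u != 0 -> \forall v \near u, v != 0.
Proof.
move=> u0; suff : open [set v : V | v != 0] by move=> h; apply: open_nbhs_nbhs.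
rewrite (_ : [set v : V | v != 0] = ~` [set 0]).
  exact/closed_openC/accessible_closed_set1/hausdorff_accessible/norm_hausdorff.
by apply/seteqP; split => v /=; [move/eqP|move=> ?; apply/eqP].
Qed.

Lemma B_gt0 : 0 < B. Proof. exact: lt_le_trans ltr01 B1. Qed.
Let B0 := B_gt0.

(** A bound that holds on the annulus is nonnegative because the annulus has a point. *)
Lemma annulus_witness : annulus (mk3 1 0 0).
Proof.
rewrite /annulus; have -> : `|mk3 1 0 0 : V| = 1.
  apply/eqP; rewrite eq_le; apply/andP; split.
    apply: norm_le_coord => // -[[|[|[|//]]] h]; rewrite mxE (tnth_nth 0)/=;
      by rewrite ?normr1 ?normr0.
  apply: le_trans (coord_le_norm _ 0); by rewrite mxE (tnth_nth 0)/= normr1.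
by rewrite invf_le1 ?B1.
Qed.

Lemma Mu_bound_ge0 lam k N w : Mu lam k N w -> 0 <= N.
Proof. by case: k => [|k] [_ /(_ _ annulus_witness) + _]; exact: le_trans. Qed.

Lemma Mu_bound lam k N w u : Mu lam k N w -> annulus u -> `|w u| <= N.
Proof. by case: k => [|k] [_ + _]; apply. Qed.

Lemma Mu_ext lam k N w w' : (forall u, u != 0 -> w u = w' u) -> Mu lam k N w ->
  Mu lam k N w'.
Proof.
move=> E.
have near_E u : u != 0 -> \forall v \near u, w v = w' v.
  by move=> u0; apply: filterS (near_neq0 u0).
have cont u : u != 0 -> {for u, continuous w} -> {for u, continuous w'}.
  move=> u0 cw; rewrite /prop_for /continuous_at -(E _ u0).
  exact: (cvg_trans (near_eq_cvg (near_E u u0)) cw).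
have an0 u : annulus u -> u != 0.
  by move=> /andP[+ _]; apply: contraTneq => ->; rewrite normr0 -ltNge invr_gt0.
case: k => [|k] [c b d]; split=> //.
- by move=> u u0; apply: cont => //; exact: c.
- by move=> u au; rewrite -E ?an0//; exact: b.
- by move=> u u0; apply: cont => //; exact: c.
- by move=> u au; rewrite -E ?an0//; exact: b.
move=> i; have [w1 [dw hw]] := d i; exists w1; split=> // u u0.
by apply: near_eq_is_derive (dw _ u0); exact: near_E.
Qed.

Lemma Mu_le lam lam' k N N' w : 0 <= lam <= lam' -> N <= N' -> Mu lam k N w ->
  Mu lam' k N' w.
Proof.
move=> ll; elim: k N N' w => [|k IH] N N' w NN [c b d]; split=> //.
- by move=> u au; exact: le_trans (b _ au) NN.
- by move=> u au; exact: le_trans (b _ au) NN.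
move=> i; have [w1 [dw hw]] := d i; exists w1; split=> //.
apply: IH hw; case/andP: ll => l0 ll; apply: ler_pM => //.
exact: le_trans (normr_ge0 _) (b _ annulus_witness).
Qed.

Lemma Mu_leN lam k N N' w : 0 <= lam -> N <= N' -> Mu lam k N w -> Mu lam k N' w.
Proof. by move=> l0; apply: Mu_le; rewrite l0 lexx. Qed.

Lemma Mu_pred lam k N w : Mu lam k.+1 N w -> Mu lam k N w.
Proof.
elim: k N w => [|k IH] N w [c b d]; split=> // i.
by have [w1 [dw hw]] := d i; exists w1; split=> //; exact: IH.
Qed.

Lemma Mu_leK lam k k' N w : (k' <= k)%N -> Mu lam k N w -> Mu lam k' N w.
Proof.
move=> /subnK <-; elim: (k - k')%N => // m IH h; apply: IH; exact: Mu_pred.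
Qed.

Lemma Mu_add lam k N M f g : Mu lam k N f -> Mu lam k M g ->
  Mu lam k (N + M) (fun u => f u + g u).
Proof.
elim: k N M f g => [|k IH] N M f g [cf bf df] [cg bg dg]; split=> //.
- by move=> u u0; apply: continuousD; [exact: cf|exact: cg].
- by move=> u au; rewrite (le_trans (ler_normD _ _))// lerD ?bf ?bg.
- by move=> u u0; apply: continuousD; [exact: cf|exact: cg].
- by move=> u au; rewrite (le_trans (ler_normD _ _))// lerD ?bf ?bg.
move=> i; have [f' [Df hf]] := df i; have [g' [Dg hg]] := dg i.
exists (fun u => f' u + g' u); split.
  by move=> u u0; apply: is_deriveD_fun; [exact: Df|exact: Dg].
by rewrite mulrDr; exact: IH.
Qed.

(** The product rule doubles the number of terms with each order, whence 2^k. *)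
Lemma Mu_mul lam k N M f g : 0 <= lam -> Mu lam k N f -> Mu lam k M g ->
  Mu lam k (2 ^+ k * (N * M)) (fun u => f u * g u).
Proof.
move=> l0; elim: k N M f g => [|k IH] N M f g hf hg.
  have N0 := Mu_bound_ge0 hf; have M0 := Mu_bound_ge0 hg.
  move: hf hg => [cf bf _] [cg bg _]; split=> //.
    by move=> u u0; apply: continuousM; [exact: cf|exact: cg].
  by move=> u au; rewrite expr0 mul1r normrM ler_pM ?bf ?bg.
have N0 := Mu_bound_ge0 hf; have M0 := Mu_bound_ge0 hg.
have [hf1 hg1] : Mu lam k N f /\ Mu lam k M g by split; exact: Mu_pred.
move: hf hg => [cf bf df] [cg bg dg]; split=> //.
- by move=> u u0; apply: continuousM; [exact: cf|exact: cg].
- move=> u au; rewrite normrM; apply: le_trans (_ : N * M <= _).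
    by rewrite ler_pM ?bf ?bg.
  by rewrite ler_peMl ?mulr_ge0// exprn_ege1// ler1n.
move=> i; have [f' [Df hf]] := df i; have [g' [Dg hg]] := dg i.
exists (fun u => f u * g' u + g u * f' u); split.
  by move=> u u0; apply: is_deriveM_fun; [exact: Df|exact: Dg].
have -> : lam * (2 ^+ k.+1 * (N * M)) =
  2 ^+ k * (N * (lam * M)) + 2 ^+ k * (M * (lam * N)) by rewrite exprS; ring.
by apply: Mu_add; apply: IH.
Qed.

Lemma Mu_cst lam k (a : R) : 0 <= lam -> Mu lam k `|a| (fun=> a).
Proof.
move=> l0; suff H N : `|a| <= N -> Mu lam k N (fun=> a) by exact: H.
elim: k a N => [|k IH] b N bN; split=> //.
- by move=> u _; exact: cst_continuous.
- by move=> u _; exact: cst_continuous.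
move=> i; exists (fun=> 0); split; first by move=> u _; exact: is_derive_cst_fun.
by apply: IH; rewrite normr0 mulr_ge0// (le_trans _ bN).
Qed.

Lemma Mu_scale lam k (a : R) N f : 0 <= lam -> Mu lam k N f ->
  Mu lam k (2 ^+ k * (`|a| * N)) (fun u => a * f u).
Proof. by move=> l0 hf; apply: Mu_mul => //; exact: Mu_cst. Qed.

Lemma Mu_coord lam k j : 1 <= lam -> Mu lam k B (fun u => u 0 j).
Proof.
move=> l1; case: k => [|k]; split=> //.
- by move=> u _; exact: coord_cont.
- by move=> u /andP[_]; apply: le_trans; exact: coord_le_norm.
- by move=> u _; exact: coord_cont.
- by move=> u /andP[_]; apply: le_trans; exact: coord_le_norm.
move=> i; exists (fun=> di i 0 j); split; first by move=> u _; exact: is_derive_coord.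
apply: Mu_leN (_ : `|di i 0 j| <= _) _; first exact: le_trans l1.
  rewrite /di mxE/=; apply: (@le_trans _ _ 1).
    by case: eqP => _; rewrite ?normr1 ?normr0.
  by rewrite -[1]mulr1 ler_pM.
by apply: Mu_cst; exact: le_trans l1.
Qed.

(** The denominator of the field [Vf]: the sum of the u_j^4 is |grad F0|^2 / 9. *)
Definition Qinv u : R := (\sum_(j < 3) u 0 j ^+ 4)^-1.

Lemma Q_gt0 u : u != 0 -> 0 < \sum_(j < 3) u 0 j ^+ 4.
Proof.
move=> u0; have [j Hj] := norm_coord_ex u.
rewrite (bigD1 j)//= ltr_pwDl//.
  rewrite -[4%N]/(2 * 2)%N exprM exprn_even_gt0//= sqrf_eq0.
  by rewrite -normr_eq0 Hj normr_eq0.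
by apply: sumr_ge0 => i _; rewrite -[4%N]/(2 * 2)%N exprM sqr_ge0.
Qed.

Lemma is_derive_pow4 u i j : is_derive u (di i) (fun x : V => x 0 j ^+ 4)
   ((4 * u 0 j ^+ 3) * di i 0 j).
Proof. exact: (@is_deriveX _ _ (fun x : V => x 0 j) 4 u (di i) _ (is_derive_coord u (di i) j)). Qed.

Lemma sum_di (c : 'I_3 -> R) i : \sum_(j < 3) c j * di i 0 j = c i.
Proof.
rewrite (bigD1 i)//= /di mxE !eqxx/= mulr1 big1 ?addr0// => j ji.
by rewrite mxE/= (negPf ji) mulr0.
Qed.

Lemma is_derive_sum_fun (h : 'I_3 -> V -> R) u v (dh : 'I_3 -> R) :
  (forall j, is_derive u v (h j) (dh j)) ->
  is_derive u v (fun x => \sum_(j < 3) h j x) (\sum_(j < 3) dh j).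
Proof.
move=> H; rewrite (_ : (fun x => _) = \sum_(j < 3) h j); first exact: is_derive_sum.
by apply/funext => x; rewrite fct_sumE.
Qed.

Lemma is_derive_Qinv u i : u != 0 ->
  is_derive u (di i) Qinv (- 4 * ((u 0 i * u 0 i * u 0 i) * (Qinv u * Qinv u))).
Proof.
move=> u0.
have D : is_derive u (di i) (fun x : V => \sum_(j < 3) x 0 j ^+ 4) (4 * u 0 i ^+ 3).
  rewrite -(sum_di (fun j => 4 * u 0 j ^+ 3) i).
  by apply: is_derive_sum_fun => j; exact: is_derive_pow4.
have := is_deriveV_fun (lt0r_neq0 (Q_gt0 u0)) D.
rewrite -/(Qinv u).
by move=> h; apply: is_derive_eq h _; rewrite -/(Qinv u); ring.
Qed.

Lemma Qinv_bound u : annulus u -> `|Qinv u| <= B ^+ 4.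
Proof.
move=> /andP[uB _].
have u0 : u != 0 by apply: contraTneq uB => ->; rewrite normr0 -ltNge invr_gt0.
rewrite ger0_norm; last by rewrite invr_ge0 ltW// Q_gt0.
rewrite /Qinv -[leRHS]invrK lef_pV2 ?posrE ?Q_gt0 ?invr_gt0 ?exprn_gt0//.
have [j Hj] := norm_coord_ex u.
rewrite (bigD1 j)//= -[leLHS]addr0 lerD//.
  rewrite -exprVn -[leRHS]ger0_norm; last by rewrite -[4%N]/(2 * 2)%N exprM sqr_ge0.
  by rewrite normrX lerXn2r ?nnegrE ?invr_ge0 ?(ltW B0)// Hj.
by apply: sumr_ge0 => i _; rewrite -[4%N]/(2 * 2)%N exprM sqr_ge0.
Qed.

End WeightedClass.

(** * Bounds for [Qinv] with a constant independent of the annulus *)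

Section UniformConstants.
Context {R : realType}.
Local Notation V := 'rV[R]_3.

(** The derivative -4 u_i^3 Qinv^2 has size B^3 B^8 = B^7 B^4, so one derivative costs B^7. This is
    the origin of the recurring condition B^7 <= lam. *)
Lemma Mu_Qinv k : exists2 c : R, 1 <= c & forall B lam : R, 1 <= B -> B ^+ 7 <= lam ->
  Mu B lam k (c * B ^+ 4) Qinv.
Proof.
have cont (u : V) : u != 0 -> {for u, continuous (@Qinv R)}.
  move=> u0; apply: continuousV; first exact: lt0r_neq0 (Q_gt0 u0).
  suff H s : {for u, continuous (fun x : V => \sum_(j <- s) x 0 j ^+ 4)} by exact: H.
  elim: s => [|j s IH].
    rewrite (_ : (fun x : V => _) = fun=> 0); first exact: cst_continuous.
    by apply/funext => x; rewrite big_nil.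
  rewrite (_ : (fun x : V => _) = fun x => x 0 j ^+ 4 + \sum_(j <- s) x 0 j ^+ 4).
    apply: continuousD => //; apply: (@continuous_comp _ _ _ (fun x : V => x 0 j) (fun t : R => t ^+ 4)).
      exact: coord_cont.
    exact: exprn_continuous.
  by apply/funext => x; rewrite big_cons.
elim: k => [|k [c c1 IH]].
  exists 1 => // B lam B1 Bl; split=> //.
  by move=> u au; rewrite mul1r Qinv_bound.
have two1 : 1 <= 2 ^+ k :> R by rewrite exprn_ege1// ler1n.
exists (4 * (2 ^+ k) ^+ 5 * c ^+ 2).
  have : 1 <= (2 ^+ k) ^+ 5 :> R by rewrite exprn_ege1.
  have : 1 <= c ^+ 2 by rewrite exprn_ege1.
  by move: (c ^+ 2) ((2 ^+ k) ^+ 5) => x y; nra.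
move=> B lam B1 Bl.
have lam1 : 1 <= lam by apply: le_trans Bl; rewrite exprn_ege1.
have lam0 : 0 <= lam by exact: le_trans lam1.
have {}IH := IH B lam B1 Bl.
split; first by [].
  move=> u au; apply: le_trans (Qinv_bound B1 au) _.
  rewrite ler_peMl ?exprn_ge0 ?(le_trans ler01 B1)//.
  have : 1 <= (2 ^+ k) ^+ 5 :> R by rewrite exprn_ege1.
  have : 1 <= c ^+ 2 by rewrite exprn_ege1.
  by move: (c ^+ 2) ((2 ^+ k) ^+ 5) => x y; nra.
move=> i; exists (fun u : V => - 4 * ((u 0 i * u 0 i * u 0 i) * (Qinv u * Qinv u))).
split; first by move=> u u0; exact: is_derive_Qinv.
have X := @Mu_coord R B B1 lam k i lam1.
have H := Mu_scale B1 (- 4) lam0 (Mu_mul B1 lam0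
   (Mu_mul B1 lam0 (Mu_mul B1 lam0 X X) X) (Mu_mul B1 lam0 IH IH)).
apply: Mu_leN H => //.
rewrite normrN ger0_norm//.
have -> : 2 ^+ k * (4 * (2 ^+ k * (2 ^+ k * (2 ^+ k * (B * B) * B) *
          (2 ^+ k * (c * B ^+ 4 * (c * B ^+ 4)))))) =
  B ^+ 7 * (4 * (2 ^+ k) ^+ 5 * c ^+ 2 * B ^+ 4) by ring.
by rewrite ler_wpM2r// !mulr_ge0// ?exprn_ge0// (le_trans ler01).
Qed.

End UniformConstants.

Section AnnularClass.
Context {R : realType}.
Local Notation V := 'rV[R]_3.
Implicit Types (f g w : V -> R) (u v : V) (i j : 'I_3) (lam N M : R) (k : nat).

Variable B : R.
Hypothesis B1 : 1 <= B.

Definition CC lam k N f :=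
  (forall u, f u != 0 -> annulus B u) /\ Mu B lam k N f.

Lemma annulus_closed u : ~ annulus B u -> \forall v \near u, ~ annulus B v.
Proof.
move=> h.
have cn : {for u, continuous (fun v : V => `|v|)} by exact: norm_continuous.
have : `|u| < B^-1 \/ B < `|u|.
  case: (ltP `|u| B^-1) => h1; first by left.
  by case: (ltP B `|u|) => h2; [right|exfalso; apply: h; rewrite /annulus h1 h2].
case=> h1.
  have : \forall v \near u, `|v : V| < B^-1 by exact: (cvgr_lt _ cn _ h1).
  by apply: filterS => v vB /andP[]; rewrite leNgt vB.
have : \forall v \near u, B < `|v : V| by exact: (cvgr_gt _ cn _ h1).
by apply: filterS => v vB /andP[_]; rewrite leNgt vB.
Qed.

Lemma CC_near0 lam k N f u : CC lam k N f -> ~ annulus B u -> \forall v \near u, f v = 0.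
Proof.
move=> [sf _] /annulus_closed; apply: filterS => v nv.
by apply: contra_notP nv => /eqP; exact: sf.
Qed.

Lemma annulus_neq0 u : annulus B u -> u != 0.
Proof.
by move=> /andP[+ _]; apply: contraTneq => ->; rewrite normr0 -ltNge invr_gt0 B_gt0.
Qed.

Lemma not_annulus0 : ~ annulus B (0 : V).
Proof. by move=> /annulus_neq0; rewrite eqxx. Qed.

Lemma CC_ge0 lam k N f : CC lam k N f -> 0 <= N.
Proof. by move=> [_ /(Mu_bound_ge0 B1)]. Qed.

Lemma CC_bound lam k N f u : CC lam k N f -> `|f u| <= N.
Proof.
move=> hf; have [/eqP ->|fu] := boolP (f u == 0).
  by rewrite normr0; exact: CC_ge0 hf.
by case: hf => sf /Mu_bound; apply; exact: sf.
Qed.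

Lemma CC_supp lam k N f u : CC lam k N f -> ~ annulus B u -> f u = 0.
Proof. by move=> hf /(CC_near0 hf); exact: nbhs_singleton. Qed.

(** Off the annulus f vanishes in a neighbourhood. The origin is such a point, so smoothness away
    from 0 becomes smoothness everywhere. *)
Lemma CC_derive lam k N f i : CC lam k.+1 N f ->
  (forall u, is_derive u (di i) f ('D_(di i) f u)) /\
  CC lam k (lam * N) ('D_(di i) f).
Proof.
move=> hf; have near0 u : ~ annulus B u -> is_derive u (di i) f 0.
  move=> /(CC_near0 hf) h.
  have h' : \forall v \near u, (fun=> 0) v = f v by apply: filterS h => v ->.
  exact: near_eq_is_derive h' (is_derive_cst_fun 0 u (di i)).
have [sf [_ _ /(_ i) [w' [Dw hw]]]] := hf.
have D u : is_derive u (di i) f ('D_(di i) f u).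
  have [/eqP ->|u0] := boolP (u == 0).
    by apply: derivableP; case: (near0 0 not_annulus0).
  by apply: derivableP; case: (Dw u u0).
split=> //; split.
  move=> u; apply: contraNP => /near0 [_ ->]; exact: eqxx.
by apply: (Mu_ext B1) hw => u u0; case: (Dw u u0) => _ ->.
Qed.

Lemma CC_mul lam k N M f w : 0 <= lam -> CC lam k N f -> Mu B lam k M w ->
  CC lam k (2 ^+ k * (N * M)) (fun u => f u * w u).
Proof.
move=> l0 [sf hf] hw; split; last exact: Mu_mul.
by move=> u; rewrite mulf_eq0 negb_or => /andP[/sf].
Qed.

Lemma CC_add lam k N M f g : CC lam k N f -> CC lam k M g ->
  CC lam k (N + M) (fun u => f u + g u).
Proof.
move=> [sf hf] [sg hg]; split; last exact: Mu_add.
move=> u; apply: contraNP => nu; apply/eqP.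
have -> : f u = 0 by apply: contra_notP nu => /eqP; exact: sf.
have -> : g u = 0 by apply: contra_notP nu => /eqP; exact: sg.
by rewrite addr0.
Qed.

Lemma CC_leN lam k N N' f : 0 <= lam -> N <= N' -> CC lam k N f -> CC lam k N' f.
Proof. by move=> l0 NN [sf hf]; split=> //; exact: Mu_leN hf. Qed.

Lemma CC_leK lam k k' N f : (k' <= k)%N -> CC lam k N f -> CC lam k' N f.
Proof. by move=> kk [sf hf]; split=> //; exact: Mu_leK hf. Qed.

Lemma CC_lam lam lam' k N f : 0 <= lam <= lam' -> CC lam k N f -> CC lam' k N f.
Proof. by move=> ll [sf hf]; split=> //; exact: (Mu_le B1 ll (lexx N)). Qed.

(* [Vf] is a field with [Vf . grad F0 = 1] away from 0. *)
Definition Vf i u : R := 3^-1 * (u 0 i * u 0 i * Qinv u).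

(** The divergence of f Vf: up to sign, the adjoint of differentiation along [Vf], hence of d/dt on
    functions of t = F0. *)
Definition Lop f u : R := \sum_(i < 3) 'D_(di i) (fun v => f v * Vf i v) u.

Lemma Vf_grad u : u != 0 -> \sum_(i < 3) Vf i u * (3 * u 0 i ^+ 2) = 1.
Proof.
move=> u0; rewrite -[RHS](@mulVf _ (\sum_(j < 3) u 0 j ^+ 4)) ?lt0r_neq0 ?Q_gt0//.
rewrite mulr_sumr; apply: eq_bigr => i _; rewrite /Vf /Qinv.
field; exact: lt0r_neq0 (Q_gt0 u0).
Qed.

Lemma is_derive_F0 u i : is_derive u (di i) (fun x : V => F0 x) (3 * u 0 i ^+ 2).
Proof.
rewrite -(sum_di (fun j => 3 * u 0 j ^+ 2) i) /F0.
apply: is_derive_sum_fun => j.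
exact: (@is_deriveX _ _ (fun x : V => x 0 j) 3 u (di i) _ (is_derive_coord u (di i) j)).
Qed.

Lemma F0_cont : continuous (fun x : V => F0 x).
Proof.
move=> u; rewrite /F0.
suff H s : {for u, continuous (fun x : V => \sum_(j <- s) x 0 j ^+ 3)} by exact: H.
elim: s => [|j s IH].
  rewrite (_ : (fun x : V => _) = fun=> 0); first exact: cst_continuous.
  by apply/funext => x; rewrite big_nil.
rewrite (_ : (fun x : V => _) = fun x => x 0 j ^+ 3 + \sum_(j <- s) x 0 j ^+ 3).
  apply: continuousD => //; apply: (@continuous_comp _ _ _ (fun x : V => x 0 j) (fun t : R => t ^+ 3)).
    exact: coord_cont.
  exact: exprn_continuous.
by apply/funext => x; rewrite big_cons.
Qed.

Lemma F0_bound u : `|u| <= B -> `|F0 u| <= 3 * B ^+ 3.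
Proof.
move=> uB; rewrite /F0; apply: le_trans (ler_norm_sum _ _ _) _.
rewrite (_ : 3 * B ^+ 3 = \sum_(i < 3) B ^+ 3); last first.
  by rewrite sumr_const card_ord mulr_natl.
apply: ler_sum => i _; rewrite normrX lerXn2r ?nnegrE ?(ltW (B_gt0 B1))//.
exact: le_trans (coord_le_norm u i) uB.
Qed.

End AnnularClass.

Lemma big_ord3 (W : nmodType) (h : 'I_3 -> W) : \sum_(i < 3) h i = h 0 + h 1 + h 2.
Proof.
rewrite !big_ord_recl big_ord0 addr0 addrA.
by congr (h _ + h _ + h _); apply: val_inj.
Qed.

Section OperatorBounds.
Context {R : realType}.
Local Notation V := 'rV[R]_3.

Lemma Mu_Vf k : exists2 c : R, 0 <= c & forall (B lam : R) i, 1 <= B -> B ^+ 7 <= lam ->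
  Mu B lam k (c * B ^+ 6) (Vf i).
Proof.
have [c c1 H] := @Mu_Qinv R k.
exists (3^-1 * (2 ^+ k) ^+ 3 * c).
  by rewrite !mulr_ge0// ?exprn_ge0// (le_trans ler01).
move=> B lam i B1 Bl.
have lam1 : 1 <= lam by apply: le_trans Bl; rewrite exprn_ege1.
have lam0 : 0 <= lam by exact: le_trans lam1.
have X := @Mu_coord R B B1 lam k i lam1.
have := Mu_scale B1 3^-1 lam0 (Mu_mul B1 lam0 (Mu_mul B1 lam0 X X) (H B lam B1 Bl)).
apply: (Mu_leN B1 lam0); rewrite ger0_norm ?invr_ge0//.
by rewrite le_eqVlt; apply/orP; left; apply/eqP; ring.
Qed.

Lemma CC_L k : exists2 c : R, 0 <= c & forall (B lam N : R) f, 1 <= B -> B ^+ 7 <= lam ->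
  CC B lam k.+1 N f -> CC B lam k (c * (lam * B ^+ 6) * N) (Lop f).
Proof.
have [c c0 H] := Mu_Vf k.+1.
exists (3 * 2 ^+ k.+1 * c); first by rewrite !mulr_ge0// exprn_ge0.
move=> B lam N f B1 Bl hf.
have lam1 : 1 <= lam by apply: le_trans Bl; rewrite exprn_ege1.
have lam0 : 0 <= lam by exact: le_trans lam1.
have hi i := (CC_derive B1 i (CC_mul B1 lam0 hf (H B lam i B1 Bl))).2.
rewrite /Lop.
have -> : (fun u : V => \sum_(i < 3) 'D_(di i) (fun v => f v * Vf i v) u) =
  (fun u => 'D_(di 0) (fun v => f v * Vf 0 v) u + 'D_(di 1) (fun v => f v * Vf 1 v) u
     + 'D_(di 2) (fun v => f v * Vf 2 v) u).
  by apply/funext => u; rewrite big_ord3.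
have := CC_add (CC_add (hi 0) (hi 1)) (hi 2).
apply: (CC_leN B1 lam0).
by rewrite le_eqVlt; apply/orP; left; apply/eqP; ring.
Qed.

Lemma CC_iterL k j : (j <= k)%N -> exists2 c : R, 0 <= c &
  forall (B lam N : R) f, 1 <= B -> B ^+ 7 <= lam ->
  CC B lam k N f -> CC B lam (k - j) (c * (lam * B ^+ 6) ^+ j * N) (iter j Lop f).
Proof.
elim: j => [|j IH] jk.
  exists 1 => // B lam N f B1 Bl hf; by rewrite subn0 expr0 !mul1r.
have [c c0 H] := IH (ltnW jk).
have [c' c'0 H'] := CC_L (k - j.+1).
exists (c' * c); first by rewrite mulr_ge0.
move=> B lam N f B1 Bl hf.
have h := H B lam N f B1 Bl hf.
rewrite -subnSK// in h.
have := H' _ _ _ _ B1 Bl h.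
move: h; set x := lam * B ^+ 6; rewrite [x ^+ j.+1]exprS => _.
by rewrite (_ : _ * _ * (c * _ * N) = c' * c * (x * x ^+ j) * N)//; ring.
Qed.

End OperatorBounds.

(** * Symmetry of second derivatives *)

Section Clairaut.
Context {R : realType}.
Local Notation V := 'rV[R]_3.
Implicit Types (f g : V -> R) (u v : V) (i j : 'I_3).

Lemma MVT_real (phi dphi : R -> R) (a b : R) : a < b ->
  (forall t : R, is_derive t 1 phi (dphi t)) ->
  exists2 c, a < c < b & phi b - phi a = dphi c * (b - a).
Proof.
move=> ab D; have cphi : {within `[a, b], continuous phi}.
  by apply: continuous_subspaceT => x; apply/differentiable_continuous/derivable1_diffP; case: (D x).
have [c cab E] := MVT ab (fun x _ => D x) cphi.
by exists c => //; move: cab; rewrite in_itv.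
Qed.

Lemma is_derive_line0 f u i (D : V -> R) (t : R) : (forall v, is_derive v (di i) f (D v)) ->
  is_derive t 1 (fun s : R => f (u + s *: di i)) (D (u + t *: di i)).
Proof. by move=> H; exact: (is_derive_lineP f u (di i) t _).1 (H _). Qed.

Lemma second_difference f u i j (Di Dji : V -> R) (h : R) : 0 < h ->
  (forall v, is_derive v (di i) f (Di v)) ->
  (forall v, is_derive v (di j) Di (Dji v)) ->
  exists s t, [/\ 0 < s < h, 0 < t < h &
    f (u + h *: di j + h *: di i) - f (u + h *: di i) - (f (u + h *: di j) - f u) =
    Dji (u + s *: di i + t *: di j) * h * h].
Proof.
move=> h0 Hi Hj.
pose phi := fun s : R => f (u + h *: di j + s *: di i) - f (u + s *: di i).
have dphi (s : R) : is_derive s 1 phi (Di (u + h *: di j + s *: di i) - Di (u + s *: di i)).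
  by apply: is_deriveB; exact: is_derive_line0.
have [s s0 Es] := MVT_real h0 dphi.
have [t t0 Et] := MVT_real h0 (fun t => is_derive_line0 (u + s *: di i) t Hj).
exists s, t; split=> //.
move: Es Et; rewrite /phi !scale0r !addr0 !subr0 => -> Et.
rewrite (_ : u + h *: di j + s *: di i = u + s *: di i + h *: di j) ?Et//.
by rewrite addrAC.
Qed.

(** The same second difference is h^2 times either mixed derivative, each taken at some point of a
    small square at u; continuity of both at u then forces equality. *)
Lemma clairaut f u i j (Di Dj Dji Dij : V -> R) :
  (forall v, is_derive v (di i) f (Di v)) -> (forall v, is_derive v (di j) f (Dj v)) ->
  (forall v, is_derive v (di j) Di (Dji v)) -> (forall v, is_derive v (di i) Dj (Dij v)) ->
  {for u, continuous Dji} -> {for u, continuous Dij} -> Dji u = Dij u.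
Proof.
move=> Hi Hj Hji Hij cji cij.
apply/eqP; rewrite -subr_eq0 -normr_le0; apply/ler_addgt0Pr => eps eps0; rewrite add0r.
have e2 : 0 < eps / 2 by rewrite divr_gt0.
have N1 : \forall v \near u, `|Dji u - Dji v| < eps / 2.
  by move/cvgrPdist_lt : cji => /(_ _ e2).
have N2 : \forall v \near u, `|Dij u - Dij v| < eps / 2.
  by move/cvgrPdist_lt : cij => /(_ _ e2).
have N3 : nbhs u [set v | `|Dji u - Dji v| < eps / 2 /\ `|Dij u - Dij v| < eps / 2].
  exact: filterI N1 N2.
have [r /= r0 Hr] := (@nbhs_ballP R V u _).1 N3.
pose h := r / 4; have h0 : 0 < h by rewrite divr_gt0.
have dn l : `|di l : V| <= 1.
  apply: norm_le_coord => // k; rewrite mxE/=.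
  by case: eqP => _; rewrite ?normr1 ?normr0.
have nearp (a b : 'I_3) s t : 0 < s < h -> 0 < t < h ->
    ball u r (u + s *: di a + t *: di b).
  move=> /andP[s0 sh] /andP[t0 th]; rewrite -ball_normE/=.
  rewrite -addrA opprD addrA subrr add0r normrN.
  apply: le_lt_trans (ler_normD _ _) _; rewrite !normrZ !gtr0_norm//.
  have := dn a; have := dn b; rewrite /h in sh th.
  move: (`|_|) (`|_|) (normr_ge0 (di a : V)) (normr_ge0 (di b : V)) => x y.
  by move=> *; nra.
have [s [t [hs ht E1]]] := second_difference u h0 Hi Hji.
have [s' [t' [hs' ht' E2]]] := second_difference u h0 Hj Hij.
have E : Dji (u + s *: di i + t *: di j) = Dij (u + s' *: di j + t' *: di i).
  have hh : h * h != 0 by rewrite mulf_neq0// lt0r_neq0.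
  apply: (mulIf hh); rewrite [LHS]mulrA [RHS]mulrA.
  rewrite -[LHS]E1 -[RHS]E2 [u + h *: di i + h *: di j]addrAC; ring.
have /= [_ H2] := Hr (u + s' *: di j + t' *: di i) (nearp j i s' t' hs' ht').
have /= [H1 _] := Hr (u + s *: di i + t *: di j) (nearp i j s t hs ht).
set p := u + s *: di i + t *: di j in E H1 *.
have H3 : `|Dji p - Dij u| <= eps / 2 by rewrite E distrC ltW.
apply: (le_trans (ler_distD (Dji p) (Dji u) (Dij u))).
by rewrite [leRHS]splitr; exact: lerD (ltW H1) H3.
Qed.

End Clairaut.

(** * Test functions supported away from the origin *)

Section SmoothCompactSupport.
Context {R : realType}.
Local Notation V := 'rV[R]_3.
Implicit Types (f g : V -> R) (u v : V) (i j : 'I_3) (s : seq 'I_3).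

Lemma smooth_iter s f : smooth f -> smooth (iter_partial s f).
Proof.
move=> sf s'; rewrite /iter_partial -foldr_cat; exact: sf.
Qed.

Lemma smooth_is_derive f i u : smooth f -> is_derive u (di i) f ('D_(di i) f u).
Proof. by move=> sf; apply: derivableP; have [_] := sf [::]; apply. Qed.

Lemma iter_partial_swap f i j : smooth f ->
  iter_partial [:: i; j] f = iter_partial [:: j; i] f.
Proof.
move=> sf; apply/funext => u /=.
apply: (@clairaut R f u j i ('D_(di j) f) ('D_(di i) f)
  (iter_partial [:: i; j] f) (iter_partial [:: j; i] f)).
- by move=> v; exact: smooth_is_derive.
- by move=> v; exact: smooth_is_derive.
- by move=> v; apply: smooth_is_derive; exact: (smooth_iter [:: j] sf).
- by move=> v; apply: smooth_is_derive; exact: (smooth_iter [:: i] sf).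
- by have [c _] := sf [:: i; j]; exact: (c u).
- by have [c _] := sf [:: j; i]; exact: (c u).
Qed.

(** [Cnorm] takes derivatives in one fixed order of the coordinates, whereas the class [Mu]
    differentiates in any order. *)
Lemma iter_partial_perm f s s' : smooth f -> perm_eq s s' ->
  iter_partial s f = iter_partial s' f.
Proof.
move=> sf; elim: s s' => [|i s IH] s' p.
  by have /perm_size := p; case: s' p.
have is' : i \in s' by rewrite -(perm_mem p) mem_head.
have Hmove (s1 s2 : seq 'I_3) : iter_partial (s1 ++ i :: s2) f = iter_partial (i :: s1 ++ s2) f.
  elim: s1 => [//|j s1 IH1] /=.
  have -> : iter_partial (s1 ++ i :: s2) f = iter_partial (i :: s1 ++ s2) f := IH1.
  exact: (iter_partial_swap j i (smooth_iter (s1 ++ s2) sf)).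
case/splitPr: is' p => s1 s2 p.
rewrite Hmove /= (IH (s1 ++ s2))//.
by rewrite -(perm_cons i) (perm_trans p)// -cat1s perm_catCA/=.
Qed.

Lemma Supp_compl_nbhs f u : ~ Supp f u -> nbhs u (~` Supp f).
Proof.
move=> nS; apply: open_nbhs_nbhs; split=> //.
by apply: closed_openC; exact: closed_closure.
Qed.

Lemma Supp_eq0 f u : ~ Supp f u -> f u = 0.
Proof.
by apply: contra_notP => /eqP fu; exact: subset_closure.
Qed.

Lemma iter_partial_off_supp s f u : ~ Supp f u -> iter_partial s f u = 0.
Proof.
elim: s u => [|i s IH] u nS; first exact: Supp_eq0.
have h : \forall v \near u, (fun=> 0) v = iter_partial s f v.
  by apply: filterS (Supp_compl_nbhs nS) => v nv; rewrite IH.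
by case: (near_eq_is_derive h (is_derive_cst_fun 0 u (di i))).
Qed.

Lemma iter_partial_bounded s f : smooth_compact_supp f ->
  exists M, forall u, `|iter_partial s f u| <= M.
Proof.
move=> [sf cf].
have cs : continuous (iter_partial s f) by have [] := sf s.
have ci : compact (iter_partial s f @` Supp f).
  by apply: continuous_compact => //; exact: continuous_subspaceT.
have /compact_bounded [M [_ HM]] := ci.
exists (`|M| + 1) => u.
have [Su|nS] := pselect (Supp f u); last by rewrite iter_partial_off_supp// normr0.
apply: HM; last by exists u.
by rewrite ltr_pwDr// ler_norm.
Qed.

Lemma Cnorm_bound (k : nat) f s u : smooth_compact_supp f -> (size s <= k)%N ->
  `|iter_partial s f u| <= Cnorm k f.
Proof.
move=> hf sk; have [sf _] := hf.
pose alpha : {ffun 'I_3 -> 'I_k.+1} := [ffun i => inord (count_mem i s)].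
have aE i : alpha i = count_mem i s :> nat.
  by rewrite ffunE inordK// ltnS (leq_trans (count_size _ _)).
have p : perm_eq s (flatten [seq nseq (alpha i) i | i <- enum 'I_3]).
  apply/allP => x _ /=; rewrite count_flatten -map_comp/=.
  rewrite (eq_map (g := fun i => ((i == x) * count_mem x s)%N)); last first.
    by move=> i /=; rewrite count_nseq/= aE; case: eqP => [->|]; rewrite ?mul0n ?mul1n.
  rewrite sumnE big_map big_enum/= (bigD1 x)//= eqxx mul1n big1 ?addn0//.
  by move=> i /negPf ->.
rewrite (iter_partial_perm sf p).
have [M HM] := iter_partial_bounded (flatten [seq nseq (alpha i) i | i <- enum 'I_3]) hf.
apply: (@le_trans _ _ (sup (range (fun v => `|multi_partial (fun i => alpha i) f v|)))).
  apply: ub_le_sup; last by exists u.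
  by exists M => _ [v _ <-]; exact: HM.
have Pa : (\sum_(i < 3) alpha i <= k)%N.
  rewrite (leq_trans _ sk)// (perm_size p) size_flatten /shape -map_comp sumnE big_map.
  by rewrite big_enum/= leq_eqVlt; apply/orP; left; apply/eqP/eq_bigr => i _; rewrite /= size_nseq.
pose Fs (alpha : {ffun 'I_3 -> 'I_k.+1}) : R := sup (range (fun u => `|multi_partial (fun i => alpha i) f u|)).
exact: (le_bigmax_cond 0 Fs Pa).
Qed.

(* When [Supp f] is compact and avoids 0, the default value of
   [least_supp_bound] is never used. *)
Lemma least_supp_boundP f : smooth_compact_supp f -> ~ Supp f 0 ->
  supp_bound f (least_supp_bound f).
Proof.
move=> [_ cf] nS0.
suff [B0 HB0] : exists B, supp_bound f B.
  have exP : exists B, `[< supp_bound f B >] by exists B0; apply/asboolP.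
  have E : exists B, [set B | supp_bound f B /\ forall B', supp_bound f B' -> (B <= B')%N] B.
    exists (ex_minn exP); case: ex_minnP => B /asboolP h1 h2; split=> // B' h'.
    by apply: h2; apply/asboolP.
  by have [] := xgetPex 1%N E.
have /compact_bounded [M [_ HM]] := cf.
have [r /= r0 Hr] := (@nbhs_ballP R V 0 _).1 (Supp_compl_nbhs nS0).
pose B := maxn (Num.truncn (`|M| + 1)).+1 (Num.truncn r^-1).+1.
exists B; split; first by rewrite /B leq_max.
move=> u Su; apply/andP; split.
  have h : r <= `|u|.
    rewrite leNgt; apply/negP => ur; apply: (Hr u) Su.
    by rewrite -ball_normE/= sub0r normrN.
  apply: le_trans h; rewrite -[leRHS]invrK lef_pV2 ?posrE ?invr_gt0//.
    by apply: ltW; apply: (lt_le_trans (truncnS_gt _)); rewrite ler_nat leq_maxr.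
  by rewrite ltr0n /B leq_max.
apply: le_trans (HM (`|M| + 1) _ _ Su) _; first by rewrite ltr_pwDr// ler_norm.
by apply: ltW; apply: (lt_le_trans (truncnS_gt _)); rewrite ler_nat leq_maxl.
Qed.

(** All derivatives up to order 100 are bounded by one norm, so every cost lam >= 1 is
    admissible. *)
Lemma smooth_CC f (lam : R) (k : nat) : smooth_compact_supp f -> ~ Supp f 0 ->
  1 <= lam -> (k <= 100)%N ->
  CC (least_supp_bound f)%:R lam k (Cnorm 100 f) f.
Proof.
move=> hf nS0 lam1 k100; have [B1 HB] := least_supp_boundP hf nS0.
split.
  by move=> u fu; apply: HB; exact: subset_closure.
have lam0 : 0 <= lam by exact: le_trans lam1.
suff H s N : (size s + k <= 100)%N -> Cnorm 100 f <= N ->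
    Mu (least_supp_bound f)%:R lam k N (iter_partial s f) by exact: (H [::]).
elim: k s N {k100} => [|k IH] s N sk CN.
  split=> //; first by move=> u _; have [c _] := hf.1 s; exact: (c u).
  by move=> u _; apply: le_trans CN; apply: Cnorm_bound => //; lia.
split=> //; first by move=> u _; have [c _] := hf.1 s; exact: (c u).
  by move=> u _; apply: le_trans CN; apply: Cnorm_bound => //; lia.
move=> i; exists (iter_partial (i :: s) f); split.
  by move=> u _; apply: smooth_is_derive; apply: smooth_iter; case: hf.
apply: IH => /=; first by lia.
have N0 : 0 <= N.
  by apply: le_trans CN; apply: le_trans (@Cnorm_bound 100 f [::] 0 hf isT).
by apply: (le_trans CN); rewrite ler_peMl.
Qed.

End SmoothCompactSupport.

(** * Lattice sums and integrals *)

Section BoundedIntegrals.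
Context {d : measure_display} {T : measurableType d} {R : realType}.
Variable mu : {measure set T -> \bar R}.
Variable E : set T.
Hypotheses (mE : measurable E) (finE : (mu E < +oo)%E).
Implicit Types (g : T -> R) (M : R).

(** Bounded, measurable and null off a set of finite measure: a class closed under the operations
    below, in which linearity, dominated convergence and Fubini carry no integrability
    conditions. *)
Definition adm M g := [/\ measurable_fun setT g, forall x, `|g x| <= M &
  forall x, ~ E x -> g x = 0].

Lemma adm_integrable M g : adm M g -> mu.-integrable setT (EFin \o g).
Proof.
move=> [mg gM gE].
have : mu.-integrable E (EFin \o g).
  apply: measurable_bounded_integrable => //; first exact: (measurable_funS measurableT).
  exists M; split; first exact: num_real.
  by move=> x Mx t _; exact: (le_trans (gM t) (ltW Mx)).
move=> /(integrable_mkcond _ mE); congr (mu.-integrable _ _).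
apply/funext => x /=; rewrite /patch; case: ifPn => //.
by move=> /negP h; rewrite gE// => Ex; apply: h; rewrite inE.
Qed.

Lemma adm_norm M g : adm M g -> adm M (fun x => `|g x|).
Proof.
move=> [mg gM gE]; split.
- by apply: measurableT_comp => //; exact: measurable_normr.
- by move=> x; rewrite normr_id.
- by move=> x /gE ->; rewrite normr0.
Qed.

Lemma adm_le M M' g : M <= M' -> adm M g -> adm M' g.
Proof. by move=> MM [mg gM gE]; split=> // x; exact: le_trans (gM x) MM. Qed.

Lemma adm_add M N f g : adm M f -> adm N g -> adm (M + N) (fun x => f x + g x).
Proof.
move=> [mf fM fE] [mg gM gE]; split; first exact: measurable_funD.
- by move=> x; rewrite (le_trans (ler_normD _ _))// lerD.
- by move=> x nE; rewrite fE// gE// addr0.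
Qed.

Lemma adm_mul M N f g : 0 <= N -> adm M f -> measurable_fun setT g ->
  (forall x, E x -> `|g x| <= N) -> adm (M * N) (fun x => f x * g x).
Proof.
move=> N0 [mf fM fE] mg gN; split; first exact: measurable_funM.
- move=> x; have M0 : 0 <= M by exact: le_trans (fM x).
  have [Ex|nEx] := pselect (E x); last by rewrite fE// mul0r normr0 mulr_ge0.
  by rewrite normrM ler_pM// gN.
- by move=> x nE; rewrite fE// mul0r.
Qed.

Lemma adm_scale M f (a : R) : adm M f -> adm (`|a| * M) (fun x => a * f x).
Proof.
move=> [mf fM fE]; split; first exact: measurable_funM.
- by move=> x; rewrite normrM ler_wpM2l.
- by move=> x nE; rewrite fE// mulr0.
Qed.

Lemma adm_integral_bound M g : adm M g -> `|\int[mu]_x g x| <= M * fine (mu E).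
Proof.
move=> h; have [mg gM gE] := h.
have iE : mu.-integrable E (EFin \o g).
  by apply: (integrableS measurableT mE _ (adm_integrable h)).
have iE' : mu.-integrable E (EFin \o (fun x => `|g x|)).
  by apply: (integrableS measurableT mE _ (adm_integrable (adm_norm h))).
have -> : \int[mu]_x g x = \int[mu]_(x in E) g x.
  rewrite [RHS]Rintegral_mkcond; apply: eq_Rintegral => x _.
  rewrite /patch; case: ifPn => // /negP nE; rewrite gE// => Ex; apply: nE; rewrite inE//.
apply: le_trans (le_normr_Rintegral mE iE) _.
rewrite -(Rintegral_cst mu mE).
apply: le_Rintegral => //.
apply: (@measurable_bounded_integrable _ _ _ mu (cst M)) => //.
exists `|M|; split; first exact: num_real.
by move=> x Mx t _ /=; exact: ltW.
Qed.

Lemma adm_integralD M N f g : adm M f -> adm N g ->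
  \int[mu]_x (f x + g x) = \int[mu]_x f x + \int[mu]_x g x.
Proof. by move=> hf hg; apply: RintegralD; rewrite ?(adm_integrable hf) ?(adm_integrable hg). Qed.

Lemma adm_integralZ M f (a : R) : adm M f ->
  \int[mu]_x (a * f x) = a * \int[mu]_x f x.
Proof. by move=> hf; apply: RintegralZl => //; exact: adm_integrable hf. Qed.

Lemma adm_integralB M N f g : adm M f -> adm N g ->
  \int[mu]_x (f x - g x) = \int[mu]_x f x - \int[mu]_x g x.
Proof. by move=> hf hg; apply: RintegralB; rewrite ?(adm_integrable hf) ?(adm_integrable hg). Qed.

Lemma adm0 : adm 0 (fun=> 0).
Proof. by split=> // x; rewrite normr0. Qed.

Lemma adm_sum (I : Type) (r : seq I) (F : I -> T -> R) (M : I -> R) :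
  (forall i, adm (M i) (F i)) ->
  adm (\sum_(i <- r) M i) (fun x => \sum_(i <- r) F i x) /\
  \int[mu]_x (\sum_(i <- r) F i x) = \sum_(i <- r) \int[mu]_x F i x.
Proof.
move=> H; elim: r => [|i r [IH1 IH2]].
  rewrite !big_nil (_ : (fun x => _) = fun=> 0); last by apply/funext => x; rewrite big_nil.
  by split; [exact: adm0|rewrite Rintegral_cst// mul0r].
rewrite !big_cons (_ : (fun x => _) = fun x => F i x + \sum_(j <- r) F j x); last first.
  by apply/funext => x; rewrite big_cons.
by split; [exact: adm_add|rewrite (adm_integralD (H i) IH1) IH2].
Qed.

Lemma adm_cvg M (f_ : nat -> T -> R) f : (forall n, adm M (f_ n)) ->
  (forall x, f_ n x @[n --> \oo] --> f x) ->
  adm M f /\ \int[mu]_x f_ n x @[n --> \oo] --> \int[mu]_x f x.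
Proof.
move=> H cv.
have mf : measurable_fun setT f.
  by apply: (measurable_fun_cvg (h := f_)) => // n; have [] := H n.
have M0 (x : T) : 0 <= M.
  by have [_ h _] := H 0%N; exact: le_trans (normr_ge0 _) (h x).
have af : adm M f.
  split=> //.
    move=> x; apply: (cvgr_to_le (cvg_norm (cv x))).
    by apply: nearW => n; have [_ h _] := H n; exact: h.
  move=> x nE; apply: (cvg_unique _ (cv x)) => //.
  rewrite (_ : (fun n => f_ n x) = fun=> 0); first exact: cvg_cst.
  by apply/funext => n; have [_ _ h] := H n; exact: h.
split=> //.
have aE : adm `|M| (fun x => M * \1_E x).
  split.
  - by apply: measurable_funM => //; exact/measurable_indicP.
  - move=> x; rewrite indicE; case: (_ \in _); rewrite ?mulr1// mulr0 normr0//.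
  - by move=> x nE; rewrite indicE memNset// mulr0.
have h1 n : measurable_fun setT (fun x => (f_ n x)%:E).
  by apply/measurable_EFinP; have [] := H n.
have h2 : measurable_fun setT (fun x => (f x)%:E) by exact/measurable_EFinP.
have h3 : {ae mu, forall x, setT x -> (f_ n x)%:E @[n --> \oo] --> (f x)%:E}.
  by apply: aeW => x _; apply: cvg_EFin; [exact: nearW|exact: cv].
have h4 := adm_integrable aE.
have h5 : {ae mu, forall x n, setT x -> (`|(f_ n x)%:E| <= (M * \1_E x)%R%:E)%E}.
  apply: aeW => x n _; have [_ b0 b1] := H n; rewrite /= lee_fin indicE.
  have [Ex|nEx] := pselect (E x); first by rewrite mem_set// mulr1 b0.
  by rewrite b1// normr0 mulr_ge0 ?M0.
have [_ _ h] := dominated_convergence measurableT h1 h2 h3 h4 h5.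
have fin : (\int[mu]_x (f x)%:E)%E \is a fin_num.
  exact: (integrable_fin_num measurableT (adm_integrable af)).
by rewrite -(fineK fin) in h; exact: fine_cvg h.
Qed.

End BoundedIntegrals.

(** The integers of [-N, N), half-open so that residue blocks and lattice cells tile without
    overlap. *)
Definition zl (N : nat) : seq int := [seq i%:Z - N%:Z | i <- iota 0 (N + N)].

Lemma mem_zl N a : (a \in zl N) = (- N%:Z <= a < N%:Z).
Proof.
apply/mapP/idP => [[j jN ->]|h].
  by move: jN; rewrite mem_iota add0n /=; lia.
exists (absz (a + N%:Z)); last by lia.
by rewrite mem_iota; lia.
Qed.

Lemma zl_uniq N : uniq (zl N).
Proof. by rewrite map_inj_uniq ?iota_uniq// => i j /addIr[]. Qed.

Lemma size_zl N : size (zl N) = (N + N)%N.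
Proof. by rewrite size_map size_iota. Qed.

(** * Lattice step functions and the integral over three-space *)

Section StepFunctions.
Context {R : realType}.
Local Notation V := 'rV[R]_3.
Local Notation lebesgue3 := (@lebesgue3 R).
Local Notation RB := (measurableTypeR R).
Local Notation RB3 := (RB * RB * RB)%type.
Implicit Types (f : V -> R) (h A L : R) (N : nat).

Definition cell h (a : int) : set RB := `[h * a%:~R, h * (a + 1)%:~R[%classic.

Lemma cell_floor h a t : 0 < h -> (t \in cell h a) = (a == Num.floor (t / h)).
Proof.
move=> h0; rewrite eq_sym real_floor_eq ?num_real// ler_pdivlMr// ltr_pdivrMr//.
by rewrite ![_%:~R * h]mulrC /cell mem_setE in_itv.
Qed.

Lemma sum_cell h t N (phi : int -> R) : 0 < h ->
  \sum_(a <- zl N) phi a * \1_(cell h a) t =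
  if Num.floor (t / h) \in zl N then phi (Num.floor (t / h)) else 0.
Proof.
move=> h0; case: ifPn => fN.
  rewrite (bigD1_seq _ fN (zl_uniq N))/= big1 ?addr0.
    by rewrite indicE cell_floor// eqxx mulr1.
  by move=> a /negPf af; rewrite indicE cell_floor// af mulr0.
rewrite big1_seq// => a /andP[_ aN]; rewrite indicE cell_floor//.
by case: eqP fN => [<-|]; rewrite ?aN// mulr0.
Qed.

Definition pt h (a b c : int) : V := mk3 (h * a%:~R) (h * b%:~R) (h * c%:~R).

Definition box A : set (RB3) :=
  (`[- A, A]%classic `*` `[- A, A]%classic) `*` `[- A, A]%classic.

Definition lattice_sum h N f : R :=
  \sum_(a <- zl N) \sum_(b <- zl N) \sum_(c <- zl N) f (pt h a b c).

Definition fstep h N f (x : RB3) : R :=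
  \sum_(a <- zl N) \sum_(b <- zl N) \sum_(c <- zl N)
    f (pt h a b c) * \1_((cell h a `*` cell h b) `*` cell h c) x.

Lemma row3E (x : RB3) : row3 x = mk3 x.1.1 x.1.2 x.2.
Proof. by []. Qed.

Lemma fstepE h N f x : 0 < h -> fstep h N f x =
  if [&& Num.floor (x.1.1 / h) \in zl N, Num.floor (x.1.2 / h) \in zl N &
         Num.floor (x.2 / h) \in zl N]
  then f (pt h (Num.floor (x.1.1 / h)) (Num.floor (x.1.2 / h)) (Num.floor (x.2 / h)))
  else 0.
Proof.
move=> h0.
have E a b c : \1_((cell h a `*` cell h b) `*` cell h c) x =
    \1_(cell h a) x.1.1 * (\1_(cell h b) x.1.2 * \1_(cell h c) x.2) :> R.
  by rewrite !indicE !in_setX -!natrM !mulnb andbA.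
transitivity (\sum_(a <- zl N) (\sum_(b <- zl N) (\sum_(c <- zl N)
    f (pt h a b c) * \1_(cell h c) x.2) * \1_(cell h b) x.1.2) * \1_(cell h a) x.1.1).
  apply: eq_bigr => a _; rewrite mulr_suml; apply: eq_bigr => b _.
  rewrite !mulr_suml; apply: eq_bigr => c _; rewrite E; ring.
rewrite (@sum_cell h _ N (fun a => \sum_(b <- zl N) (\sum_(c <- zl N)
    f (pt h a b c) * \1_(cell h c) x.2) * \1_(cell h b) x.1.2))//.
case: ifP => //= _.
rewrite (@sum_cell h _ N (fun b => \sum_(c <- zl N)
    f (pt h _ b c) * \1_(cell h c) x.2))//.
case: ifP => //= _.
by rewrite (@sum_cell h _ N (fun c => f (pt h _ _ c))).
Qed.

Lemma floor_dist h t : 0 < h -> `|t - h * (Num.floor (t / h))%:~R| <= h.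
Proof.
move=> h0; have /andP[h1 h2] := real_floor_itv (num_real (t / h)).
move: h1 h2; rewrite ler_pdivlMr// ltr_pdivrMr// ![_%:~R * h]mulrC intrD mulrDr mulr1.
by move=> h1 h2; rewrite ger0_norm ?subr_ge0// lerBlDl ltW.
Qed.

Lemma floor_out h t A N : 0 < h -> A < h * N%:R -> Num.floor (t / h) \notin zl N -> A < `|t|.
Proof.
move=> h0 hN; rewrite mem_zl negb_and -!ltNge -leNgt => /orP[].
  rewrite real_floor_lt_int ?num_real// ltr_pdivrMr// => h1.
  apply: (lt_trans hN); rewrite -[X in _ < X]normrN; apply: lt_le_trans (ler_norm _).
  by move: h1; rewrite mulrNz mulNr mulrC ltrNr.
rewrite real_floor_ge_int ?num_real// ler_pdivlMr// => h1.
apply: (lt_le_trans hN); apply: le_trans (ler_norm _).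
by rewrite mulrC.
Qed.

Lemma fstep_dist h N f L A x : 0 < h -> A < h * N%:R ->
  (forall u v, `|f u - f v| <= L * `|u - v|) ->
  (forall u, f u != 0 -> `|u| <= A) ->
  0 <= L -> `|f (row3 x) - fstep h N f x| <= L * h.
Proof.
move=> h0 hN Lf sf L0; rewrite fstepE// row3E; case: ifPn => H.
  apply: le_trans (Lf _ _) _; rewrite ler_wpM2l//.
  apply: norm_le_coord; first exact: ltW.
  move=> j; rewrite !mxE.
  by case: j => -[|[|[|//]]] hj; rewrite !(tnth_nth 0)/=; exact: floor_dist.
suff -> : f (mk3 x.1.1 x.1.2 x.2) = 0 by rewrite subrr normr0 mulr_ge0// ltW.
apply/eqP; apply: contraTT H => /sf uA.
rewrite negbK; have out t : `|t| <= A -> Num.floor (t / h) \in zl N.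
  by apply: contraTT => /(floor_out h0 hN); rewrite -ltNge.
rewrite !out//; apply: le_trans uA.
- by have := coord_le_norm (mk3 x.1.1 x.1.2 x.2) 2; rewrite mxE (tnth_nth 0).
- by have := coord_le_norm (mk3 x.1.1 x.1.2 x.2) 1; rewrite mxE (tnth_nth 0).
- by have := coord_le_norm (mk3 x.1.1 x.1.2 x.2) 0; rewrite mxE (tnth_nth 0).
Qed.

Lemma measurable_cell h a : measurable (cell h a).
Proof. exact: measurable_itv. Qed.

Lemma measurable_box A : measurable (box A).
Proof. by apply: measurableX; [apply: measurableX|]; exact: measurable_itv. Qed.

Lemma lebesgue3_box A : 0 <= A -> (lebesgue3 (box A) = ((2 * A) ^+ 3)%:E)%E.
Proof.
move=> A0; have E : (@lebesgue_measure R `[(- A)%R, A]%classic = (2 * A)%:E)%E.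
  rewrite lebesgue_measure_itv/= lte_fin; case: ltP => h.
    by rewrite -EFinD; congr EFin; lra.
  by congr EFin; lra.
rewrite -[LHS]/((@lebesgue2 R \x @lebesgue_measure R)%E (box A)) /box.
rewrite product_measure1E//; last by apply: measurableX.
rewrite -[X in (X * _)%E]/((@lebesgue_measure R \x @lebesgue_measure R)%E _).
rewrite product_measure1E//.
transitivity ((2 * A)%:E * (2 * A)%:E * (2 * A)%:E)%E.
  by congr (_ * _ * _)%E; exact: E.
rewrite -!EFinM.
by congr EFin; rewrite !exprS expr0 mulr1 mulrA.
Qed.

Lemma lebesgue3_cell h a b c : 0 < h ->
  (lebesgue3 ((cell h a `*` cell h b) `*` cell h c) = (h ^+ 3)%:E)%E.
Proof.
move=> h0; have E n : (@lebesgue_measure R (cell h n) = h%:E)%E.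
  rewrite lebesgue_measure_itv/= lte_fin ltr_pM2l// ltr_int.
  rewrite ltrDl ltr01 -EFinD; congr EFin; rewrite intrD; ring.
have mc n := measurable_cell h n.
rewrite -[LHS]/((@lebesgue2 R \x @lebesgue_measure R)%E ((cell h a `*` cell h b) `*` cell h c)).
rewrite product_measure1E; [|exact: (measurableX (mc a) (mc b))|exact: mc].
rewrite -[X in (X * _)%E]/((@lebesgue_measure R \x @lebesgue_measure R)%E _).
rewrite product_measure1E; [|exact: mc|exact: mc].
transitivity (h%:E * h%:E * h%:E)%E.
  by congr (_ * _ * _)%E; exact: E.
rewrite -!EFinM.
by congr EFin; rewrite !exprS expr0 mulr1 mulrA.
Qed.

Lemma lebesgue3_box_fin A : 0 <= A -> (lebesgue3 (box A) < +oo)%E.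
Proof. by move=> A0; rewrite lebesgue3_box// ltry. Qed.

Definition I3 f : R := \int[lebesgue3]_x f (row3 x).

Lemma cell_box h N a b c x : 0 < h -> a \in zl N -> b \in zl N -> c \in zl N ->
  ((cell h a `*` cell h b) `*` cell h c) x -> box (h * N%:R) x.
Proof.
move=> h0 aN bN cN.
have C n t : n \in zl N -> cell h n t -> `[- (h * N%:R), h * N%:R]%classic t.
  rewrite mem_zl => /andP[n1 n2]; rewrite /cell /= !in_itv/= => /andP[t1 t2].
  apply/andP; split.
    apply: le_trans t1; rewrite -mulrN ler_pM2l//.
    by rewrite (_ : - N%:R = (- N%:Z)%:~R) ?ler_int// mulrNz.
  apply: ltW (lt_le_trans t2 _); rewrite ler_pM2l// (_ : N%:R = N%:Z%:~R)// ler_int; lia.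
by move=> [[/= xa xb] xc]; split; [split; [exact: C aN xa|exact: C bN xb]|exact: C cN xc].
Qed.

Lemma adm_le_set d (T : measurableType d) (E E' : set T) M (g : T -> R) :
  E `<=` E' -> adm E M g -> adm E' M g.
Proof. by move=> EE [mg gM gE]; split=> // x nE; apply: gE => /EE. Qed.

Lemma adm3_integralZ A M g (a : R) : 0 <= A -> adm (box A) M g ->
  \int[lebesgue3]_x (a * g x) = a * \int[lebesgue3]_x g x.
Proof.
move=> A0; apply: adm_integralZ; first exact: measurable_box.
exact: lebesgue3_box_fin.
Qed.

Lemma adm3_integralD A M M' g g' : 0 <= A -> adm (box A) M g -> adm (box A) M' g' ->
  \int[lebesgue3]_x (g x + g' x) = \int[lebesgue3]_x g x + \int[lebesgue3]_x g' x.
Proof.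
move=> A0; apply: adm_integralD; first exact: measurable_box.
exact: lebesgue3_box_fin.
Qed.

Lemma adm3_integralB A M M' g g' : 0 <= A -> adm (box A) M g -> adm (box A) M' g' ->
  \int[lebesgue3]_x (g x - g' x) = \int[lebesgue3]_x g x - \int[lebesgue3]_x g' x.
Proof.
move=> A0; apply: adm_integralB; first exact: measurable_box.
exact: lebesgue3_box_fin.
Qed.

Lemma adm3_sum A (I : Type) (r : seq I) (F : I -> RB3 -> R) (M : I -> R) :
  0 <= A -> (forall i, adm (box A) (M i) (F i)) ->
  adm (box A) (\sum_(i <- r) M i) (fun x => \sum_(i <- r) F i x) /\
  \int[lebesgue3]_x (\sum_(i <- r) F i x) = \sum_(i <- r) \int[lebesgue3]_x F i x.
Proof.
move=> A0; apply: adm_sum; first exact: measurable_box.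
exact: lebesgue3_box_fin.
Qed.

Lemma adm3_bound A M g : 0 <= A -> adm (box A) M g ->
  `|\int[lebesgue3]_x g x| <= M * (2 * A) ^+ 3.
Proof.
move=> A0 ag; have -> : (2 * A) ^+ 3 = fine (lebesgue3 (box A)) by rewrite lebesgue3_box.
by apply: adm_integral_bound ag; [exact: measurable_box|exact: lebesgue3_box_fin].
Qed.

Lemma adm3_cvg A M (f_ : nat -> RB3 -> R) g : 0 <= A ->
  (forall n, adm (box A) M (f_ n)) -> (forall x, f_ n x @[n --> \oo] --> g x) ->
  adm (box A) M g /\ \int[lebesgue3]_x f_ n x @[n --> \oo] --> \int[lebesgue3]_x g x.
Proof.
move=> A0; apply: adm_cvg; first exact: measurable_box.
exact: lebesgue3_box_fin.
Qed.

Lemma fstep_adm h N f M : 0 < h -> (forall u, `|f u| <= M) ->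
  adm (box (h * N%:R)) M (fstep h N f) /\
  \int[lebesgue3]_x fstep h N f x = h ^+ 3 * lattice_sum h N f.
Proof.
move=> h0 fM.
have M0 : 0 <= M by exact: le_trans (normr_ge0 _) (fM 0).
have B0 : 0 <= h * N%:R by rewrite mulr_ge0// ltW.
have fin := lebesgue3_box_fin B0.
have mB := measurable_box (h * N%:R).
have mC a b c : measurable ((cell h a `*` cell h b) `*` cell h c).
  by apply: measurableX; [apply: measurableX|]; exact: measurable_cell.
pose F a b c (x : RB3) := if [&& a \in zl N, b \in zl N & c \in zl N] then
  f (pt h a b c) * \1_((cell h a `*` cell h b) `*` cell h c) x else 0.
have aF a b c : adm (box (h * N%:R)) M (F a b c).
  rewrite /F; case: [&& _, _ & _] / and3P => [[aN bN cN]|_]; last first.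
    by apply: (adm_le M0); exact: adm0.
  split.
  - by apply: measurable_funM => //; exact/measurable_indicP.
  - move=> x; rewrite indicE; case: (_ \in _); rewrite ?mulr1 ?fM// mulr0 normr0//.
  - move=> x nB; rewrite indicE memNset ?mulr0// => /(cell_box h0 aN bN cN).
    exact: nB.
have iF a b c : [&& a \in zl N, b \in zl N & c \in zl N] ->
    \int[lebesgue3]_x F a b c x = h ^+ 3 * f (pt h a b c).
  move=> H; have [aN bN cN] := and3P H; rewrite /F H.
  have ind : adm (box (h * N%:R)) 1 (fun x => \1_((cell h a `*` cell h b) `*` cell h c) x : R).
    split; first exact/measurable_indicP.
      by move=> x; rewrite indicE; case: (_ \in _); rewrite ?normr1 ?normr0.
    by move=> x nB; rewrite indicE memNset// => /(cell_box h0 aN bN cN).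
  rewrite (adm3_integralZ _ B0 ind) mulrC; congr (_ * _).
  have -> : \int[lebesgue3]_x (\1_((cell h a `*` cell h b) `*` cell h c) x : R) =
      fine (lebesgue3 ((cell h a `*` cell h b) `*` cell h c)).
    by rewrite /Rintegral integral_indic// setIT.
  by rewrite lebesgue3_cell.
have S1 a b := adm3_sum (zl N) B0 (aF a b).
have S2 a := adm3_sum (zl N) B0 (fun b => (S1 a b).1).
have S3 := adm3_sum (zl N) B0 (fun a => (S2 a).1).
have FE : fstep h N f = (fun x => \sum_(a <- zl N) \sum_(b <- zl N) \sum_(c <- zl N) F a b c x).
  apply/funext => x; rewrite /fstep; apply: eq_big_seq => a aN; apply: eq_big_seq => b bN.
  by apply: eq_big_seq => c cN; rewrite /F aN bN cN.
split.
  have [[m1 _ m3] _] := S3; split; [by rewrite FE| |by rewrite FE].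
  by move=> x; rewrite fstepE//; case: ifP => _; rewrite ?fM// normr0.
rewrite FE S3.2 /lattice_sum mulr_sumr; apply: eq_big_seq => a aN.
rewrite (S2 a).2 mulr_sumr; apply: eq_big_seq => b bN.
rewrite (S1 a b).2 mulr_sumr; apply: eq_big_seq => c cN.
by rewrite iF// aN bN cN.
Qed.

Definition steps h A : nat := (Num.truncn (A / h)).+1.

Lemma steps_gt h A : 0 < h -> 0 <= A -> A < h * (steps h A)%:R.
Proof.
by move=> h0 A0; rewrite mulrC -ltr_pdivrMr// truncnS_gt.
Qed.

Lemma steps_le h A : 0 < h -> 0 <= A -> h * (steps h A)%:R <= A + h.
Proof.
move=> h0 A0; rewrite /steps -natr1 mulrDr mulr1 lerD2r mulrC -ler_pdivlMr//.
by rewrite truncn_le// divr_ge0// ltW.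
Qed.

(** Measurability for the product sigma-algebra of R x R x R is inherited from the step functions on
    cells, which converge pointwise. *)
Lemma lipschitz_adm f L A M : 0 <= A -> 0 <= L ->
  (forall u v, `|f u - f v| <= L * `|u - v|) ->
  (forall u, f u != 0 -> `|u| <= A) -> (forall u, `|f u| <= M) ->
  adm (box A) M (fun x => f (row3 x)).
Proof.
move=> A0 L0 Lf sf fM.
have lt0 n : 0 < n.+1%:R^-1 :> R by rewrite invr_gt0.
have cv x : fstep n.+1%:R^-1 (steps n.+1%:R^-1 A) f x @[n --> \oo] --> f (row3 x).
  apply/cvgrPdist_le => eps eps0.
  have : (L * n.+1%:R^-1 : R) @[n --> \oo] --> L * 0.
    by apply: cvgMr; exact: cvg_harmonic.
  rewrite mulr0 => /cvgrPdist_le /(_ _ eps0); apply: filterS => n.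
  rewrite sub0r normrN ger0_norm ?mulr_ge0 ?invr_ge0// => h.
  apply: le_trans h; apply: (fstep_dist _ _ _ Lf sf L0) => //.
  exact: steps_gt.
split.
- apply: (measurable_fun_cvg (h := fun n => fstep n.+1%:R^-1 (steps n.+1%:R^-1 A) f)) => //.
  by move=> n; have [[]] := fstep_adm (steps n.+1%:R^-1 A) (lt0 n) fM.
- by move=> x; exact: fM.
- move=> x nB; apply/eqP; apply: contra_notT nB => /sf fA.
  have C j t : row3 x 0 j = t -> `[- A, A]%classic t.
    move=> <-; rewrite /= in_itv/= -ler_norml; exact: le_trans (coord_le_norm _ _) fA.
  split; [split|].
  + by apply: (C 0); rewrite mxE (tnth_nth 0).
  + by apply: (C 1); rewrite mxE (tnth_nth 0).
  + by apply: (C 2); rewrite mxE (tnth_nth 0).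
Qed.

Lemma I3_lattice f L A M h N : 0 <= A -> 0 <= L -> 0 < h -> h <= 1 ->
  A < h * N%:R -> h * N%:R <= A + 2 ->
  (forall u v, `|f u - f v| <= L * `|u - v|) ->
  (forall u, f u != 0 -> `|u| <= A) -> (forall u, `|f u| <= M) ->
  `|I3 f - h ^+ 3 * lattice_sum h N f| <= L * h * (2 * (A + 2)) ^+ 3.
Proof.
move=> A0 L0 h0 h1 hN hN2 Lf sf fM.
have A2 : 0 <= A + 2 by rewrite addr_ge0.
have mB := measurable_box (A + 2); have fin := lebesgue3_box_fin A2.
have sub A' : A' <= A + 2 -> box A' `<=` box (A + 2).
  move=> AA x; have C t : `[- A', A']%classic t -> `[- (A + 2), A + 2]%classic t.
    by rewrite /= !in_itv/= -!ler_norml => /le_trans; apply.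
  by move=> [[/C a /C b] /C c].
have af : adm (box (A + 2)) M (fun x => f (row3 x)).
  apply: adm_le_set (lipschitz_adm A0 L0 Lf sf fM); apply: sub; lra.
have [as_ is_] := fstep_adm N h0 fM.
have as' := adm_le_set (sub _ hN2) as_.
rewrite -is_ /I3 -(adm3_integralB A2 af as').
have ad : adm (box (A + 2)) (L * h) (fun x => f (row3 x) - fstep h N f x).
  have [m1 _ o1] := af; have [m2 _ o2] := as'; split.
  - exact: measurable_funB.
  - by move=> x; exact: fstep_dist sf L0.
  - by move=> x nB; rewrite o1// o2// subrr.
exact: adm3_bound ad.
Qed.

End StepFunctions.

(** * One-dimensional Riemann sums with errors of high order *)

Section LatticeSums1D.
Context {R : realType}.
Implicit Types (phi psi : R -> R) (h c t A M : R).

(** From here on one-variable integrals appear as differences of an antiderivative. *)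
Lemma antiderivative phi A M : continuous phi -> (forall t, `|phi t| <= M) ->
  (forall t, phi t != 0 -> `|t| <= A) ->
  exists psi, forall t : R, is_derive t 1 psi (phi t).
Proof.
move=> cphi bphi sphi.
pose mu := @lebesgue_measure R.
have fin : (mu `[(- A)%R, A]%classic < +oo)%E.
  rewrite /mu lebesgue_measure_itv/=; case: ifP => _; last exact: ltry.
  by rewrite -EFinD ltry.
have mE : measurable (`[(- A)%R, A]%classic : set (measurableTypeR R)) by exact: measurable_itv.
have ad : adm (`[(- A)%R, A]%classic : set (measurableTypeR R)) M phi.
  split=> //; first exact: continuous_measurable_fun.
  move=> t nE; apply/eqP; apply: contra_notT nE => /sphi.
  by rewrite /= in_itv/= -ler_norml.
have int := adm_integrable mE fin ad.
have FTC (x : R) : exists2 u : R, x < u & mu.-integrable [set` `]-oo, u]] (EFin \o phi).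
  by exists (x + 1); [rewrite ltrDl|exact: integrableS int].
have psiP (x : R) := let: ex_intro2 u xu iu := FTC x in
  @continuous_FTC1 R phi -oo%O x u xu iu (ltNyr x) (cphi x).
eexists => x; have [d E] := psiP x; apply: DeriveDef; first exact: d.
by rewrite -derive1E; exact: E.
Qed.

Fixpoint bd1 (m : nat) M A phi : Prop :=
  (forall t, phi t != 0 -> `|t| <= A) /\
  match m with
  | 0%N => forall t, `|phi t| <= M
  | m'.+1 => exists phi', (forall t : R, is_derive t 1 phi (phi' t)) /\ bd1 m' M A phi'
  end.

Lemma is_derive_sum_seq (I : Type) (r : seq I) (F dF : I -> R -> R) (t : R) :
  (forall i, is_derive t 1 (F i) (dF i t)) ->
  is_derive t 1 (fun s => \sum_(i <- r) F i s) (\sum_(i <- r) dF i t).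
Proof.
move=> H; elim: r => [|i r IH].
  rewrite big_nil (_ : (fun s => _) = fun=> 0); first exact: is_derive_cst_fun.
  by apply/funext => s; rewrite big_nil.
rewrite big_cons (_ : (fun s => _) = fun s => F i s + \sum_(j <- r) F j s).
  exact: is_deriveD_fun.
by apply/funext => s; rewrite big_cons.
Qed.

Lemma is_derive_shift_arg phi (dphi a s : R) : is_derive (a + s) 1 phi dphi ->
  is_derive s 1 (fun x : R => phi (a + x)) dphi.
Proof.
move=> H; have := is_derive_lineP phi a 1 s dphi.
rewrite [s *: 1]mulr1 => -[/(_ H) + _].
by rewrite (_ : (fun x : R => phi (a + x *: 1)) = (fun x : R => phi (a + x)))//;
  apply/funext => x; rewrite [x *: 1]mulr1.
Qed.

Lemma zl_telescope psi h N :
  \sum_(a <- zl N) (psi (h * a%:~R + h) - psi (h * a%:~R)) =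
  psi (h * N%:R) - psi (- (h * N%:R)).
Proof.
rewrite /zl big_map.
rewrite (eq_bigr (fun i => psi (h * ((i.+1)%:R - N%:R)) - psi (h * (i%:R - N%:R)))); last first.
  move=> i _; rewrite !intrD !mulrNz -!pmulrn -natr1; congr (psi _ - psi _); ring.
have -> : iota 0 (N + N) = index_iota 0 (N + N) by rewrite /index_iota subn0.
rewrite (telescope_sumr (fun i => psi (h * (i%:R - N%:R))))//.
by rewrite natrD addrK sub0r mulrN.
Qed.

Lemma bd1_ge0 m M A phi : bd1 m M A phi -> 0 <= M.
Proof.
elim: m phi => [|m IH] phi [_ h]; first exact: le_trans (normr_ge0 _) (h 0).
by have [phi' [_ /IH]] := h.
Qed.

(** A substitute for Euler-Maclaurin. By the mean value theorem the integral equals the lattice sum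
    with some common offset s. Passing from s to c costs at most h times a lattice sum of phi', and
    the integral of phi' is phi(T) - phi(-T) = 0. So the induction applies to phi', and each
    derivative gains a factor h. *)
Lemma lattice_sum1 m M A phi psi h c N :
  (forall t : R, is_derive t 1 psi (phi t)) -> bd1 m M A phi ->
  0 <= A -> 0 < h -> A < h * N%:R -> 0 <= c <= h ->
  `|h * (\sum_(a <- zl N) phi (c + h * a%:~R)) - (psi (h * N%:R) - psi (- (h * N%:R)))|
  <= h ^+ m * (4 * (h * N%:R) * M).
Proof.
move=> + + A0 h0 hN; set T := h * N%:R in hN *.
have T0 : 0 < T by exact: le_lt_trans hN.
elim: m phi psi c => [|m IH] phi psi c Dpsi [sphi hphi] hc.
  have M0 : 0 <= M by exact: le_trans (normr_ge0 _) (hphi 0).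
  have TT : - T < T by rewrite gtrN.
  have [s _ ->] := MVT_real TT Dpsi.
  rewrite expr0 mul1r; apply: le_trans (ler_normB _ _) _.
  have -> : 4 * T * M = 2 * T * M + M * (2 * T) by ring.
  apply: lerD; last first.
    rewrite normrM (_ : T - - T = 2 * T); last by ring.
    have T2 : 0 <= 2 * T by rewrite mulr_ge0// ltW.
    by rewrite [`|2 * T|]ger0_norm// ler_wpM2r.
  rewrite normrM gtr0_norm//; apply: (@le_trans _ _ (h * \sum_(a <- zl N) M)).
    rewrite ler_pM2l//; apply: le_trans (ler_norm_sum _ _ _) _.
    by apply: ler_sum => a _; exact: hphi.
  rewrite big_const_seq count_predT size_zl iter_addr addr0 mulrnDr -[M *+ N]mulr_natr /T.
  by rewrite le_eqVlt; apply/orP; left; apply/eqP; ring.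
have [phi' [Dphi hphi']] := hphi.
(* The total increment of [psi] over cells of length s; at s = h it telescopes to the integral. *)
pose Rs (s : R) := \sum_(a <- zl N) (psi (h * a%:~R + s) - psi (h * a%:~R)).
have DR (s : R) : is_derive s 1 Rs (\sum_(a <- zl N) (phi (h * a%:~R + s) - 0)).
  apply: (@is_derive_sum_seq _ (zl N) (fun a s => psi (h * a%:~R + s) - psi (h * a%:~R))
    (fun a s => phi (h * a%:~R + s) - 0)) => a.
  apply: is_deriveB; exact: is_derive_shift_arg.
have [s /andP[s0 sh] Es] := MVT_real h0 DR.
have R0 : Rs 0 = 0 by rewrite /Rs big1// => a _; rewrite addr0 subrr.
have RI : psi T - psi (- T) = h * \sum_(a <- zl N) phi (s + h * a%:~R).
  have E := Es; rewrite R0 !subr0 in E.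
  rewrite -zl_telescope -/(Rs h) E [LHS]mulrC; congr (_ * _).
  by apply: eq_bigr => a _; rewrite subr0 addrC.
rewrite RI -mulrBr normrM gtr0_norm//.
have phiT : phi T - phi (- T) = 0.
  have z t : T <= `|t| -> phi t = 0.
    move=> Tt; apply/eqP; apply: contraTT Tt => /sphi tA.
    by rewrite -ltNge; exact: le_lt_trans hN.
  by rewrite !z ?subrr// ?normrN gtr0_norm.
pose P (x : R) := \sum_(a <- zl N) phi (x + h * a%:~R).
have DP (x : R) : is_derive x 1 P (\sum_(a <- zl N) phi' (x + h * a%:~R)).
  apply: (@is_derive_sum_seq _ (zl N) (fun a y => phi (y + h * a%:~R))
    (fun a y => phi' (y + h * a%:~R))) => a.
  rewrite [x + _]addrC (_ : (fun _ => _) = fun y => phi (h * a%:~R + y)).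
    exact: is_derive_shift_arg.
  by apply/funext => y; rewrite addrC.
have PP (x y : R) : 0 <= x -> x < y -> y <= h -> `|P y - P x| <= h ^+ m * (4 * T * M).
  move=> x0 xy yh; have [z /andP[z0 z1] ->] := MVT_real xy DP.
  have zh : 0 <= z <= h by apply/andP; split; lra.
  have := IH phi' phi z Dphi hphi' zh; rewrite phiT subr0 => h1.
  rewrite mulrC; apply: le_trans h1; rewrite !normrM ler_wpM2r//.
  by rewrite !ger0_norm; lra.
rewrite exprS -mulrA ler_pM2l//.
have /andP[c0 ch] := hc.
have Es' : (P c - P s) = \sum_(a <- zl N) phi (c + h * a%:~R) -
    \sum_(a <- zl N) phi (s + h * a%:~R) by [].
rewrite -Es'; case: (ltgtP c s) => cs.
- by rewrite distrC; apply: PP => //; exact: ltW.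
- by apply: PP => //; exact: ltW.
- rewrite cs subrr normr0 !mulr_ge0 ?exprn_ge0 ?(ltW h0) ?(ltW T0)//.
  exact: bd1_ge0 hphi'.
Qed.

End LatticeSums1D.

(** * Riemann sums in three variables *)

Section LatticeSums3D.
Context {R : realType}.
Local Notation V := 'rV[R]_3.
Implicit Types (f : V -> R) (u v p : V) (i : 'I_3) (h c t A M : R).

Variable B : R.
Hypothesis B1 : 1 <= B.

Let B0 : 0 < B := B_gt0 B1.

Lemma mk3_line (x y z : R) :
  [/\ mk3 x y z = mk3 0 y z + x *: di 0, mk3 x y z = mk3 x 0 z + y *: di 1 &
      mk3 x y z = mk3 x y 0 + z *: di 2].
Proof.
split; apply/rowP => -[[|[|[|//]]] hj]; rewrite !mxE !(tnth_nth 0)/= ?mulr1 ?mulr0 ?add0r ?addr0//.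
Qed.

Lemma slice_bd1 lam m N f p i : 0 <= lam -> CC B lam m N f -> p 0 i = 0 ->
  bd1 m (lam ^+ m * N) B (fun t => f (p + t *: di i)).
Proof.
move=> l0 + p0.
have sp g t : (forall u, g u != 0 -> annulus B u) -> g (p + t *: di i) != 0 -> `|t| <= B.
  move=> sg /sg /andP[_]; apply: le_trans.
  have := coord_le_norm (p + t *: di i) i.
  by rewrite mxE p0 add0r mxE /di mxE !eqxx/= mulr1.
elim: m N f => [|m IH] N f hf; split.
- by move=> t; apply: sp; case: hf.
- by move=> t; rewrite expr0 mul1r; exact: CC_bound hf.
- by move=> t; apply: sp; case: hf.
have [D hD] := CC_derive B1 i hf.
exists (fun t => 'D_(di i) f (p + t *: di i)); split.
  by move=> t; exact: (is_derive_lineP f p (di i) t _).1 (D _).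
by rewrite exprSr -mulrA; exact: (IH _ _ hD).
Qed.

Lemma CC_lipschitz lam k N f : 0 <= lam -> CC B lam k.+1 N f ->
  forall u v, `|f u - f v| <= 3 * (lam * N) * `|u - v|.
Proof.
move=> l0 hf.
have N0 := CC_ge0 B1 hf.
have step u i t : `|f (u + t *: di i) - f u| <= lam * N * `|t|.
  have [D hD] := CC_derive B1 i hf.
  pose phi (s : R) := f (u + s *: di i).
  have Dphi (s : R) : is_derive s 1 phi ('D_(di i) f (u + s *: di i)).
    exact: (is_derive_lineP f u (di i) s _).1 (D _).
  have P (a b : R) : a < b -> `|phi b - phi a| <= lam * N * `|b - a|.
    move=> ab; have [s _ ->] := MVT_real ab Dphi.
    by rewrite normrM ler_wpM2r//; exact: CC_bound hD.
  have -> : f u = phi 0 by rewrite /phi scale0r addr0.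
  rewrite -/(phi t); case: (ltgtP 0 t) => t0.
  - by have := P 0 t t0; rewrite subr0.
  - by rewrite distrC; have := P t 0 t0; rewrite sub0r normrN.
  - by rewrite t0 subrr normr0 mulr_ge0// mulr_ge0.
have line (p q : V) i t s : p = q + t *: di i -> forall p', p' = q + s *: di i ->
    p = p' + (t - s) *: di i.
  by move=> -> p' ->; rewrite -addrA -scalerDl [s + _]addrC subrK.
move=> u v; rewrite [u]mk3_eta [v]mk3_eta.
set a := u 0 0; set b := u 0 1; set c := u 0 2.
set a' := v 0 0; set b' := v 0 1; set c' := v 0 2.
set W := `|_ - _ : V|.
have W0 : `|a - a'| <= W.
  by have := coord_le_norm (mk3 a b c - mk3 a' b' c') 0; rewrite !mxE !(tnth_nth 0).
have W1 : `|b - b'| <= W.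
  by have := coord_le_norm (mk3 a b c - mk3 a' b' c') 1; rewrite !mxE !(tnth_nth 0).
have W2 : `|c - c'| <= W.
  by have := coord_le_norm (mk3 a b c - mk3 a' b' c') 2; rewrite !mxE !(tnth_nth 0).
have K0 : 0 <= lam * N by rewrite mulr_ge0.
have s0 : `|f (mk3 a b c) - f (mk3 a' b c)| <= lam * N * W.
  have [L1 _ _] := mk3_line a b c; have [L1' _ _] := mk3_line a' b c.
  rewrite (line _ _ _ _ _ L1 _ L1'); apply: le_trans (step _ _ _) _.
  exact: ler_wpM2l.
have s1 : `|f (mk3 a' b c) - f (mk3 a' b' c)| <= lam * N * W.
  have [_ L1 _] := mk3_line a' b c; have [_ L1' _] := mk3_line a' b' c.
  rewrite (line _ _ _ _ _ L1 _ L1'); apply: le_trans (step _ _ _) _.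
  exact: ler_wpM2l.
have s2 : `|f (mk3 a' b' c) - f (mk3 a' b' c')| <= lam * N * W.
  have [_ _ L1] := mk3_line a' b' c; have [_ _ L1'] := mk3_line a' b' c'.
  rewrite (line _ _ _ _ _ L1 _ L1'); apply: le_trans (step _ _ _) _.
  exact: ler_wpM2l.
apply: le_trans (ler_distD (f (mk3 a' b c)) _ _) _.
apply: le_trans (lerD s0 (ler_distD (f (mk3 a' b' c)) _ _)) _.
apply: le_trans (lerD (lexx _) (lerD s1 s2)) _.
by rewrite le_eqVlt; apply/orP; left; apply/eqP; ring.
Qed.

Definition S1 h (n : nat) c (phi : R -> R) : R := h * \sum_(a <- zl n) phi (c + h * a%:~R).

Lemma S1_bound h (n : nat) c phi M : 0 <= h -> (forall t, `|phi t| <= M) ->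
  `|S1 h n c phi| <= 2 * (h * n%:R) * M.
Proof.
move=> h0 H; rewrite /S1 normrM ger0_norm//.
apply: (@le_trans _ _ (h * \sum_(a <- zl n) M)).
  rewrite ler_wpM2l//; apply: le_trans (ler_norm_sum _ _ _) _.
  by apply: ler_sum => a _; exact: H.
rewrite big_const_seq count_predT size_zl iter_addr addr0 mulrnDr -[M *+ n]mulr_natr.
by rewrite le_eqVlt; apply/orP; left; apply/eqP; ring.
Qed.

Lemma S1B h (n : nat) c phi psi :
  S1 h n c phi - S1 h n c psi = S1 h n c (fun t => phi t - psi t).
Proof. by rewrite /S1 -mulrBr -sumrB. Qed.

(** Finite sums commute, so each coordinate can be made the innermost one in turn; no iterated
    integral is needed. *)
Lemma S1_comm h (n : nat) c h' (n' : nat) c' (F : R -> R -> R) :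
  S1 h n c (fun s => S1 h' n' c' (F s)) = S1 h' n' c' (fun r => S1 h n c (F ^~ r)).
Proof.
rewrite /S1 !mulr_sumr.
transitivity (\sum_(a <- zl n) \sum_(b <- zl n') h * (h' * F (c + h * a%:~R) (c' + h' * b%:~R))).
  by apply: eq_bigr => a _; rewrite !mulr_sumr.
rewrite exchange_big; apply: eq_bigr => b _; rewrite !mulr_sumr.
by apply: eq_bigr => a _; ring.
Qed.

Definition S3 h (n : nat) (x y z : R) f : R :=
  S1 h n x (fun t => S1 h n y (fun s => S1 h n z (fun r => f (mk3 t s r)))).

Lemma S3E h (n : nat) f : S3 h n 0 0 0 f = h ^+ 3 * lattice_sum h n f.
Proof.
rewrite /S3 /S1 /lattice_sum (_ : h ^+ 3 = h * (h * h)); last by ring.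
rewrite -[RHS]mulrA; congr (h * _); rewrite mulr_sumr; apply: eq_bigr => a _.
rewrite -[RHS]mulrA; congr (h * _); rewrite mulr_sumr; apply: eq_bigr => b _.
by congr (h * _); apply: eq_bigr => c _; rewrite /pt !add0r.
Qed.

Lemma antiderivative_total (phi psi : R -> R) A s t : (forall r : R, is_derive r 1 psi (phi r)) ->
  (forall r, phi r != 0 -> `|r| <= A) -> A < s -> A < t ->
  psi s - psi (- s) = psi t - psi (- t).
Proof.
move=> Dpsi sphi.
have const (a b : R) : a < b -> (A <= a) || (b <= - A) -> psi b = psi a.
  move=> ab AA; have [r /andP[r1 r2] E] := MVT_real ab Dpsi.
  apply/eqP; rewrite -subr_eq0 E.
  suff -> : phi r = 0 by rewrite mul0r.
  apply/eqP; apply: contraTT AA => /sphi; rewrite ler_norml => /andP[q1 q2].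
  by rewrite negb_or -!ltNge; apply/andP; split; lra.
move=> s1 t1; have -> : psi s = psi t.
  case: (ltgtP s t) => [st|st|->//].
    by rewrite (const _ _ st)// (ltW s1).
  by rewrite -(const _ _ st)// (ltW t1).
congr (_ - _); case: (ltgtP s t) => [st|st|->//].
  by rewrite (const (- t) (- s)) ?ltrN2// lerN2 (ltW s1) orbT.
by rewrite (const (- s) (- t)) ?ltrN2// lerN2 (ltW t1) orbT.
Qed.

Lemma line_compare m M phi h (n : nat) c h' (n' : nat) c' :
  continuous phi -> (forall t, `|phi t| <= M) -> forall M', bd1 m M' B phi ->
  0 < h -> B < h * n%:R -> h * n%:R <= B + 2 -> 0 <= c <= h ->
  0 < h' -> B < h' * n'%:R -> h' * n'%:R <= B + 2 -> 0 <= c' <= h' ->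
  `|S1 h n c phi - S1 h' n' c' phi| <= (h ^+ m + h' ^+ m) * (4 * (B + 2) * M').
Proof.
move=> cphi bphi M' hphi h0 hn hn2 hc h0' hn' hn2' hc'.
have sphi : forall t, phi t != 0 -> `|t| <= B by case: (m) hphi => [|k] [].
have [psi Dpsi] := antiderivative cphi bphi sphi.
have M0 := bd1_ge0 hphi.
have b1 := lattice_sum1 Dpsi hphi (ltW B0) h0 hn hc.
have b2 := lattice_sum1 Dpsi hphi (ltW B0) h0' hn' hc'.
have E := antiderivative_total Dpsi sphi hn hn'.
rewrite -/(S1 h n c phi) E in b1; rewrite -/(S1 h' n' c' phi) in b2.
set I := psi _ - psi _ in b1 b2.
apply: le_trans (ler_distD I _ _) _; rewrite mulrDl; apply: lerD.
  apply: le_trans b1 _; rewrite ler_wpM2l ?exprn_ge0 ?(ltW h0)// ler_wpM2r//.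
  by rewrite ler_pM2l.
rewrite distrC; apply: le_trans b2 _.
rewrite ler_wpM2l ?exprn_ge0 ?(ltW h0')// ler_wpM2r//.
by rewrite ler_pM2l.
Qed.

Lemma S1_bound2 h (n : nat) x h' (n' : nat) y (g : R -> R -> R) E :
  0 <= h -> 0 <= h' -> h * n%:R <= B + 2 -> h' * n'%:R <= B + 2 ->
  (forall t s, `|g t s| <= E) ->
  `|S1 h n x (fun t => S1 h' n' y (g t))| <= (2 * (B + 2)) * ((2 * (B + 2)) * E).
Proof.
move=> h0 h0' hn hn' gE; have E0 : 0 <= E by exact: le_trans (gE 0 0).
have step k (m : nat) c phi M : 0 <= k -> k * m%:R <= B + 2 -> 0 <= M ->
    (forall t, `|phi t| <= M) -> `|S1 k m c phi| <= 2 * (B + 2) * M.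
  move=> k0 km M0 H; apply: le_trans (S1_bound _ _ k0 H) _.
  by rewrite ler_wpM2r// ler_pM2l.
have B2 : 0 <= B + 2 by rewrite addr_ge0// ltW.
apply: (step) => //; first by rewrite !mulr_ge0.
by move=> t; exact: step.
Qed.

Lemma slice_cont lam k N f p i : CC B lam k.+1 N f -> continuous (fun t : R => f (p + t *: di i)).
Proof.
move=> hf t; have [D _] := CC_derive B1 i hf.
have [d _] := (is_derive_lineP f p (di i) t _).1 (D _).
by apply: differentiable_continuous; exact/derivable1_diffP.
Qed.

(** The mesh is changed one coordinate at a time; on each line the integral of the slice cancels
    between the two meshes. The constant is 48 = 3 * 2 * 2 * 4, from three coordinates, two outer
    sums and the one-dimensional bound. *)
Lemma lattice_compare lam m N f h (n : nat) x y z h' (n' : nat) :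
  0 <= lam -> CC B lam m.+1 N f ->
  0 < h -> B < h * n%:R -> h * n%:R <= B + 2 ->
  0 <= x <= h -> 0 <= y <= h -> 0 <= z <= h ->
  0 < h' -> B < h' * n'%:R -> h' * n'%:R <= B + 2 ->
  `|S3 h n x y z f - S3 h' n' 0 0 0 f| <=
  48 * (B + 2) ^+ 3 * (lam ^+ m.+1 * N) * (h ^+ m.+1 + h' ^+ m.+1).
Proof.
move=> l0 hf h0 hn hn2 hx hy hz h0' hn' hn2'.
set E := (h ^+ m.+1 + h' ^+ m.+1) * (4 * (B + 2) * (lam ^+ m.+1 * N)).
have c0 : 0 <= (0 : R) <= h' by rewrite lexx ltW.
have cmp p i c : p 0 i = 0 -> 0 <= c <= h ->
    `|S1 h n c (fun t => f (p + t *: di i)) - S1 h' n' 0 (fun t => f (p + t *: di i))| <= E.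
  move=> p0 hc; apply: (@line_compare _ N) => //.
  - exact: slice_cont hf.
  - by move=> t; exact: CC_bound hf.
  - exact: slice_bd1 hf p0.
have c3 t s : `|S1 h n z (fun r => f (mk3 t s r)) - S1 h' n' 0 (fun r => f (mk3 t s r))| <= E.
  have := cmp (mk3 t s 0) 2 z; rewrite mxE (tnth_nth 0)/= => /(_ erefl hz).
  congr (`|S1 _ _ _ _ - S1 _ _ _ _| <= _); apply/funext => r;
    by have [_ _ ->] := mk3_line t s r.
have c2 t r : `|S1 h n y (fun s => f (mk3 t s r)) - S1 h' n' 0 (fun s => f (mk3 t s r))| <= E.
  have := cmp (mk3 t 0 r) 1 y; rewrite mxE (tnth_nth 0)/= => /(_ erefl hy).
  congr (`|S1 _ _ _ _ - S1 _ _ _ _| <= _); apply/funext => s;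
    by have [_ -> _] := mk3_line t s r.
have c1 s r : `|S1 h n x (fun t => f (mk3 t s r)) - S1 h' n' 0 (fun t => f (mk3 t s r))| <= E.
  have := cmp (mk3 0 s r) 0 x; rewrite mxE (tnth_nth 0)/= => /(_ erefl hx).
  congr (`|S1 _ _ _ _ - S1 _ _ _ _| <= _); apply/funext => t;
    by have [-> _ _] := mk3_line t s r.
have h00 := ltW h0; have h00' := ltW h0'.
pose T2 := (2 * (B + 2)) * ((2 * (B + 2)) * E).
pose P := S1 h n x (fun t => S1 h n y (fun s => S1 h' n' 0 (fun r => f (mk3 t s r)))).
pose Q := S1 h n x (fun t => S1 h' n' 0 (fun s => S1 h' n' 0 (fun r => f (mk3 t s r)))).
have d1 : `|S3 h n x y z f - P| <= T2.
  rewrite /S3 /P S1B; under [X in S1 _ _ _ X]eq_fun do rewrite S1B.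
  by apply: S1_bound2 => // t s; exact: c3.
have d2 : `|P - Q| <= T2.
  rewrite /P /Q S1B; under [X in S1 _ _ _ X]eq_fun do rewrite S1_comm [X in _ - X]S1_comm S1B.
  by apply: S1_bound2 => // t s; exact: c2.
have d3 : `|Q - S3 h' n' 0 0 0 f| <= T2.
  rewrite /Q /S3 S1_comm [X in _ - X]S1_comm S1B.
  under [X in S1 _ _ _ X]eq_fun do rewrite S1_comm [X in _ - X]S1_comm S1B.
  by apply: S1_bound2 => // t s; exact: c1.
apply: le_trans (ler_distD P _ _) _.
apply: le_trans (lerD d1 (ler_distD Q _ _)) _.
apply: le_trans (lerD (lexx _) (lerD d2 d3)) _.
by rewrite le_eqVlt; apply/orP; left; apply/eqP; rewrite /T2 /E; ring.
Qed.

Lemma CC_lattice lam k N f h (n : nat) : 0 <= lam -> CC B lam k.+1 N f ->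
  0 < h -> h <= 1 -> B < h * n%:R -> h * n%:R <= B + 2 ->
  `|I3 f - S3 h n 0 0 0 f| <= 3 * (lam * N) * h * (2 * (B + 2)) ^+ 3.
Proof.
move=> l0 hf h0 h1 hn hn2; rewrite S3E; apply: (@I3_lattice _ _ _ _ N) => //.
- exact: ltW.
- by rewrite !mulr_ge0//; exact: CC_ge0 hf.
- exact: CC_lipschitz hf.
- by move=> u /(proj1 hf) /andP[].
- by move=> u; exact: CC_bound hf.
Qed.

Lemma small_step (C del : R) : 0 <= C -> 0 < del ->
  exists h, [/\ 0 < h, h <= 1 & C * h <= del].
Proof.
move=> C0 d0; exists (Num.min 1 (del / (C + 1))).
have C1 : 0 < C + 1 by rewrite ltr_wpDl.
split; first by rewrite lt_min ltr01 divr_gt0.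
  by rewrite ge_min lexx.
apply: (@le_trans _ _ (C * (del / (C + 1)))); first by rewrite ler_wpM2l// ge_min lexx orbT.
rewrite mulrA ler_pdivrMr// mulrC ler_pM2l// lerDl//.
Qed.

(** The mesh h' of a second lattice tends to 0 with h fixed. Its sum approaches the integral only at
    rate h', but the comparison between the two lattices keeps the order m + 1 in h. *)
Lemma lattice3 lam m N f h (n : nat) x y z : 0 <= lam -> CC B lam m.+1 N f ->
  0 < h -> B < h * n%:R -> h * n%:R <= B + 2 ->
  0 <= x <= h -> 0 <= y <= h -> 0 <= z <= h ->
  `|S3 h n x y z f - I3 f| <= 48 * (B + 2) ^+ 3 * (lam ^+ m.+1 * N) * h ^+ m.+1.
Proof.
move=> l0 hf h0 hn hn2 hx hy hz; apply/ler_addgt0Pr => del d0.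
have N0 := CC_ge0 B1 hf.
have B2 : 0 <= B + 2 by rewrite addr_ge0// ltW.
set C1 := 48 * _ * _; set C2 := 3 * (lam * N) * (2 * (B + 2)) ^+ 3.
have C10 : 0 <= C1 by rewrite /C1 !mulr_ge0// exprn_ge0.
have C20 : 0 <= C2 by rewrite /C2 !mulr_ge0// exprn_ge0// mulr_ge0.
have [h' [h0' h1' hC]] := small_step (addr_ge0 C10 C20) d0.
have hn' := steps_gt h0' (ltW B0); have hn2' := steps_le h0' (ltW B0).
have hn3' : h' * (steps h' B)%:R <= B + 2 by apply: le_trans hn2' _; lra.
have b1 := lattice_compare l0 hf h0 hn hn2 hx hy hz h0' hn' hn3'.
have b2 := CC_lattice l0 hf h0' h1' hn' hn3'.
apply: le_trans (ler_distD (S3 h' (steps h' B) 0 0 0 f) _ _) _.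
rewrite [X in _ + X <= _]distrC; apply: le_trans (lerD b1 b2) _; rewrite -/C1 mulrDr -addrA lerD2l.
apply: le_trans hC; rewrite [leRHS]mulrDl; apply: lerD; last by rewrite /C2 mulrAC.
by rewrite ler_wpM2l// exprS ler_piMr ?(ltW h0')// exprn_ile1// ltW.
Qed.

(** Along each line the lattice sum of the derivative is O(h), since f vanishes at both ends of the
    line; then h tends to 0. *)
Lemma I3_derive0 lam k N f i : 0 <= lam -> CC B lam k.+2 N f -> I3 ('D_(di i) f) = 0.
Proof.
move=> l0 hf; have [Df hD] := CC_derive B1 i hf.
have M0 := CC_ge0 B1 hD; have N0 := CC_ge0 B1 hf.
apply/eqP; rewrite -normr_le0; apply/ler_addgt0Pr => del d0; rewrite add0r.
have B2 : 0 <= B + 2 by rewrite addr_ge0// ltW.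
set M := lam * N in hD M0.
pose C1 := 3 * (lam * M) * (2 * (B + 2)) ^+ 3.
pose C2 := 2 * (B + 2) * (2 * (B + 2) * (4 * (B + 2) * (lam * M))).
have C10 : 0 <= C1.
  rewrite /C1; apply: mulr_ge0; first by apply: mulr_ge0 => //; exact: mulr_ge0.
  by rewrite exprn_ge0// mulr_ge0.
have C20 : 0 <= C2 by rewrite /C2 !mulr_ge0.
have [h [h0 h1 hC]] := small_step (addr_ge0 C10 C20) d0.
have hn := steps_gt h0 (ltW B0); have hn2 := steps_le h0 (ltW B0).
have hn3 : h * (steps h B)%:R <= B + 2 by apply: le_trans hn2 _; lra.
set n := steps h B in hn hn2 hn3.
have b1 := CC_lattice l0 hD h0 h1 hn hn3.
have line p : p 0 i = 0 ->
    `|S1 h n 0 (fun t => 'D_(di i) f (p + t *: di i))| <= h * (4 * (B + 2) * (lam * M)).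
  move=> p0; have hb := slice_bd1 l0 (CC_leK (ltn0Sn k) hD) p0.
  have Dl (t : R) : is_derive t 1 (fun s => f (p + s *: di i)) ('D_(di i) f (p + t *: di i)).
    exact: (is_derive_lineP f p (di i) t _).1 (Df _).
  have c0 : 0 <= (0 : R) <= h by rewrite lexx ltW.
  have := lattice_sum1 Dl hb (ltW B0) h0 hn c0.
  have z t : B < `|t| -> f (p + t *: di i) = 0.
    move=> Bt; apply: (CC_supp hf) => /andP[_]; apply/negP; rewrite -ltNge.
    apply: lt_le_trans Bt (le_trans _ (coord_le_norm _ i)).
    by rewrite mxE p0 add0r mxE /di mxE !eqxx mulr1.
  have hn0 : 0 < h * n%:R by exact: lt_trans B0 hn.
  rewrite !z ?normrN ?(ger0_norm (ltW hn0))// !subr0 expr1 => H; apply: le_trans H _.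
  by rewrite ler_wpM2l ?(ltW h0)// ler_wpM2r ?mulr_ge0// ler_pM2l.
have b2 : `|S3 h n 0 0 0 ('D_(di i) f)| <= C2 * h.
  have h00 := ltW h0.
  have -> : C2 * h = 2 * (B + 2) * (2 * (B + 2) * (h * (4 * (B + 2) * (lam * M)))).
    by rewrite /C2; ring.
  move: line; case: i {Df hD b1} => -[|[|[|//]]] hi line; rewrite /S3.
  - rewrite S1_comm; under [X in S1 _ _ _ X]eq_fun do rewrite S1_comm.
    apply: S1_bound2 => // s r; have := line (mk3 0 s r); rewrite mxE (tnth_nth 0)/= => /(_ erefl).
    congr (`|S1 _ _ _ _| <= _); apply/funext => t; have [-> _ _] := mk3_line t s r.
    by congr ('D_ _ _ (_ + _ *: di _)); apply: val_inj.
  - under [X in S1 _ _ _ X]eq_fun do rewrite S1_comm.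
    apply: S1_bound2 => // t r; have := line (mk3 t 0 r); rewrite mxE (tnth_nth 0)/= => /(_ erefl).
    congr (`|S1 _ _ _ _| <= _); apply/funext => s; have [_ -> _] := mk3_line t s r.
    by congr ('D_ _ _ (_ + _ *: di _)); apply: val_inj.
  - apply: S1_bound2 => // t s; have := line (mk3 t s 0); rewrite mxE (tnth_nth 0)/= => /(_ erefl).
    congr (`|S1 _ _ _ _| <= _); apply/funext => r; have [_ _ ->] := mk3_line t s r.
    by congr ('D_ _ _ (_ + _ *: di _)); apply: val_inj.
have := ler_distD (S3 h n 0 0 0 ('D_(di i) f)) (I3 ('D_(di i) f)) 0; rewrite !subr0 => H.
apply: le_trans H _; apply: le_trans (lerD b1 b2) _; apply: le_trans hC.
by rewrite [leRHS]mulrDl lerD2r /C1 mulrAC.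
Qed.

End LatticeSums3D.

(** * The density of the cubic form *)

Section CompF0.
Context {R : realType}.
Local Notation V := 'rV[R]_3.

Lemma is_derive_compF0 (psi : R -> R) (d : R) (u : V) i : is_derive (F0 u) 1 psi d ->
  is_derive u (di i) (fun v => psi (F0 v)) (d * (3 * u 0 i ^+ 2)).
Proof.
by move=> hd; exact: (is_derive_comp_real (is_derive_F0 u i) hd).
Qed.

(** Each use of the chain rule brings a factor 3 u_i^2 besides the next derivative of [psi], hence
    the condition lam1 B^2 <= lam. *)
Lemma Mu_compF0 k : exists2 c : R, 0 <= c & forall (B lam lam1 P : R) (psi : nat -> R -> R),
  1 <= B -> 0 <= lam1 -> 1 <= lam -> lam1 * B ^+ 2 <= lam ->
  (forall j, (j <= k)%N -> continuous (psi j)) ->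
  (forall j (t : R), (j < k)%N -> is_derive t 1 (psi j) (psi j.+1 t)) ->
  (forall j t, (j <= k)%N -> `|t| <= 3 * B ^+ 3 -> `|psi j t| <= P * lam1 ^+ j) ->
  Mu B lam k (c * P) (fun u => psi 0%N (F0 u)).
Proof.
have cont (psi : R -> R) u : continuous psi -> {for u, continuous (fun v : V => psi (F0 v))}.
  by move=> cp; apply: (@continuous_comp _ _ _ (fun v : V => F0 v) psi); [exact: F0_cont|exact: cp].
have bnd (B P : R) (psi : R -> R) : 1 <= B -> (forall t, `|t| <= 3 * B ^+ 3 -> `|psi t| <= P) ->
    forall u : V, annulus B u -> `|psi (F0 u)| <= P.
  by move=> B1 H u /andP[_ uB]; apply: H; exact: F0_bound.
elim: k => [|k [c c0 IH]].
  exists 1 => // B lam lam1 P psi B1 l10 l1 ll cpsi dpsi bpsi; split=> //.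
  - by move=> u _; apply: cont; exact: cpsi.
  - rewrite mul1r; apply: bnd => // t tB; have := bpsi 0%N t (leqnn _) tB.
    by rewrite expr0 mulr1.
exists (1 + 2 ^+ k * (c * (2 ^+ k * (3 * 2 ^+ k)))).
  by rewrite addr_ge0// !mulr_ge0// exprn_ge0.
move=> B lam lam1 P psi B1 l10 l1 ll cpsi dpsi bpsi.
have l0 : 0 <= lam by exact: le_trans l1.
have P0 : 0 <= P.
  have z0 : `|0 : R| <= 3 * B ^+ 3 by rewrite normr0 mulr_ge0// exprn_ge0// (le_trans ler01).
  by have := bpsi 0%N 0 (leq0n _) z0; rewrite expr0 mulr1; apply: le_trans.
split.
- by move=> u _; apply: cont; exact: cpsi.
- move=> u /(bnd _ P (psi 0%N) B1) h; apply: le_trans (h _) _.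
    by move=> t tB; have := bpsi 0%N t (leq0n _) tB; rewrite expr0 mulr1.
  by rewrite ler_peMl// lerDl !mulr_ge0// exprn_ge0.
move=> i; exists (fun u => psi 1%N (F0 u) * (3 * (u 0 i * u 0 i))); split.
  move=> u _; rewrite -expr2; apply: is_derive_compF0; exact: dpsi.
have h1 : Mu B lam k (c * (P * lam1)) (fun u => psi 1%N (F0 u)).
  apply: (IH B lam lam1 (P * lam1) (fun j => psi j.+1)) => //.
  - by move=> j jk; exact: cpsi.
  - by move=> j t jk; exact: dpsi.
  - by move=> j t jk tB; rewrite -mulrA -exprS; exact: bpsi.
have h2 : Mu B lam k (2 ^+ k * (`|3| * (2 ^+ k * (B * B)))) (fun u : V => 3 * (u 0 i * u 0 i)).
  by apply: Mu_scale => //; apply: Mu_mul => //; exact: Mu_coord.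
apply: Mu_leN (Mu_mul B1 l0 h1 h2) => //.
set K := 2 ^+ k; rewrite (_ : K * _ = (K * (c * (K * (3 * K)))) * P * (lam1 * B ^+ 2)); last first.
  by rewrite ger0_norm//; ring.
rewrite [leRHS]mulrC; apply: ler_pM => //.
- by rewrite !mulr_ge0// /K exprn_ge0.
- by rewrite mulr_ge0// exprn_ge0// (le_trans ler01).
- by rewrite ler_wpM2r// lerDr.
Qed.

End CompF0.

(** * Integration by parts against functions of the form *)

Section Pushforward.
Context {R : realType}.
Local Notation V := 'rV[R]_3.
Local Notation RB := (measurableTypeR R).
Local Notation RB3 := (RB * RB * RB)%type.
Local Notation lebesgue3 := (@lebesgue3 R).
Implicit Types (f g : V -> R) (k psi : R -> R) (t : R).

Lemma measurable_F0row : measurable_fun setT (fun x : RB3 => F0 (row3 x) : R).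
Proof.
rewrite (_ : (fun x : RB3 => _) = fun x : RB3 => x.1.1 ^+ 3 + x.1.2 ^+ 3 + x.2 ^+ 3); last first.
  by apply/funext => x; rewrite /F0 big_ord3 !mxE !(tnth_nth 0).
apply: measurable_funD; first apply: measurable_funD; apply: measurable_funX.
- by apply: measurableT_comp => //; exact: measurable_fst.
- by apply: measurableT_comp => //; exact: measurable_fst.
- exact: measurable_snd.
Qed.

Variable B : R.
Hypothesis B1 : 1 <= B.
Let B0 : 0 < B := B_gt0 B1.
Let B00 : 0 <= B := ltW B0.

(** The function k tested against the push-forward of f dx under F0. *)
Definition J f k : R := I3 (fun u => f u * k (F0 u)).

Lemma CC_adm lam m N f : 0 <= lam -> CC B lam m.+1 N f ->
  adm (box B) N (fun x => f (row3 x)).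
Proof.
move=> l0 hf; apply: (@lipschitz_adm _ _ (3 * (lam * N))) => //.
- by rewrite !mulr_ge0//; exact: CC_ge0 hf.
- exact: CC_lipschitz hf.
- by move=> u /(proj1 hf) /andP[].
- by move=> u; exact: CC_bound hf.
Qed.

Lemma box_F0 (x : RB3) : box B x -> `|F0 (row3 x)| <= 3 * B ^+ 3.
Proof.
move=> [[h1 h2] h3]; apply: (F0_bound B1); apply: norm_le_coord => // i.
move: h1 h2 h3; rewrite /= !in_itv/= -!ler_norml => h1 h2 h3.
by case: i => -[|[|[|//]]] hi; rewrite mxE (tnth_nth 0).
Qed.

Lemma J_adm N f k M : adm (box B) N (fun x => f (row3 x)) -> measurable_fun setT k -> 0 <= M ->
  (forall s, `|s| <= 3 * B ^+ 3 -> `|k s| <= M) ->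
  adm (box B) (N * M) (fun x => f (row3 x) * k (F0 (row3 x))).
Proof.
move=> hf mk M0 kM; apply: adm_mul => //.
- by apply: measurableT_comp => //; exact: measurable_F0row.
- by move=> x /box_F0; exact: kM.
Qed.

Lemma J_bound N f k M : adm (box B) N (fun x => f (row3 x)) -> measurable_fun setT k -> 0 <= M ->
  (forall s, `|s| <= 3 * B ^+ 3 -> `|k s| <= M) -> `|J f k| <= N * M * (2 * B) ^+ 3.
Proof. by move=> hf mk M0 kM; apply: adm3_bound => //; exact: J_adm. Qed.

Lemma J_ext f k k' : (forall u, annulus B u -> f u * k (F0 u) = f u * k' (F0 u)) ->
  (forall u, f u != 0 -> annulus B u) -> J f k = J f k'.
Proof.
move=> E sf; rewrite /J; congr I3; apply/funext => u.
have [/eqP ->|/sf/E//] := boolP (f u == 0).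
by rewrite !mul0r.
Qed.

Lemma J_lin N f k k' M M' a b : adm (box B) N (fun x => f (row3 x)) ->
  measurable_fun setT k -> 0 <= M -> (forall s, `|s| <= 3 * B ^+ 3 -> `|k s| <= M) ->
  measurable_fun setT k' -> 0 <= M' -> (forall s, `|s| <= 3 * B ^+ 3 -> `|k' s| <= M') ->
  J f (fun s => a * k s + b * k' s) = a * J f k + b * J f k'.
Proof.
move=> hf mk M0 kM mk' M0' kM'.
have h := J_adm hf mk M0 kM; have h' := J_adm hf mk' M0' kM'.
rewrite /J /I3 -(adm3_integralZ a B00 h) -(adm3_integralZ b B00 h').
rewrite -(adm3_integralD B00 (adm_scale a h) (adm_scale b h')).
by apply: eq_Rintegral => x _; ring.
Qed.

(** The divergence of f psi(F0) Vf has integral 0. Its part in which psi is differentiated is f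
    psi1(F0), because Vf . grad F0 = 1. *)
Lemma J_ibp lam m N f psi psi1 psi2 P : 1 <= lam -> CC B lam m.+3 N f ->
  continuous psi -> continuous psi1 -> continuous psi2 ->
  (forall t, is_derive t 1 psi (psi1 t)) -> (forall t, is_derive t 1 psi1 (psi2 t)) ->
  (forall s, `|s| <= 3 * B ^+ 3 -> [/\ `|psi s| <= P, `|psi1 s| <= P & `|psi2 s| <= P]) ->
  J (Lop f) psi = - J f psi1.
Proof.
move=> l1 hf c0 c1 c2 d0 d1 bP.
have l0 : 0 <= lam by exact: le_trans l1.
(* Raising the cost to at least B^7 makes the bounds for [Vf] available. *)
pose lam' := Num.max lam (B ^+ 7).
have ll : lam <= lam' by rewrite le_max lexx.
have l1' : 1 <= lam' by exact: le_trans ll.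
have l0' : 0 <= lam' by exact: le_trans ll.
have Bl : B ^+ 7 <= lam' by rewrite le_max lexx orbT.
have hf' : CC B lam' m.+3 N f by apply: CC_lam hf; rewrite // l0.
have [c cc0 HV] := @Mu_Vf R m.+3; have [c2' _ HL'] := @CC_L R m.+2; have [c' cc0' HF] := @Mu_compF0 R 2.
have HL : forall g N', CC B lam' m.+3 N' g -> CC B lam' m.+2 _ (Lop g) :=
  fun g N' h => HL' B lam' N' g B1 Bl h.
have hF : Mu B lam' 2 (c' * P) (fun u => psi (F0 u)).
  apply: (HF B lam' 1 P (fun j => match j with 0 => psi | 1 => psi1 | _ => psi2 end)) => //.
  - by rewrite mul1r; apply: (le_trans _ Bl); rewrite ler_weXn2l.
  - by case=> [|[|j]].
  - by case=> [|[|j]].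
  - by move=> j t _ /bP[h0 h1 h2]; rewrite expr1n mulr1; case: j => [|[|j]].
have hV i := HV B lam' i B1 Bl.
have hg i : CC B lam' m.+3 _ (fun v => f v * Vf i v) := CC_mul B1 l0' hf' (hV i).
have hgF i := CC_mul B1 l0' (CC_leK (isT : (2 <= m.+3)%N) (hg i)) hF.
have Dg i := CC_derive B1 i (hg i).
have DgF i := CC_derive B1 i (hgF i).
have E i u : 'D_(di i) (fun v => f v * Vf i v * psi (F0 v)) u =
    'D_(di i) (fun v => f v * Vf i v) u * psi (F0 u) +
    f u * Vf i u * (psi1 (F0 u) * (3 * u 0 i ^+ 2)).
  have D1 := is_deriveM_fun ((Dg i).1 u) (is_derive_compF0 i (d0 (F0 u))).
  rewrite (is_derive_unique ((DgF i).1 u) D1); ring.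
have S : J (Lop f) psi + J f psi1 = \sum_(i < 3) I3 ('D_(di i) (fun v => f v * Vf i v * psi (F0 v))).
  have P0 : 0 <= P.
    have z0 : `|0 : R| <= 3 * B ^+ 3 by rewrite normr0 mulr_ge0// exprn_ge0.
    by have [+ _ _] := bP _ z0; apply: le_trans.
  have mc k : continuous k -> measurable_fun setT k.
    by move=> ck; exact: continuous_measurable_fun.
  have a1 : adm (box B) _ (fun x => Lop f (row3 x) * psi (F0 (row3 x))) :=
    J_adm (CC_adm l0' (HL _ _ hf')) (mc _ c0) P0 (fun s hs => let: And3 h _ _ := bP s hs in h).
  have a2 : adm (box B) _ (fun x => f (row3 x) * psi1 (F0 (row3 x))) :=
    J_adm (CC_adm l0 hf) (mc _ c1) P0 (fun s hs => let: And3 _ h _ := bP s hs in h).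
  have a3 i := CC_adm l0' ((DgF i).2).
  rewrite -(adm3_integralD B00 a1 a2) -(adm3_sum (index_enum 'I_3) B00 a3).2.
  apply: eq_Rintegral => x _; rewrite /Lop mulr_suml.
  under [RHS]eq_bigr do rewrite E.
  rewrite big_split/=; congr (_ + _).
  have [/eqP r0|r0] := boolP (row3 x == 0).
    have f0 : f (row3 x) = 0 by rewrite r0; exact: (CC_supp hf (not_annulus0 B1)).
    by rewrite f0 mul0r big1// => i _; rewrite !mul0r.
  rewrite -[LHS]mulr1 -[X in _ * X](Vf_grad r0) mulr_sumr; apply: eq_bigr => i _; ring.
apply/eqP; rewrite -addr_eq0 S big1 ?eqxx// => i _.
exact: (I3_derive0 B1 i l0' (hgF i)).
Qed.

End Pushforward.

(** * Truncated powers and quadratic Taylor remainders *)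

Section Kernels.
Context {R : realType}.
Implicit Types (k : R -> R) (t x h : R).

Definition lb k := measurable_fun setT k /\
  forall Y, exists2 M, 0 <= M & forall x, `|x| <= Y -> `|k x| <= M.

(** Differentiability with a remainder O(h^2), locally uniformly. Unlike the pointwise notion it
    survives integration of k(F0 - t) against a weight, which is how derivatives in t pass under the
    integral sign. *)
Definition quad k k' := forall Y, exists2 C, 0 <= C &
  forall x h, `|x| <= Y -> `|h| <= 1 -> `|k (x + h) - k x - h * k' x| <= C * h ^+ 2.

Lemma lb_cont k : continuous k -> lb k.
Proof.
move=> ck; split; first exact: continuous_measurable_fun.
move=> Y; have [Y0|Y0] := leP 0 Y; last first.
  by exists 0 => // x xY; move: (le_trans (normr_ge0 x) xY); rewrite leNgt Y0.
have cY : {within `[- Y, Y], continuous (fun x => `|k x|)}.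
  apply: continuous_subspaceT => x.
  by apply: (@continuous_comp _ _ _ k (fun y : R => `|y|)); [exact: ck|exact: norm_continuous].
have YY : - Y <= Y by rewrite (le_trans _ Y0)// oppr_le0.
have [c _ H] := EVT_max YY cY.
exists `|k c| => // x xY; apply: H; by rewrite in_itv/= -ler_norml.
Qed.

Lemma lb_shift k t : lb k -> lb (fun s => k (s - t)).
Proof.
move=> [mk bk]; split.
  apply: measurableT_comp => //; exact: measurable_funB.
move=> Y; have [M M0 H] := bk (Y + `|t|); exists M => // x xY; apply: H.
by rewrite (le_trans (ler_normB _ _))// lerD2r.
Qed.

Lemma lb_lin k k' a b : lb k -> lb k' -> lb (fun s => a * k s + b * k' s).
Proof.
move=> [mk bk] [mk' bk']; split.
  by apply: measurable_funD; apply: measurable_funM.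
move=> Y; have [M M0 H] := bk Y; have [M' M0' H'] := bk' Y.
exists (`|a| * M + `|b| * M'); first by rewrite addr_ge0// mulr_ge0.
move=> x xY; rewrite (le_trans (ler_normD _ _))// lerD// normrM ler_wpM2l//; [exact: H|exact: H'].
Qed.

Lemma quad_derive k k' : quad k k' -> forall t : R, is_derive t 1 k (k' t).
Proof.
move=> q t; have [C C0 H] := q `|t|.
suff E : (fun h : R => h^-1 *: (k (h *: 1 + t) - k t)) @ 0^' --> k' t.
  split; first exact: (cvgP _ E).
  exact: (cvg_lim _ E).
apply/cvgrPdist_le => e0 e00.
have C1 : 0 < C + 1 by rewrite ltr_wpDl.
near=> h; have h0 : h != 0 by near: h; exact: nbhs_dnbhs_neq.
have h1 : `|h| <= Num.min 1 (e0 / (C + 1)).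
  near: h; apply: dnbhs0_le; rewrite lt_min ltr01 divr_gt0// ltr_wpDl.
move: h1; rewrite le_min => /andP[h1 h2].
have -> : k' t - h^-1 *: (k (h *: 1 + t) - k t) = - h^-1 * (k (t + h) - k t - h * k' t).
  rewrite /GRing.scale/= mulr1 [h + t]addrC; field; exact: h0.
rewrite normrM normrN normfV ler_pdivrMl ?normr_gt0//.
apply: le_trans (H _ _ (lexx _) h1) _; rewrite -[h ^+ 2]real_normK ?num_real// expr2 mulrCA.
rewrite ler_wpM2l//; move: h2; rewrite ler_pdivlMr// mulrC; apply: le_trans.
by rewrite ler_wpM2r// lerDl.
Unshelve. all: by end_near.
Qed.

Lemma quad_unique k k1 k2 : quad k k1 -> quad k k2 -> k1 =1 k2.
Proof. by move=> /quad_derive q1 /quad_derive q2 t; exact: is_derive_unique (q1 t) (q2 t). Qed.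

Lemma quad_cont k k' : quad k k' -> continuous k.
Proof.
move=> /quad_derive q t; apply: differentiable_continuous; apply/derivable1_diffP.
by case: (q t).
Qed.

Lemma quad_shift k k' t : quad k k' -> quad (fun s => k (s - t)) (fun s => k' (s - t)).
Proof.
move=> q Y; have [C C0 H] := q (Y + `|t|); exists C => // x h xY h1.
rewrite (_ : x + h - t = x - t + h); last by ring.
by apply: H => //; rewrite (le_trans (ler_normB _ _))// lerD2r.
Qed.

Lemma quad_opp k k' : quad k k' -> quad (fun s => - k s) (fun s => - k' s).
Proof.
move=> q Y; have [C C0 H] := q Y; exists C => // x h xY h1.
rewrite (_ : _ - _ - _ = - (k (x + h) - k x - h * k' x)); last by ring.
by rewrite normrN; exact: H.
Qed.

Lemma quad_ext k k1 k' k1' : k =1 k1 -> k' =1 k1' -> quad k k' -> quad k1 k1'.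
Proof. by move=> /funext <- /funext <-. Qed.

(** The truncated powers x_+^j / j!, each the derivative of the next. The difference quotients of
    the first tend to an indicator, which links them to the distribution function of F0. *)
Definition pos1 x : R := Num.max x 0.
Definition pos2 x : R := pos1 x ^+ 2 / 2.
Definition pos3 x : R := pos1 x ^+ 3 / 6.

Lemma pos1_cont : continuous pos1.
Proof.
rewrite (_ : pos1 = fun x => (x + `|x|) / 2) => [x|].
  by apply: cvgMl; apply: cvgD; [exact: cvg_id|exact: norm_continuous].
apply/funext => x; rewrite /pos1; case: leP => x0.
  by rewrite ler0_norm// subrr mul0r.
by rewrite gtr0_norm// -mulr2n -[_ *+ 2]mulr_natr mulfK.
Qed.

Lemma pos2_cont : continuous pos2.
Proof.
move=> x; apply: cvgMl; apply: (@continuous_comp _ _ _ pos1 (fun y : R => y ^+ 2)).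
  exact: pos1_cont.
exact: exprn_continuous.
Qed.

Lemma pos3_cont : continuous pos3.
Proof.
move=> x; apply: cvgMl; apply: (@continuous_comp _ _ _ pos1 (fun y : R => y ^+ 3)).
  exact: pos1_cont.
exact: exprn_continuous.
Qed.

Lemma quad_pos2 : quad pos2 pos1.
Proof.
move=> Y; exists 1 => // x h _ _; rewrite mul1r /pos2 /pos1 ler_norml.
by case: (leP x 0) => x0; case: (leP (x + h) 0) => xh0; rewrite ?expr0n/=; apply/andP; split; nra.
Qed.

Lemma quad_pos3 : quad pos3 pos2.
Proof.
move=> Y; have [Y0|Y0] := leP 0 Y; last first.
  by exists 0 => // x h xY; move: (le_trans (normr_ge0 x) xY); rewrite leNgt Y0.
exists (Y + 1); first by rewrite addr_ge0.
move=> x h /ler_normlP[x1 x2] /ler_normlP[h1 h2]; rewrite /pos3 /pos2 /pos1.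
(* When x and x + h lie on different sides of 0, |x| <= |h| and every term is cubic in h. *)
case: (leP x 0) => x0; case: (leP (x + h) 0) => xh0; rewrite ?expr0n/=.
- by rewrite !mul0r mulr0 !subr0 normr0 mulr_ge0 ?sqr_ge0// addr_ge0.
- have h0 : 0 <= h by lra.
  have c3 : (x + h) ^+ 3 <= h ^+ 3 by rewrite lerXn2r ?nnegrE//; lra.
  have c0 : 0 <= (x + h) ^+ 3 by rewrite exprn_ge0// ltW.
  rewrite !mul0r mulr0 !subr0 ger0_norm ?divr_ge0//.
  have h3 : h ^+ 3 <= h ^+ 2 by rewrite exprS ler_piMl// sqr_ge0.
  have q : 0 <= Y * h ^+ 2 by rewrite mulr_ge0// sqr_ge0.
  have q' := sqr_ge0 h.
  by rewrite [leRHS]mulrDl mul1r; lra.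
- have xh : 0 <= x <= - h by apply/andP; split; lra.
  have x3 : x ^+ 3 <= (- h) ^+ 3 by rewrite lerXn2r ?nnegrE//; lra.
  have x20 : x ^+ 2 <= (- h) ^+ 2 by rewrite lerXn2r ?nnegrE//; lra.
  have c0 : 0 <= x ^+ 3 by rewrite exprn_ge0// ltW.
  have e3 : (- h) ^+ 3 <= h ^+ 2 by rewrite -[h ^+ 2]sqrrN exprS ler_piMl ?sqr_ge0//; lra.
  have t0 : 0 <= - h * x ^+ 2 by rewrite mulr_ge0 ?sqr_ge0//; lra.
  have t1 : - h * x ^+ 2 <= (- h) ^+ 3 by rewrite [leRHS]exprS ler_wpM2l//; lra.
  have q : 0 <= Y * h ^+ 2 by rewrite mulr_ge0// sqr_ge0.
  rewrite mul0r sub0r [leRHS]mulrDl mul1r mulrA ler_norml.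
  by apply/andP; split; lra.
- rewrite (_ : _ - _ - _ = (x / 2 + h / 6) * h ^+ 2); last by field.
  rewrite normrM [X in _ * X]ger0_norm ?sqr_ge0// ler_wpM2r ?sqr_ge0//.
  by rewrite ler_norml; apply/andP; split; lra.
Qed.

End Kernels.

(** * The distribution function of the form and its derivative *)

Section Density.
Context {R : realType}.
Local Notation V := 'rV[R]_3.
Local Notation RB := (measurableTypeR R).
Local Notation RB3 := (RB * RB * RB)%type.
Implicit Types (f g : V -> R) (k : R -> R) (t : R).

Variables (B lam : R).
Hypotheses (B1 : 1 <= B) (Bl : B ^+ 7 <= lam).
Let B0 : 0 < B := B_gt0 B1.
Let B00 : 0 <= B := ltW B0.
Let l1 : 1 <= lam.
Proof. by apply: (le_trans _ Bl); rewrite exprn_ege1. Qed.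
Let l0 : 0 <= lam := le_trans ler01 l1.

Definition A k f t : R := J f (fun s => k (s - t)).

Lemma CC_Lop m N f : CC B lam m.+1 N f -> exists N', CC B lam m N' (Lop f).
Proof. by move=> hf; have [c _ H] := @CC_L R m; eexists; exact: H hf. Qed.

Lemma J_lb_lin m N f k k' a b : CC B lam m.+1 N f -> lb k -> lb k' ->
  J f (fun s => a * k s + b * k' s) = a * J f k + b * J f k'.
Proof.
move=> hf [mk bk] [mk' bk'].
have [M M0 H] := bk (3 * B ^+ 3); have [M' M0' H'] := bk' (3 * B ^+ 3).
exact: (J_lin B1 _ _ (CC_adm B1 l0 hf) mk M0 H mk' M0' H').
Qed.

Lemma J_quad m N f k k' : CC B lam m.+1 N f -> lb k -> lb k' -> quad k k' ->
  quad (A k f) (fun t => - A k' f t).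
Proof.
move=> hf hk hk' q Y; have N0 := CC_ge0 B1 hf.
have [C C0 H] := q (3 * B ^+ 3 + Y).
exists (N * C * (2 * B) ^+ 3); first by rewrite !mulr_ge0// exprn_ge0// mulr_ge0.
move=> t h tY h1.
have ht := lb_shift t hk; have hth := lb_shift (t + h) hk; have ht' := lb_shift t hk'.
rewrite (_ : A k f (t + h) - A k f t - h * - A k' f t =
    J f (fun s => 1 * (1 * k (s - (t + h)) + (- 1) * k (s - t)) + h * k' (s - t))); last first.
  rewrite (J_lb_lin _ _ hf (lb_lin 1 (-1) hth ht) ht') (J_lb_lin _ _ hf hth ht) /A; ring.
have [mm _] := lb_lin 1 h (lb_lin 1 (-1) hth ht) ht'.
rewrite (_ : _ * _ * _ * _ = N * (C * h ^+ 2) * (2 * B) ^+ 3); last by ring.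
apply: (J_bound B1 (CC_adm B1 l0 hf) mm (mulr_ge0 C0 (sqr_ge0 h))) => s sB.
rewrite !mul1r mulN1r (_ : s - (t + h) = s - t - h); last by ring.
have := H (s - t) (- h); rewrite normrN sqrrN mulNr opprK; apply => //.
by rewrite (le_trans (ler_normB _ _))// lerD.
Qed.

Lemma lb_pos1 : lb (@pos1 R). Proof. exact: lb_cont pos1_cont. Qed.
Lemma lb_pos2 : lb (@pos2 R). Proof. exact: lb_cont pos2_cont. Qed.
Lemma lb_pos3 : lb (@pos3 R). Proof. exact: lb_cont pos3_cont. Qed.

Lemma J_ibp_cont m N f psi psi1 psi2 : CC B lam m.+3 N f ->
  quad psi psi1 -> quad psi1 psi2 -> continuous psi2 ->
  J (Lop f) psi = - J f psi1.
Proof.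
move=> hf q q1 c2.
have [_ bp] := lb_cont (quad_cont q); have [_ bp1] := lb_cont (quad_cont q1).
have [_ bp2] := lb_cont c2.
have [M M0 H] := bp (3 * B ^+ 3); have [M1 M10 H1] := bp1 (3 * B ^+ 3).
have [M2 M20 H2] := bp2 (3 * B ^+ 3).
apply: (@J_ibp _ B B1 lam m N f psi psi1 psi2 (M + M1 + M2) l1 hf) => //.
- exact: quad_cont q.
- exact: quad_cont q1.
- exact: quad_derive q.
- exact: quad_derive q1.
move=> s sB; have h := H _ sB; have h1 := H1 _ sB; have h2 := H2 _ sB.
by split; lra.
Qed.

Lemma A_pos3 m N f t : CC B lam m.+3 N f -> A (@pos3 R) (Lop f) t = - A (@pos2 R) f t.
Proof.
move=> hf; apply: (J_ibp_cont hf (quad_shift t quad_pos3) (quad_shift t quad_pos2)).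
move=> s; apply: (@continuous_comp _ _ _ (fun y : R => y - t) pos1).
  by apply: cvgB; [exact: cvg_id|exact: cvg_cst].
exact: pos1_cont.
Qed.

(** [J_ibp_cont] does not reach [pos2], whose second derivative jumps. Instead the identity for
    [pos3] is differentiated in t, and the derivatives of its two sides are compared. *)
Lemma A_pos2 m N f t : CC B lam m.+3 N f -> A (@pos2 R) (Lop f) t = - A (@pos1 R) f t.
Proof.
move=> hf; have [N' hL] := CC_Lop hf.
have q1 := quad_opp (J_quad hf lb_pos2 lb_pos1 quad_pos2).
have q2 := J_quad hL lb_pos3 lb_pos2 quad_pos3.
have E : (fun s => - A (@pos2 R) f s) =1 A (@pos3 R) (Lop f) by move=> s; rewrite (A_pos3 _ hf).
have := quad_unique (quad_ext E (fun=> erefl) q1) q2 t.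
by rewrite opprK => ->; rewrite opprK.
Qed.

(** The t-derivative of the integral of f (F0 - t)_+, that is minus the integral of f over F0 > t
    ([J_above]). Its own derivative [U (Lop f)] is the density. *)
Definition U f : R -> R := A (@pos1 R) (Lop f).

Lemma quad_pos1 m N f : CC B lam m.+3 N f -> quad (A (@pos1 R) f) (U f).
Proof.
move=> hf; have [N' hL] := CC_Lop hf.
have := quad_opp (J_quad hL lb_pos2 lb_pos1 quad_pos2); apply: quad_ext => t.
  by rewrite (A_pos2 _ hf) opprK.
by rewrite opprK.
Qed.

Lemma quad_U m N f : CC B lam m.+4 N f -> quad (U f) (U (Lop f)).
Proof. by move=> /CC_Lop[N' /quad_pos1]. Qed.

Definition above t (s : R) : R := (t < s)%R%:R.
Definition above_eq t (s : R) : R := (t <= s)%R%:R.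

Lemma norm_nat_bool (b : bool) : `|b%:R : R| <= 1.
Proof. by case: b; rewrite ?normr1 ?normr0. Qed.

Lemma lb_indic (D : set R) : measurable D -> lb (\1_D : R -> R).
Proof.
move=> mD; split; first exact: measurable_indic.
by move=> Y; exists 1 => // x _; exact: norm_nat_bool.
Qed.

Lemma lb_above t : lb (above t).
Proof.
rewrite (_ : above t = \1_(`]t, +oo[%classic)).
  by apply: lb_indic; exact: measurable_itv.
apply/funext => s; rewrite indicE /above; congr (nat_of_bool _)%:R.
by rewrite mem_setE in_itv/= andbT.
Qed.

Lemma lb_above_eq t : lb (above_eq t).
Proof.
rewrite (_ : above_eq t = \1_(`[t, +oo[%classic)).
  by apply: lb_indic; exact: measurable_itv.
apply/funext => s; rewrite indicE /above; congr (nat_of_bool _)%:R.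
by rewrite mem_setE in_itv/= andbT.
Qed.

Lemma pos1_lipschitz (x y : R) : `|pos1 x - pos1 y| <= `|x - y|.
Proof.
have := ler_norm (x - y); have := ler_norm (- (x - y)); rewrite normrN /pos1 ler_norml.
by move: `|x - y| => H q1 q2; case: (leP x 0) => c1; case: (leP y 0) => c2; apply/andP; split; lra.
Qed.

(* The difference quotients of the ramp converge to an indicator; the choice of
   the sign of the increments decides on which side it is closed. *)
Lemma J_indicator m N f t (sg : R) k : CC B lam m.+3 N f -> `|sg| = 1 -> lb k ->
  (forall s, \forall n \near \oo,
     (pos1 (s - (t + sg * n.+1%:R^-1)) - pos1 (s - t)) / (sg * n.+1%:R^-1) = - k s) ->
  J f k = - U f t.
Proof.
move=> hf sg1 [mk bk] E.
pose h n : R := sg * n.+1%:R^-1.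
have hn n : `|h n| = n.+1%:R^-1 by rewrite normrM sg1 mul1r ger0_norm// invr_ge0.
have h0 n : h n != 0 by rewrite -normr_eq0 hn invr_eq0 pnatr_eq0.
have h1 n : `|h n| <= 1 by rewrite hn invf_le1// ler1n.
pose kap n s : R := (pos1 (s - (t + h n)) - pos1 (s - t)) / h n.
have hkap n : lb (kap n).
  have := lb_lin (h n)^-1 (- (h n)^-1) (lb_shift (t + h n) lb_pos1) (lb_shift t lb_pos1).
  congr lb; apply/funext => s; rewrite /kap; ring.
have kb n s : `|kap n s| <= 1.
  rewrite /kap normrM normfV ler_pdivrMr ?normr_gt0// mul1r.
  apply: le_trans (pos1_lipschitz _ _) _.
  by rewrite (_ : _ - _ - _ = - h n) ?normrN//; ring.
have a n := J_adm B1 (CC_adm B1 l0 hf) (hkap n).1 ler01 (fun s _ => kb n s).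
have cv (x : RB3) : f (row3 x) * kap n (F0 (row3 x)) @[n --> \oo] --> f (row3 x) * - k (F0 (row3 x)).
  apply: cvgMr; apply: cvg_near_cst; exact: E.
have [ad C1] := adm3_cvg B00 a cv.
have C2 : J f (kap n) @[n --> \oo] --> U f t.
  have [C C0 H] := quad_pos1 hf `|t|.
  have E1 n : J f (kap n) = (h n)^-1 * A (@pos1 R) f (t + h n) + (- (h n)^-1) * A (@pos1 R) f t.
    rewrite /A -(J_lb_lin _ _ hf (lb_shift (t + h n) lb_pos1) (lb_shift t lb_pos1)).
    by congr J; apply/funext => s; rewrite /kap; ring.
  apply/cvgrPdist_le => e0 e00.
  have : (C * n.+1%:R^-1 : R) @[n --> \oo] --> C * 0 by apply: cvgMr; exact: cvg_harmonic.
  rewrite mulr0 => /cvgrPdist_le /(_ _ e00); apply: filterS => n.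
  rewrite sub0r normrN ger0_norm ?mulr_ge0 ?invr_ge0// => hC; apply: le_trans hC.
  have -> : U f t - J f (kap n) = - (h n)^-1 * (A (@pos1 R) f (t + h n) - A (@pos1 R) f t - h n * U f t).
    by rewrite E1; field; exact: h0.
  rewrite normrM normrN normfV ler_pdivrMl ?normr_gt0//.
  apply: le_trans (H _ _ (lexx _) (h1 n)) _.
  by rewrite -[h n ^+ 2]real_normK ?num_real// expr2 hn mulrCA.
rewrite -(cvg_unique (@norm_hausdorff _ R) C1 C2).
rewrite /J /I3 -[RHS]mulN1r -(adm3_integralZ (-1) B00 ad).
by apply: eq_Rintegral => x _; ring.
Qed.

Lemma natSinv_le (d : R) : 0 < d -> \forall n \near \oo, n.+1%:R^-1 <= d.
Proof.
move=> d0; have /cvgrPdist_le/(_ _ d0) := @cvg_harmonic R; apply: filterS => n.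
by rewrite sub0r normrN ger0_norm// invr_ge0.
Qed.

Lemma J_above m N f t : CC B lam m.+3 N f -> J f (above t) = - U f t.
Proof.
move=> hf; apply: (J_indicator (sg := 1) hf) => [||s]; [exact: normr1|exact: lb_above|].
have [st|st] := leP s t.
  near=> n; rewrite /above ltNge st oppr0 mul1r /pos1.
  have p : 0 < n.+1%:R^-1 :> R by rewrite invr_gt0.
  move: n.+1%:R^-1 p => x p; have c1 : s - (t + x) <= 0 by lra.
  have c2 : s - t <= 0 by rewrite subr_le0.
  by rewrite !max_r// subrr mul0r.
near=> n; rewrite /above st mul1r /pos1.
have p : 0 < n.+1%:R^-1 :> R by rewrite invr_gt0.
have q : n.+1%:R^-1 <= s - t.
  by near: n; apply: natSinv_le; rewrite subr_gt0.
move: n.+1%:R^-1 p q => x p q; have c1 : 0 <= s - (t + x) by lra.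
have c2 : 0 <= s - t by rewrite subr_ge0 ltW.
rewrite !max_l//.
rewrite (_ : _ - _ = - x) ?mulNr ?divff ?lt0r_neq0//; last by ring.
Unshelve. all: by end_near.
Qed.

(** The same value as for the strict inequality: level sets of F0 carry no mass of f, and closed
    shells and half-open cells are both increments of [U]. *)
Lemma J_above_eq m N f t : CC B lam m.+3 N f -> J f (above_eq t) = - U f t.
Proof.
move=> hf; apply: (J_indicator (sg := -1) hf) => [||s].
- by rewrite normrN normr1.
- exact: lb_above_eq.
have [st|st] := leP t s.
  near=> n; rewrite /above_eq st mulN1r /pos1.
  have p : 0 < n.+1%:R^-1 :> R by rewrite invr_gt0.
  move: n.+1%:R^-1 p => x p; have c1 : 0 <= s - (t + - x) by lra.
  have c2 : 0 <= s - t by rewrite subr_ge0.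
  rewrite !max_l//.
  rewrite (_ : _ - _ = x) ?invrN ?mulrN ?divff ?lt0r_neq0//; last by ring.
near=> n; rewrite /above_eq leNgt st oppr0 mulN1r /pos1.
have q : n.+1%:R^-1 <= t - s.
  by near: n; apply: natSinv_le; rewrite subr_gt0.
move: n.+1%:R^-1 q => x q; have c1 : s - (t + - x) <= 0 by lra.
have c2 : s - t <= 0 by rewrite subr_le0 ltW.
by rewrite !max_r// subrr mul0r.
Unshelve. all: by end_near.
Qed.

End Density.

Lemma CC_iterL_le {R : realType} (k : nat) : exists2 c : R, 0 <= c &
  forall j, (j <= k)%N -> forall (B lam N : R) f, 1 <= B -> B ^+ 7 <= lam ->
  CC B lam k N f -> CC B lam (k - j) (c * (lam * B ^+ 6) ^+ j * N) (iter j (@Lop R) f).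
Proof.
suff H n : (n <= k)%N -> exists2 c : R, 0 <= c & forall j, (j <= n)%N ->
    forall (B lam N : R) f, 1 <= B -> B ^+ 7 <= lam ->
    CC B lam k N f -> CC B lam (k - j) (c * (lam * B ^+ 6) ^+ j * N) (iter j (@Lop R) f).
  exact: H (leqnn k).
elim: n => [|n IH] nk.
  have [c c0 H] := @CC_iterL R k 0 (leq0n _); exists c => // j; rewrite leqn0 => /eqP ->; exact: H.
have [c c0 H] := IH (ltnW nk); have [c' c0' H'] := @CC_iterL R k n.+1 nk.
exists (c + c'); first exact: addr_ge0.
move=> j jn B lam N f B1 Bl hf.
have B0 : 0 <= B by exact: le_trans B1.
have l0 : 0 <= lam by apply: (le_trans _ Bl); rewrite exprn_ge0.
have N0 := CC_ge0 B1 hf.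
move: jn; rewrite leq_eqVlt => /orP[/eqP ->|jn].
  apply: CC_leN (H' B lam N f B1 Bl hf) => //.
  by rewrite ler_wpM2r// ler_wpM2r ?lerDr// exprn_ge0// mulr_ge0// exprn_ge0.
apply: CC_leN (H j jn B lam N f B1 Bl hf) => //.
by rewrite ler_wpM2r// ler_wpM2r ?lerDl// exprn_ge0// mulr_ge0// exprn_ge0.
Qed.

(** * Support and size of the density, and the push-forward formula *)

Section DensityBounds.
Context {R : realType}.
Local Notation V := 'rV[R]_3.
Local Notation RB := (measurableTypeR R).
Local Notation RB3 := (RB * RB * RB)%type.
Implicit Types (f g : V -> R) (k : R -> R) (t : R).

Variables (B lam : R).
Hypotheses (B1 : 1 <= B) (Bl : B ^+ 7 <= lam).
Let B0 : 0 < B := B_gt0 B1.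
Let B00 : 0 <= B := ltW B0.
Let l1 : 1 <= lam.
Proof. by apply: (le_trans _ Bl); rewrite exprn_ege1. Qed.
Let l0 : 0 <= lam := le_trans ler01 l1.

Lemma J_eq0 m N f k : CC B lam m.+1 N f -> lb k ->
  (forall s, `|s| <= 3 * B ^+ 3 -> k s = 0) -> J f k = 0.
Proof.
move=> hf [mk _] k0; apply/eqP; rewrite -normr_le0.
have H s : `|s| <= 3 * B ^+ 3 -> `|k s| <= 0 by move=> /k0 ->; rewrite normr0.
by have := J_bound B1 (CC_adm B1 l0 hf) mk (lexx 0) H; rewrite mulr0 mul0r.
Qed.

Lemma J_kernel_ext m N f k k' : CC B lam m N f ->
  (forall s, `|s| <= 3 * B ^+ 3 -> k s = k' s) -> J f k = J f k'.
Proof.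
move=> hf E; apply: (J_ext (B := B)) => [u /andP[_ uB]|]; last exact: (proj1 hf).
by rewrite E//; exact: (F0_bound B1).
Qed.

Lemma lb_cst (a : R) : lb (fun=> a).
Proof. by apply: lb_cont; exact: cst_continuous. Qed.

Lemma quad_lin (b : R) : quad (fun s => s - b) (fun=> 1).
Proof.
move=> Y; exists 0 => // x h _ _.
by rewrite (_ : _ - _ - _ = 0) ?normr0 ?mul0r//; ring.
Qed.

Lemma quad_cst (a : R) : quad (fun=> a) (fun=> 0).
Proof.
move=> Y; exists 0 => // x h _ _.
by rewrite (_ : _ - _ - _ = 0) ?normr0 ?mul0r//; ring.
Qed.

(** For t above the range of F0 the kernel (F0 - t)_+ is 0. For t below it the kernel is affine in
    F0, and integrating by parts once for each of the two [Lop] differentiates it to 0. *)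
Lemma density_supp m N f t : CC B lam m.+4 N f -> 3 * B ^+ 3 <= `|t| -> U (Lop f) t = 0.
Proof.
move=> hf; have [N1 h1] := CC_Lop B1 Bl hf; have [N2 h2] := CC_Lop B1 Bl h1.
rewrite /U /A; have [t0|t0] := leP 0 t => ht.
  apply: (J_eq0 h2); first exact/lb_shift/lb_pos1.
  rewrite (ger0_norm t0) in ht.
  by move=> s /ler_normlP[_ sB]; rewrite /pos1 max_r//; lra.
rewrite (ltr0_norm t0) in ht.
rewrite (J_kernel_ext (k' := fun s => s - t) h2).
  rewrite (J_ibp_cont B1 Bl h1 (quad_lin t) (quad_cst 1)); last exact: cst_continuous.
  rewrite (J_ibp_cont B1 Bl hf (quad_cst 1) (quad_cst 0)); last exact: cst_continuous.
  by rewrite opprK; exact: (J_eq0 hf (lb_cst 0)).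
by move=> s /ler_normlP[sB _]; rewrite /pos1 max_l//; lra.
Qed.

(** On the support of the density the kernel is at most 6 B^3, and the box has volume (2B)^3. *)
Lemma density_bound m N f N2 t : CC B lam m.+4 N f -> CC B lam m.+2 N2 (Lop (Lop f)) ->
  `|U (Lop f) t| <= 48 * B ^+ 6 * N2.
Proof.
move=> hf h2; have N0 := CC_ge0 B1 h2.
have [tB|tB] := leP (3 * B ^+ 3) `|t|.
  by rewrite (density_supp hf tB) normr0 !mulr_ge0// exprn_ge0.
have H s : `|s| <= 3 * B ^+ 3 -> `|pos1 (s - t)| <= 6 * B ^+ 3.
  move=> sB; have := @pos1_lipschitz R (s - t) 0; rewrite {2}/pos1 maxxx !subr0 => h.
  by apply: le_trans h (le_trans (ler_normB _ _) _); lra.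
have M0 : 0 <= 6 * B ^+ 3 by rewrite mulr_ge0// exprn_ge0.
have [mk _] := lb_shift t (@lb_pos1 R).
apply: le_trans (J_bound B1 (CC_adm B1 l0 h2) mk M0 H) _.
by rewrite le_eqVlt; apply/orP; left; apply/eqP; ring.
Qed.

Definition shell t eps (s : R) : R := (`|s - t| <= eps)%R%:R.

Lemma shellE t eps s : 0 <= eps ->
  shell t eps s = 1 * above_eq (t - eps) s + (- 1) * above (t + eps) s.
Proof.
move=> e0; rewrite /shell /above_eq /above ler_distl.
case: (leP (t - eps) s) => h1; case: (leP s (t + eps)) => h2 /=.
- by rewrite mulr1 mulr0 addr0.
- by rewrite mulr1 mulN1r subrr.
- by rewrite !mulr0 addr0.
- by exfalso; lra.
Qed.

Lemma lb_shell t eps : 0 <= eps -> lb (shell t eps).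
Proof.
move=> e0; have := lb_lin 1 (-1) (lb_above_eq (t - eps)) (lb_above (t + eps)).
by congr lb; apply/funext => s; rewrite shellE.
Qed.

Lemma J_shell m N f t eps : CC B lam m.+3 N f -> 0 <= eps ->
  J f (shell t eps) = U f (t + eps) - U f (t - eps).
Proof.
move=> hf e0; rewrite (_ : shell t eps = fun s => 1 * above_eq (t - eps) s + (- 1) * above (t + eps) s).
  rewrite (J_lb_lin B1 Bl _ _ hf (lb_above_eq _) (lb_above _)).
  rewrite (J_above B1 Bl _ hf) (J_above_eq B1 Bl _ hf); ring.
by apply/funext => s; rewrite shellE.
Qed.

Lemma lb_cell h a : lb (\1_(cell h a) : R -> R).
Proof. by apply: lb_indic; exact: measurable_cell. Qed.

Lemma J_cell m N f h a : CC B lam m.+3 N f -> 0 < h ->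
  J f \1_(cell h a) = U f (h * (a + 1)%:~R) - U f (h * a%:~R).
Proof.
move=> hf h0.
rewrite (_ : \1_(cell h a) = fun s => 1 * above_eq (h * a%:~R) s + (- 1) * above_eq (h * (a + 1)%:~R) s).
  rewrite (J_lb_lin B1 Bl _ _ hf (lb_above_eq _) (lb_above_eq _)).
  rewrite !(J_above_eq B1 Bl _ hf); ring.
apply/funext => s; rewrite indicE /cell mem_setE in_itv/= /above_eq.
case: (leP (h * a%:~R) s) => h1; case: (leP (h * (a + 1)%:~R) s) => h2 /=.
- by rewrite mulr1 mulN1r subrr.
- by rewrite mulr1 mulr0 addr0.
- have : h * a%:~R < h * (a + 1)%:~R by rewrite ltr_pM2l// ltr_int ltrDl.
  by move=> h3; exfalso; lra.
- by rewrite !mulr0 addr0.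
Qed.

Lemma J_seq (I : Type) (r : seq I) m N f (c : I -> R) (k : I -> R -> R) : CC B lam m.+1 N f ->
  (forall i, lb (k i)) ->
  lb (fun s => \sum_(i <- r) c i * k i s) /\
  J f (fun s => \sum_(i <- r) c i * k i s) = \sum_(i <- r) c i * J f (k i).
Proof.
move=> hf hk; elim: r => [|i r [IH1 IH2]].
  rewrite (_ : (fun s => _) = fun=> 0); last by apply/funext => s; rewrite big_nil.
  by rewrite big_nil; split; [exact: lb_cst|exact: (J_eq0 hf (lb_cst 0))].
rewrite (_ : (fun s => _) = fun s => c i * k i s + 1 * (\sum_(j <- r) c j * k j s)); last first.
  by apply/funext => s; rewrite big_cons mul1r.
split; first exact: lb_lin.
by rewrite (J_lb_lin B1 Bl _ _ hf (hk i) IH1) IH2 big_cons mul1r.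
Qed.

(** The push-forward formula: the integral of f k(F0) is that of k against the density. On a cell of
    length h, k is constant up to O(h), and the mass of the cell is an increment of [U], so h times
    the density up to O(h^2). *)
Lemma J_total m N f k Lk M Psi : CC B lam m.+4 N f ->
  (forall x y, `|k x - k y| <= Lk * `|x - y|) -> (forall x, `|k x| <= M) ->
  bd1 1 M (3 * B ^+ 3) (fun t => k t * U (Lop f) t) ->
  (forall t : R, is_derive t 1 Psi (k t * U (Lop f) t)) ->
  forall T, 3 * B ^+ 3 < T -> J f k = Psi T - Psi (- T).
Proof.
move=> hf Lk1 kM hb D T hT.
have N0 := CC_ge0 B1 hf.
have M0 : 0 <= M by exact: le_trans (kM 0).
have Lk0 : 0 <= Lk by have := Lk1 1 0; rewrite subr0 normr1 mulr1; exact: le_trans.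
pose AA := 3 * B ^+ 3; have AA0 : 0 <= AA by rewrite mulr_ge0// exprn_ge0.
have [C C0 H] := quad_U B1 Bl hf (AA + 2).
have lk : lb k.
  apply: lb_cont => x; apply/cvgrPdist_le => e0 e00.
  near=> y; apply: le_trans (Lk1 _ _) _.
  have : `|x - y| <= e0 / (Lk + 1).
    near: y; apply: (@cvgrPdist_le _ _ _ (nbhs x) _ id x).1; first exact: cvg_id.
    by rewrite divr_gt0// ltr_wpDl.
  rewrite ler_pdivlMr ?ltr_wpDl// mulrC; apply: le_trans.
  by rewrite ler_wpM2r// lerDl.
apply/eqP; rewrite -subr_eq0 -normr_le0; apply/ler_addgt0Pr => del d0; rewrite add0r.
pose C1 := N * Lk * (2 * B) ^+ 3.
pose C2 := 2 * (AA + 1) * (M * C).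
pose C3 := 4 * (AA + 1) * M.
have C10 : 0 <= C1 by rewrite /C1 !mulr_ge0// exprn_ge0// mulr_ge0.
have C20 : 0 <= C2 by rewrite /C2 mulr_ge0 ?mulr_ge0// addr_ge0.
have C30 : 0 <= C3 by rewrite /C3 mulr_ge0 ?mulr_ge0// addr_ge0.
have [h [h0 h1 hC]] := small_step (addr_ge0 C10 (addr_ge0 C20 C30)) d0.
have hn := steps_gt h0 AA0; have hn2 := steps_le h0 AA0.
set n := steps h AA in hn hn2.
have hn3 : h * n%:R <= AA + 1 by apply: le_trans hn2 _; rewrite lerD2l.
pose kh s := \sum_(a <- zl n) k (h * a%:~R) * \1_(cell h a) s.
have [lkh Jkh] := J_seq (zl n) (fun a => k (h * a%:~R)) hf (fun a => lb_cell h a).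
rewrite -/kh in lkh Jkh.
have E1 : `|J f k - J f kh| <= C1 * h.
  have E : J f k - J f kh = J f (fun s => 1 * k s + (-1) * kh s).
    by rewrite (J_lb_lin B1 Bl _ _ hf lk lkh); ring.
  have [mm _] := lb_lin 1 (-1) lk lkh.
  rewrite E (_ : C1 * h = N * (Lk * h) * (2 * B) ^+ 3); last by rewrite /C1; ring.
  apply: (J_bound B1 (CC_adm B1 l0 hf) mm (mulr_ge0 Lk0 (ltW h0))) => s sB.
  rewrite mul1r mulN1r /kh sum_cell//; case: ifPn => [_|nz].
    by apply: le_trans (Lk1 _ _) _; rewrite ler_wpM2l//; exact: floor_dist.
  by exfalso; have := floor_out h0 hn nz; rewrite ltNge sB.
have E2 : `|J f kh - h * \sum_(a <- zl n) k (0 + h * a%:~R) * U (Lop f) (0 + h * a%:~R)| <= C2 * h.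
  rewrite Jkh mulr_sumr -sumrB.
  apply: le_trans (ler_norm_sum _ _ _) _.
  apply: (@le_trans _ _ (\sum_(a <- zl n) M * (C * h ^+ 2))).
    rewrite big_seq_cond [leRHS]big_seq_cond; apply: ler_sum => a /andP[az _].
    rewrite (J_cell _ hf h0) !add0r intrD [h * (_ + _)]mulrDr mulr1.
    have alg (p q r c : R) : c * (p - q) - h * (c * r) = c * (p - q - h * r) by ring.
    rewrite alg normrM; apply: ler_pM => //; apply: H; last by rewrite ger0_norm// ltW.
    rewrite normrM (ger0_norm (ltW h0)); apply: (@le_trans _ _ (h * n%:R)); last by lra.
    rewrite ler_wpM2l ?(ltW h0)//; move: az; rewrite mem_zl => /andP[a1 a2].
    rewrite ler_norml -[n%:R]/(n%:Z%:~R) -mulrNz !ler_int a1/=; exact: ltW.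
  rewrite big_const_seq count_predT size_zl iter_addr addr0 mulrnDr -[M * _ *+ n]mulr_natr.
  apply: (@le_trans _ _ (2 * (h * n%:R) * (M * C) * h)).
    by rewrite le_eqVlt; apply/orP; left; apply/eqP; ring.
  rewrite /C2; apply: ler_wpM2r; first exact: ltW.
  by apply: ler_wpM2r; [exact: mulr_ge0|rewrite ler_pM2l].
have c0 : 0 <= (0 : R) <= h by rewrite lexx ltW.
have E3 := lattice_sum1 D hb AA0 h0 hn c0.
have sphi t : k t * U (Lop f) t != 0 -> `|t| <= AA by case: hb => + _; apply.
rewrite (antiderivative_total D sphi hn hT) in E3.
apply: le_trans (ler_distD (J f kh) _ _) _.
apply: le_trans (lerD E1 (ler_distD (h * \sum_(a <- zl n) k (0 + h * a%:~R) * U (Lop f) (0 + h * a%:~R)) _ _)) _.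
apply: le_trans (lerD (lexx _) (lerD E2 E3)) _.
apply: le_trans hC; rewrite [leRHS]mulrDl lerD2l [leRHS]mulrDl lerD2l expr1 /C3 [leRHS]mulrC.
by rewrite ler_wpM2l ?(ltW h0)// ler_wpM2r// ler_pM2l.
Unshelve. all: by end_near.
Qed.

End DensityBounds.

(** * Derivatives of the density *)

Section Chains.
Context {R : realType}.
Implicit Types (f : 'rV[R]_3 -> R) (t : R).

Lemma bd1_add m M M' A (phi psi : R -> R) : bd1 m M A phi -> bd1 m M' A psi ->
  bd1 m (M + M') A (fun t => phi t + psi t).
Proof.
elim: m phi psi => [|m IH] phi psi [s1 h1] [s2 h2]; split.
- move=> t; have [/eqP ->|/s1//] := boolP (phi t == 0); rewrite add0r; exact: s2.
- by move=> t; rewrite (le_trans (ler_normD _ _))// lerD.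
- move=> t; have [/eqP ->|/s1//] := boolP (phi t == 0); rewrite add0r; exact: s2.
have [p1 [d1 b1]] := h1; have [p2 [d2 b2]] := h2.
exists (fun t => p1 t + p2 t); split; last exact: IH.
by move=> t; exact: is_deriveD_fun.
Qed.

(** Differentiating a product of two members of the chain gives two such products, so the induction
    runs over all pairs (i, j) at once. *)
Lemma bd1_chain (g : nat -> R -> R) (P l A : R) m n i j : 0 <= l ->
  (forall i t, (i <= m)%N -> `|g i t| <= P * l ^+ i) ->
  (forall i t, (i <= m)%N -> g i t != 0 -> `|t| <= A) ->
  (forall i t, (i < m)%N -> is_derive (t : R) 1 (g i) (g i.+1 t)) ->
  (i + n <= m)%N -> (j + n <= m)%N ->
  bd1 n (2 ^+ n * P ^+ 2 * l ^+ (n + i + j)) A (fun t => g i t * g j t).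
Proof.
move=> l0 bg sg dg; elim: n i j => [|n IH] i j im jm.
  rewrite !addn0 in im jm; split.
    by move=> t; rewrite mulf_eq0 negb_or => /andP[/(sg _ _ im)].
  move=> t; rewrite normrM (_ : _ * _ = (P * l ^+ i) * (P * l ^+ j)).
    by apply: ler_pM => //; exact: bg.
  by rewrite exprD; ring.
split.
  move=> t; rewrite mulf_eq0 negb_or => /andP[h _]; apply: sg h.
  exact: leq_trans (leq_addr _ _) im.
exists (fun t => g i.+1 t * g j t + g i t * g j.+1 t); split.
  move=> t; have di : is_derive t 1 (g i) (g i.+1 t) by apply: dg; lia.
  have dj : is_derive t 1 (g j) (g j.+1 t) by apply: dg; lia.
  rewrite [X in _ + X]mulrC addrC [X in _ + X]mulrC [X in X + _]mulrC; exact: is_deriveM_fun.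
rewrite (_ : 2 ^+ n.+1 * P ^+ 2 * l ^+ (n.+1 + i + j) =
  2 ^+ n * P ^+ 2 * l ^+ (n + i.+1 + j) + 2 ^+ n * P ^+ 2 * l ^+ (n + i + j.+1)).
  by apply: bd1_add; apply: IH; lia.
by rewrite addnS addSn addnS addSn exprS; ring.
Qed.

(** The j-th derivative of the density g of the overview. *)
Definition dens f j : R -> R := U (Lop (iter j (@Lop R) f)).

(** Each further derivative is one more [Lop], at the cost lam B^6. At most m + 2 applications
    occur, and the surplus 7 leaves the orders of smoothness that are still asked for afterwards. *)
Lemma density_chain m : exists2 c : R, 0 <= c & forall (B lam N : R) f,
  1 <= B -> B ^+ 7 <= lam -> CC B lam (m + 7) N f ->
  let P := c * (B ^+ 6 * (lam * B ^+ 6) ^+ 2 * N) in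
  let l := lam * B ^+ 6 in
  [/\ 0 <= P, forall j t, (j <= m)%N -> `|dens f j t| <= P * l ^+ j,
      forall j t, (j <= m)%N -> dens f j t != 0 -> `|t| <= 3 * B ^+ 3 &
      forall j, (j <= m)%N -> quad (dens f j) (dens f j.+1)].
Proof.
have [c c0 H] := @CC_iterL_le R (m + 7).
exists (48 * c); first exact: mulr_ge0.
move=> B lam N f B1 Bl hf P l.
have B0 : 0 <= B by exact: le_trans B1.
have l0 : 0 <= lam by apply: (le_trans _ Bl); rewrite exprn_ge0.
have N0 := CC_ge0 B1 hf.
have hC j (jm : (j <= m + 7)%N) := H j jm B lam N f B1 Bl hf.
have C4 j : (j <= m)%N -> CC B lam 4 (c * l ^+ j * N) (iter j (@Lop R) f).
  by move=> jm; apply: (CC_leK _ (hC j _)); lia.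
split.
- by rewrite /P !mulr_ge0// ?exprn_ge0// ?mulr_ge0// exprn_ge0.
- move=> j t jm.
  have C2 : CC B lam 2 (c * l ^+ j.+2 * N) (Lop (Lop (iter j (@Lop R) f))).
    by apply: (CC_leK _ (hC j.+2 _)); lia.
  apply: le_trans (density_bound B1 Bl t (C4 j jm) C2) _.
  rewrite /P -/l le_eqVlt; apply/orP; left; apply/eqP.
  rewrite (exprD l 2 j : l ^+ j.+2 = _).
  by ring.
- move=> j t jm; apply: contraNT; rewrite -ltNge => /ltW ht; apply/eqP.
  exact: (density_supp B1 Bl (C4 j jm) ht).
- move=> j jm.
  have C5 : CC B lam 4 (c * l ^+ j.+1 * N) (Lop (iter j (@Lop R) f)).
    by apply: (CC_leK _ (hC j.+1 _)); lia.
  exact: (quad_U B1 Bl C5).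
Qed.

(** A derivative of the density costs B^7 B^6 = B^13, and the chain rule through F0 adds B^2, giving
    B^15. The size is N times B^6 (B^13)^2 N. *)
Lemma density_weight m : exists2 c : R, 0 <= c & forall (B N : R) f,
  1 <= B -> CC B (B ^+ 7) (m + 7) N f ->
  CC B (B ^+ 15) m (c * (B ^+ 32 * N ^+ 2)) (fun u => f u * dens f 0 (F0 u)).
Proof.
have [c c0 H] := density_chain m; have [c' c0' H'] := @Mu_compF0 R m.
exists (2 ^+ m * (c' * c)); first by rewrite !mulr_ge0// exprn_ge0.
move=> B N f B1 hf.
have B0 : 0 <= B by exact: le_trans B1.
have [P0 bP _ qP] := H B (B ^+ 7) N f B1 (lexx _) hf.
have E6 : B ^+ 7 * B ^+ 6 = B ^+ 13 by rewrite -exprD.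
rewrite E6 in P0 bP; set P := c * _ in P0 bP.
have hG : Mu B (B ^+ 15) m (c' * P) (fun u => dens f 0 (F0 u)).
  apply: (H' B (B ^+ 15) (B ^+ 13) P (dens f)) => //.
  - by rewrite exprn_ge0.
  - by rewrite exprn_ege1.
  - by rewrite -exprD.
  - by move=> j /qP; exact: quad_cont.
  - by move=> j t jm; exact: (quad_derive (qP j (ltnW jm))).
  - by move=> j t jm _; exact: bP.
have hf' : CC B (B ^+ 15) m N f.
  apply: (CC_lam B1 _ (CC_leK _ hf)); last by rewrite leq_addr.
  by rewrite exprn_ge0//= ler_weXn2l.
have := CC_mul B1 (exprn_ge0 15 B0) hf' hG; congr CC.
have -> : B ^+ 32 = B ^+ 6 * (B ^+ 13) ^+ 2 by rewrite -exprM -exprD.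
by rewrite /P; ring.
Qed.

(** The integral of g^2 that the sum approximates is [J f g], by the push-forward formula with k =
    g. The exponent 64 is twice 6 + 26, and each derivative of g^2 adds 13. *)
Lemma density_square_lattice m : exists2 c : R, 0 <= c & forall (B N h x : R) f (n : nat),
  1 <= B -> CC B (B ^+ 7) (m + 8) N f ->
  0 < h -> 3 * B ^+ 3 < h * n%:R -> 0 <= x <= h ->
  `|h * (\sum_(a <- zl n) dens f 0 (x + h * a%:~R) ^+ 2) - J f (dens f 0)|
  <= h ^+ m * (4 * (h * n%:R) * (c * (B ^+ (64 + 13 * m) * N ^+ 2))).
Proof.
have [c c0 H] := density_chain m.+1.
exists (2 ^+ m * c ^+ 2); first by rewrite mulr_ge0// exprn_ge0.
move=> B N h x f n B1 hf h0 hn hx.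
have B0 : 0 <= B by exact: le_trans B1.
have hf' : CC B (B ^+ 7) (m.+1 + 7) N f by rewrite addSnnS.
have [P0 bP sP qP] := H B (B ^+ 7) N f B1 (lexx _) hf'.
have E6 : B ^+ 7 * B ^+ 6 = B ^+ 13 by rewrite -exprD.
rewrite E6 in P0 bP; set P := c * _ in P0 bP.
have l0 : 0 <= B ^+ 13 by rewrite exprn_ge0.
have dP i t : (i < m.+1)%N -> is_derive (t : R) 1 (dens f i) (dens f i.+1 t).
  by move=> im; exact: quad_derive (qP i (ltnW im)) t.
pose phi t := dens f 0 t * dens f 0 t.
have hb : bd1 m (2 ^+ m * P ^+ 2 * (B ^+ 13) ^+ (m + 0 + 0)) (3 * B ^+ 3) phi.
  by apply: (bd1_chain (m := m.+1)) => //; lia.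
have hb1 : bd1 1 (2 ^+ 1 * P ^+ 2 * (B ^+ 13) ^+ (1 + 0 + 0)) (3 * B ^+ 3) phi.
  by apply: (bd1_chain (m := m.+1)) => //; lia.
have bphi t : `|phi t| <= P * P.
  by rewrite normrM; apply: ler_pM => //; have := bP 0%N t (leq0n _); rewrite expr0 mulr1.
have sphi t : phi t != 0 -> `|t| <= 3 * B ^+ 3 by case: hb1 => + _; apply.
have dphi (t : R) : is_derive t 1 phi (dens f 0 t * dens f 1 t + dens f 0 t * dens f 1 t).
  by apply: is_deriveM_fun; exact: dP.
have cphi : continuous phi.
  by move=> t; apply: differentiable_continuous; apply/derivable1_diffP; case: (dphi t).
have [Psi DPsi] := antiderivative cphi bphi sphi.
have hf4 : CC B (B ^+ 7) 4 N f by apply: (CC_leK _ hf); exact: leq_trans (leq_addl m 8).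
have lip y z : `|dens f 0 y - dens f 0 z| <= P * B ^+ 13 * `|y - z|.
  have hlt (a b : R) : a < b -> `|dens f 0 b - dens f 0 a| <= P * B ^+ 13 * `|b - a|.
    move=> ab; have [r _ ->] := MVT_real ab (fun t => dP 0%N t isT).
    by rewrite normrM ler_wpM2r//; have := bP 1%N r isT; rewrite expr1.
  case: (ltgtP y z) => [yz|yz|->]; last by rewrite subrr normr0 mulr_ge0// mulr_ge0.
    by rewrite distrC [`|y - z|]distrC; exact: hlt.
  exact: hlt.
pose M := P + 2 ^+ 1 * P ^+ 2 * (B ^+ 13) ^+ (1 + 0 + 0).
have M1 : P <= M by rewrite lerDl; apply: mulr_ge0; [apply: mulr_ge0; exact: exprn_ge0|exact: exprn_ge0].
have M2 : 2 ^+ 1 * P ^+ 2 * (B ^+ 13) ^+ (1 + 0 + 0) <= M by rewrite lerDr.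
have hbM : bd1 1 M (3 * B ^+ 3) phi.
  case: hb1 => s1 [p [dp [s2 b2]]]; split=> //; exists p; split=> //; split=> // t.
  exact: le_trans (b2 t) M2.
have bM t : `|dens f 0 t| <= M.
  by apply: le_trans M1; have := bP 0%N t (leq0n _); rewrite expr0 mulr1.
rewrite (J_total B1 (lexx _) hf4 lip bM hbM DPsi hn).
have := lattice_sum1 DPsi hb (mulr_ge0 (ler0n _ _) (exprn_ge0 3 B0)) h0 hn hx.
congr (_ <= _); last first.
  congr (_ * (_ * _)); rewrite !addn0 -exprM exprD /P.
  have -> : B ^+ 64 = (B ^+ 6 * (B ^+ 13) ^+ 2) ^+ 2 by rewrite -exprM -exprD -exprM.
  by ring.
Qed.

End Chains.

Section BoundedFubini.
Context {R : realType} {d1 d2 : measure_display}.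
Context {T1 : measurableType d1} {T2 : measurableType d2}.
Variables (m1 : {sigma_finite_measure set T1 -> \bar R}).
Variables (m2 : {sigma_finite_measure set T2 -> \bar R}).
Variables (E1 : set T1) (E2 : set T2).
Hypotheses (mE1 : measurable E1) (mE2 : measurable E2).
Hypotheses (fE1 : (m1 E1 < +oo)%E) (fE2 : (m2 E2 < +oo)%E).

Lemma adm_Fubini M (f : T1 * T2 -> R) : adm (E1 `*` E2) M f ->
  \int[(m1 \x m2)%E]_z f z = \int[m1]_x \int[m2]_y f (x, y).
Proof.
move=> hf; have mE : measurable (E1 `*` E2) by exact: measurableX.
have fE : ((m1 \x m2)%E (E1 `*` E2) < +oo)%E.
  rewrite product_measure1E//; apply: lte_mul_pinfty => //.
  by rewrite ge0_fin_numE.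
have hi := adm_integrable mE fE hf.
rewrite /Rintegral -(integral12_prod_meas1 hi) /fubini_F; congr fine.
apply: eq_integral => x _ /=.
have [mf fM f0] := hf.
have hx : adm E2 M (fun y => f (x, y)).
  split.
  - by apply: measurableT_comp => //; exact: measurable_pair1.
  - by move=> y; exact: fM.
  - by move=> y nE; apply: f0 => -[].
rewrite fineK//; have := integrable_fin_num measurableT (adm_integrable mE2 fE2 hx); exact.
Qed.

End BoundedFubini.

(** * The limits defining the real densities *)

Section SingularIntegrals.
Context {R : realType}.
Local Notation V := 'rV[R]_3.
Local Notation RB := (measurableTypeR R).
Local Notation RB3 := (RB * RB * RB)%type.
Implicit Types (f : V -> R) (t : R).

Lemma lim_right0 (phi : R -> R) (C L : R) : 0 <= C ->
  (forall eps, 0 < eps -> eps <= 1 -> `|phi eps - L| <= C * eps) ->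
  lim (phi @ 0^'+) = L.
Proof.
move=> C0 H; apply: cvg_lim => //; apply/cvgrPdist_le => e0 e00.
near=> eps.
have p0 : 0 < eps by near: eps; exact: nbhs_right_gt.
have p1 : eps <= Num.min 1 (e0 / (C + 1)).
  near: eps; apply: nbhs_right_le; by rewrite lt_min ltr01 divr_gt0// ltr_wpDl.
move: p1; rewrite le_min => /andP[p1]; rewrite ler_pdivlMr ?ltr_wpDl// => p2.
rewrite distrC; apply: le_trans (H _ p0 p1) _; apply: le_trans p2.
by rewrite mulrC ler_wpM2l ?(ltW p0)// lerDl.
Unshelve. all: by end_near.
Qed.

Variables (B lam : R).
Hypotheses (B1 : 1 <= B) (Bl : B ^+ 7 <= lam).
Let B0 : 0 < B := B_gt0 B1.
Let B00 : 0 <= B := ltW B0.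
Let l1 : 1 <= lam.
Proof. by apply: (le_trans _ Bl); rewrite exprn_ege1. Qed.
Let l0 : 0 <= lam := le_trans ler01 l1.

Lemma shell_quad (G' : R) (u0 u1 u2 eps C : R) : 0 < eps ->
  `|u1 - u0 - eps * G'| <= C * eps ^+ 2 -> `|u2 - u0 - (- eps) * G'| <= C * (- eps) ^+ 2 ->
  `|(2 * eps)^-1 * (u1 - u2) - G'| <= C * eps.
Proof.
move=> e0; rewrite sqrrN => h1 h2.
rewrite (_ : _ - G' = (2 * eps)^-1 * ((u1 - u0 - eps * G') - (u2 - u0 - (- eps) * G'))); last first.
  by field; exact: lt0r_neq0.
rewrite normrM ger0_norm ?invr_ge0 ?mulr_ge0 ?(ltW e0)//.
rewrite ler_pdivrMl ?mulr_gt0//; apply: le_trans (ler_normB _ _) _.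
by apply: le_trans (lerD h1 h2) _; rewrite le_eqVlt; apply/orP; left; apply/eqP; ring.
Qed.

(** The shell integral is an increment of [U] over length 2 eps, and the symmetric difference
    quotient tends to the density. *)
Lemma sigma_inf_aE m N f (a X : R) : CC B lam m.+4 N f ->
  sigma_inf_a a f X = dens f 0 (a / X ^+ 3).
Proof.
move=> hf; set t := a / X ^+ 3.
have [C C0 H] := quad_U B1 Bl hf `|t|.
apply: (lim_right0 C0) => eps e0 e1.
rewrite (_ : Rintegral _ _ _ = U f (t + eps) - U f (t - eps)); last first.
  rewrite -(J_shell B1 Bl _ hf (ltW e0)) Rintegral_mkcond; apply: eq_Rintegral => x _.
  rewrite patchE /shell; case: ifPn => [/set_mem/= ->|/negP h]; first by rewrite mulr1.
  rewrite (_ : (_ <= _) = false) ?mulr0//; apply/negP => q; apply: h; exact: mem_set.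
apply: (shell_quad e0).
  by apply: H => //; rewrite ger0_norm// ltW.
by apply: H => //; rewrite normrN ger0_norm// ltW.
Qed.

(** Integrating over the second point first leaves a shell integral around the value of F0 at the
    first. Its quotient by 2 eps tends to the density uniformly on the range of F0, so the limit
    passes under the outer integral. *)
Lemma sigma_infE m N f : CC B lam m.+1.+4 N f ->
  sigma_inf (tensor2 f) = J f (dens f 0).
Proof.
move=> hf; have N0 := CC_ge0 B1 hf.
have [C C0 H] := quad_U B1 Bl hf (3 * B ^+ 3).
have aU t : lb (fun s => U f (s + t)).
  have := lb_shift (- t) (lb_cont (quad_cont (quad_U B1 Bl hf))).
  by congr lb; apply/funext => s; rewrite opprK.
have [N1 h1] := CC_Lop B1 Bl hf.
have lG : lb (dens f 0) by apply: lb_cont; exact: quad_cont (quad_U B1 Bl h1).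
apply: (@lim_right0 _ (N * C * (2 * B) ^+ 3)) => [|eps e0 e1].
  by rewrite !mulr_ge0// exprn_ge0// mulr_ge0.
have E : Rintegral (@lebesgue6 R) [set x | `|F (row3 x.1, row3 x.2)| <= eps]
    (fun x => tensor2 f (row3 x.1, row3 x.2)) =
    J f (fun s => 1 * U f (s + eps) + (- 1) * U f (s - eps)).
  rewrite Rintegral_mkcond.
  pose g (z : RB3 * RB3) := f (row3 z.1) * (f (row3 z.2) * shell 0 eps (F0 (row3 z.2) - F0 (row3 z.1))).
  have af := CC_adm B1 l0 hf.
  have [ms _] := lb_shell 0 (ltW e0).
  have ag : adm (box B `*` box B) (N * N) g.
    split.
    - apply: measurable_funM.
        have [ma _ _] := af; exact: (measurableT_comp ma measurable_fst).
      apply: measurable_funM; first by have [ma _ _] := af; exact: (measurableT_comp ma measurable_snd).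
      apply: (measurableT_comp ms); apply: measurable_funB.
        exact: measurableT_comp measurable_F0row measurable_snd.
      exact: measurableT_comp measurable_F0row measurable_fst.
    - move=> z; rewrite /g normrM ler_pM//; first by case: af.
      rewrite normrM -[leRHS]mulr1 ler_pM//; first by case: af.
      exact: norm_nat_bool.
    - move=> z nE; rewrite /g; have [_ _ a0] := af.
      have [b1|b1] := pselect (box B z.1); last by rewrite (a0 _ b1) mul0r.
      have [b2|b2] := pselect (box B z.2); last by rewrite (a0 _ b2) mul0r mulr0.
      by exfalso; apply: nE.
  have mB := @measurable_box R B; have fB := lebesgue3_box_fin B00.
  have := adm_Fubini mB mB fB fB ag.
  rewrite /J /I3 => Fub; transitivity (\int[(@lebesgue3 R \x @lebesgue3 R)%E]_z g z).
    apply: eq_Rintegral => z _; rewrite patchE /g /tensor2 /= /shell subr0 distrC.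
    case: ifPn => [/set_mem/= |/negP h]; first by rewrite /F/= => ->; rewrite mulr1.
    rewrite (_ : (_ <= _) = false) ?mulr0//; apply/negP => q; apply: h; exact: mem_set.
  rewrite Fub; apply: eq_Rintegral => x _.
  rewrite /g /=.
  have E1 : J f (shell (F0 (row3 x)) eps) = U f (F0 (row3 x) + eps) - U f (F0 (row3 x) - eps).
    exact: (J_shell B1 Bl _ hf (ltW e0)).
  rewrite mul1r mulN1r -E1 /J /I3.
  have [mk _] := lb_shell (F0 (row3 x)) (ltW e0).
  have ad := J_adm B1 af mk ler01 (fun s _ => norm_nat_bool _).
  rewrite -(adm3_integralZ (f (row3 x)) B00 ad).
  by apply: eq_Rintegral => y _; rewrite /shell subr0.
rewrite E.
have lE := lb_lin 1 (-1) (aU eps) (aU (- eps)).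
rewrite (_ : _ - _ = J f (fun s => (2 * eps)^-1 * (1 * U f (s + eps) + (- 1) * U f (s - eps)) + (-1) * dens f 0 s)); last first.
  by rewrite (J_lb_lin B1 Bl _ _ hf lE lG) mulN1r.
have [mm _] := lb_lin (2 * eps)^-1 (-1) lE lG.
rewrite (_ : N * C * _ * eps = N * (C * eps) * (2 * B) ^+ 3); last by ring.
apply: (J_bound B1 (CC_adm B1 l0 hf) mm (mulr_ge0 C0 (ltW e0))) => s sB.
rewrite mul1r !mulN1r; apply: (shell_quad (u0 := U f s) e0).
  by apply: H => //; rewrite ger0_norm// ltW.
by apply: H => //; rewrite normrN ger0_norm// ltW.
Qed.

End SingularIntegrals.

(** * Expansion of the variance *)

Section LatticeSumsMod.
Context {V : nmodType}.

Lemma sum_zl (n : nat) (f : int -> V) :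
  \sum_(a <- zl n) f a = \sum_(y < n + n) f ((y : nat)%:Z - n%:Z).
Proof. by rewrite /zl big_map -(big_mkord xpredT (fun y : nat => f (y%:Z - n%:Z))) /index_iota subn0. Qed.

Lemma zl_blocks (q n : nat) (f : int -> V) : (0 < q)%N ->
  \sum_(a <- zl (q * n)) f a = \sum_(r < q) \sum_(t <- zl n) f ((r : nat)%:Z + q%:Z * t).
Proof.
move=> q0; case: n => [|n].
  rewrite muln0 sum_zl big_ord0 big1// => r _; by rewrite sum_zl big_ord0.
rewrite sum_zl -mulnDr (sum_blocks (fun a => f (a - (q * n.+1)%N%:Z)))//.
apply: eq_bigr => r _; rewrite sum_zl; apply: eq_bigr => t _; congr f.
by rewrite PoszM mulrBr addrA.
Qed.

Lemma zl_widen (m n : nat) (f : int -> V) : (m <= n)%N ->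
  (forall a, a \notin zl m -> f a = 0) -> \sum_(a <- zl n) f a = \sum_(a <- zl m) f a.
Proof.
move=> mn f0; rewrite (bigID (mem (zl m)))/= [X in _ + X]big1 ?addr0; last by move=> a; exact: f0.
rewrite -big_filter; apply: perm_big; apply: uniq_perm; rewrite ?filter_uniq ?zl_uniq//.
move=> a; rewrite mem_filter; case: (boolP (a \in zl m)) => //=.
by rewrite !mem_zl; lia.
Qed.

Definition Z3 (n : nat) (f : 'rV[int]_3 -> V) : V :=
  \sum_(a <- zl n) \sum_(b <- zl n) \sum_(c <- zl n) f (mk3 a b c).

Lemma eq_Z3 n f g : f =1 g -> Z3 n f = Z3 n g.
Proof.
by move=> E; apply: eq_bigr => a _; apply: eq_bigr => b _; apply: eq_bigr => c _; exact: E.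
Qed.

Lemma Z3_widen (m n : nat) (f : 'rV[int]_3 -> V) : (m <= n)%N ->
  (forall a b c, f (mk3 a b c) != 0 -> [/\ a \in zl m, b \in zl m & c \in zl m]) ->
  Z3 n f = Z3 m f.
Proof.
move=> mn f0.
have z a b c : [|| a \notin zl m, b \notin zl m | c \notin zl m] -> f (mk3 a b c) = 0.
  move=> h; apply/eqP; apply: contraTT h => /f0[-> -> ->]//.
rewrite /Z3 (zl_widen mn) => [|a am].
  apply: eq_bigr => a _; rewrite (zl_widen mn) => [|b bm].
    by apply: eq_bigr => b _; apply: zl_widen => // c cm; rewrite z// cm !orbT.
  by rewrite big1// => c _; rewrite z// bm orbT.
by rewrite big1// => b _; rewrite big1// => c _; rewrite z// am.
Qed.

Definition sum3 (q : nat) (f : 'rV[int]_3 -> V) : V :=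
  \sum_(r < q) \sum_(s < q) \sum_(t < q) f (mk3 (r : nat)%:Z (s : nat)%:Z (t : nat)%:Z).

Lemma Z3_blocks (q n : nat) (f : 'rV[int]_3 -> V) : (0 < q)%N ->
  Z3 (q * n) f = sum3 q (fun r => Z3 n (fun y => f (mk3 (r 0 0 + q%:Z * y 0 0)
     (r 0 1 + q%:Z * y 0 1) (r 0 2 + q%:Z * y 0 2)))).
Proof.
move=> q0; rewrite /Z3 /sum3 zl_blocks//; apply: eq_bigr => r _.
transitivity (\sum_(t <- zl n) \sum_(r2 < q) \sum_(t2 <- zl n) \sum_(r3 < q) \sum_(t3 <- zl n)
    f (mk3 ((r : nat)%:Z + q%:Z * t) ((r2 : nat)%:Z + q%:Z * t2) ((r3 : nat)%:Z + q%:Z * t3))).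
  by apply: eq_bigr => t _; rewrite zl_blocks//; apply: eq_bigr => r2 _; apply: eq_bigr => t2 _; rewrite zl_blocks.
rewrite exchange_big; apply: eq_bigr => r2 _.
transitivity (\sum_(t <- zl n) \sum_(r3 < q) \sum_(t2 <- zl n) \sum_(t3 <- zl n)
    f (mk3 ((r : nat)%:Z + q%:Z * t) ((r2 : nat)%:Z + q%:Z * t2) ((r3 : nat)%:Z + q%:Z * t3))).
  by apply: eq_bigr => t _; rewrite exchange_big.
rewrite exchange_big; apply: eq_bigr => r3 _.
apply: eq_bigr => t _; apply: eq_bigr => t2 _; apply: eq_bigr => t3 _.
by rewrite !mxE !(tnth_nth 0).
Qed.

Definition mod_periodic3 (q : nat) (f : 'rV[int]_3 -> V) :=
  forall y z : 'rV[int]_3, (forall i, (q%:Z %| (y 0 i - z 0 i)%R)%Z) -> f y = f z.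

Lemma mod_periodic3_mk3 q f a b c a' b' c' : mod_periodic3 q f ->
  (q%:Z %| a - a')%Z -> (q%:Z %| b - b')%Z -> (q%:Z %| c - c')%Z ->
  f (mk3 a b c) = f (mk3 a' b' c').
Proof.
move=> pf ha hb hc; apply: pf => i; rewrite !mxE.
by case: i => -[|[|[|//]]] hi; rewrite !(tnth_nth 0).
Qed.

Lemma sum3_multiple (q k : nat) f : (0 < q)%N -> (0 < k)%N -> mod_periodic3 q f ->
  sum3 (q * k) f = sum3 q f *+ (k ^ 3).
Proof.
move=> q0 k0 pf; rewrite /sum3.
have p1 a b : mod_periodic q (fun c => f (mk3 a b c)).
  by move=> c c' cc /=; apply: (mod_periodic3_mk3 pf); rewrite ?subrr ?dvdz0.
have p2 a (n : nat) : mod_periodic q (fun b => \sum_(t < n) f (mk3 a b (t : nat)%:Z)).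
  move=> c c' cc /=; apply: eq_bigr => t _.
  by apply: (mod_periodic3_mk3 pf); rewrite ?subrr ?dvdz0.
have p3 (n : nat) : mod_periodic q (fun a => \sum_(s < n) \sum_(t < n) f (mk3 a (s : nat)%:Z (t : nat)%:Z)).
  move=> c c' cc /=; apply: eq_bigr => s _; apply: eq_bigr => t _.
  by apply: (mod_periodic3_mk3 pf); rewrite ?subrr ?dvdz0.
rewrite (sum_multiple_period q0 k0 (p3 (q * k)%N)).
transitivity ((\sum_(r < q) \sum_(s < q) \sum_(t < q)
    f (mk3 (r : nat)%:Z (s : nat)%:Z (t : nat)%:Z)) *+ k *+ k *+ k); last first.
  by rewrite -!mulrnA !expnS expn0 muln1 mulnA.
congr (_ *+ _); rewrite -2!sumrMnl; apply: eq_bigr => r _.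
rewrite (sum_multiple_period q0 k0 (p2 (r : nat)%:Z (q * k)%N)).
congr (_ *+ _); rewrite -sumrMnl; apply: eq_bigr => s _.
exact: (sum_multiple_period q0 k0 (p1 (r : nat)%:Z (s : nat)%:Z)).
Qed.

End LatticeSumsMod.

Section WeightedSums.
Context {R : realType}.
Implicit Types (phi : int -> R[i]) (f : 'rV[R]_3 -> R).

(** The mean over a full period may be taken over any multiple of it; this moves all moduli q to the
    common D. *)
Lemma average_multiple3 (q D : nat) (phi : 'rV[int]_3 -> R[i]) : (0 < q)%N -> (0 < D)%N ->
  (q %| D)%N -> mod_periodic3 q phi ->
  q%:R ^- 3 * sum3 q phi = D%:R ^- 3 * sum3 D phi.
Proof.
move=> q0 D0 /dvdnP[k DE] pf; rewrite DE mulnC in D0 *.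
have k0 : (0 < k)%N by move: D0; rewrite muln_gt0 => /andP[].
rewrite (sum3_multiple q0 k0 pf) -[sum3 q phi *+ _]mulr_natr natrX natrM.
by field; rewrite !pnatr_eq0 -!lt0n ?q0 ?k0.
Qed.

Lemma average_multiple (q D : nat) phi : (0 < q)%N -> (0 < D)%N ->
  (q %| D)%N -> mod_periodic q phi ->
  q%:R^-1 * (\sum_(r < q) phi (r : nat)%:Z) = D%:R^-1 * (\sum_(r < D) phi (r : nat)%:Z).
Proof.
move=> q0 D0 /dvdnP[k DE] pf; rewrite DE mulnC in D0 *.
have k0 : (0 < k)%N by move: D0; rewrite muln_gt0 => /andP[].
rewrite (sum_multiple_period q0 k0 pf) -[(\sum_(_ < _) _) *+ _]mulr_natr natrM.
by field; rewrite !pnatr_eq0 -!lt0n ?q0 ?k0.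
Qed.

Lemma cabs_sum_le (I : Type) (r : seq I) (P : pred I) (F : I -> R[i]) (G : I -> R) :
  (forall i, P i -> cabs (F i) <= G i) -> cabs (\sum_(i <- r | P i) F i) <= \sum_(i <- r | P i) G i.
Proof. by move=> H; apply: le_trans (cabs_sum _ _ _) _; exact: ler_sum. Qed.

(** On the class of r mod q the periodic factor is constant, and what remains is a Riemann sum of
    mesh q/X with offset r/X. *)
Lemma weighted_sum1 (q n : nat) (X S E : R) phi (g : R -> R) : (0 < q)%N -> 0 < X ->
  mod_periodic q phi -> (forall a, cabs (phi a) <= 1) ->
  (forall x, 0 <= x <= q%:R / X ->
     `|q%:R / X * (\sum_(t <- zl n) g (x + q%:R / X * t%:~R)) - S| <= E) ->
  cabs (\sum_(a <- zl (q * n)) phi a * (g (a%:~R / X))%:C -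
        (X * S)%:C * (q%:R^-1 * \sum_(r < q) phi (r : nat)%:Z)) <= X * E.
Proof.
move=> q0 X0 pphi bphi hg.
have qR : 0 < q%:R :> R by rewrite ltr0n.
have h0 : 0 < q%:R / X by rewrite divr_gt0.
rewrite zl_blocks// !mulr_sumr -sumrB.
apply: (@le_trans _ _ (\sum_(r < q) X / q%:R * E)); last first.
  rewrite sumr_const card_ord -[(_ * E) *+ _]mulr_natr le_eqVlt; apply/orP; left; apply/eqP.
  by field; exact: lt0r_neq0.
apply: cabs_sum_le => r _.
have -> : \sum_(t <- zl n) phi ((r : nat)%:Z + q%:Z * t) * (g (((r : nat)%:Z + q%:Z * t)%:~R / X))%:C =
    phi (r : nat)%:Z * (\sum_(t <- zl n) g ((r : nat)%:R / X + q%:R / X * t%:~R))%:C.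
  rewrite rmorph_sum/= mulr_sumr; apply: eq_bigr => t _; congr (_ * (g _)%:C).
    by apply: pphi; rewrite addrAC subrr add0r dvdz_mulr.
  by rewrite intrD intrM mulrDl [q%:~R * _ * _]mulrAC.
set T := \sum_(t <- zl n) _.
have -> : phi (r : nat)%:Z * T%:C - (X * S)%:C * (q%:R^-1 * phi (r : nat)%:Z) =
    phi (r : nat)%:Z * (X / q%:R * (q%:R / X * T - S))%:C.
  rewrite (_ : X / q%:R * (q%:R / X * T - S) = T - q%:R^-1 * (X * S)); last first.
    by field; rewrite !lt0r_neq0.
  rewrite rmorphB/= mulrBr; congr (_ - _).
  by rewrite [in RHS]rmorphM/= fmorphV/= rmorph_nat; ring.
rewrite cabsM cabs_real normrM (ger0_norm (ltW (divr_gt0 X0 qR))).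
rewrite -[leRHS]mul1r; apply: ler_pM => //.
- exact: cabs_ge0.
- by rewrite mulr_ge0// ltW// divr_gt0.
rewrite ler_wpM2l ?(ltW (divr_gt0 X0 qR))//; apply: hg.
rewrite divr_ge0 ?(ltW X0)//= ler_wpM2r ?invr_ge0 ?(ltW X0)// ler_nat; exact: ltnW (ltn_ord r).
Qed.

Lemma weighted_sum3 (B lam : R) m N f (q n : nat) (X : R) (phi : 'rV[int]_3 -> R[i]) :
  1 <= B -> 0 <= lam -> CC B lam m.+1 N f -> (0 < q)%N -> 0 < X ->
  B < q%:R / X * n%:R -> q%:R / X * n%:R <= B + 2 ->
  mod_periodic3 q phi -> (forall y, cabs (phi y) <= 1) ->
  cabs (Z3 (q * n) (fun y => phi y * (f (scale X y))%:C) -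
        (X ^+ 3 * I3 f)%:C * (q%:R ^- 3 * sum3 q phi)) <=
  X ^+ 3 * (48 * (B + 2) ^+ 3 * (lam ^+ m.+1 * N) * (q%:R / X) ^+ m.+1).
Proof.
move=> B1 l0 hf q0 X0 hn hn2 pphi bphi; set h := q%:R / X; set E := _ * h ^+ _.
have qR : 0 < q%:R :> R by rewrite ltr0n.
have h0 : 0 < h by rewrite divr_gt0.
rewrite Z3_blocks// /sum3 !mulr_sumr -sumrB.
have E3 : X ^+ 3 * E = \sum_(r < q) \sum_(s < q) \sum_(t < q) (h ^- 3 * E).
  rewrite !sumr_const !card_ord -!mulrnA -[(_ * E) *+ _]mulr_natr !natrM /h.
  by field; rewrite !lt0r_neq0.
rewrite E3; apply: cabs_sum_le => r _; rewrite !mulr_sumr -sumrB; apply: cabs_sum_le => s _.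
rewrite !mulr_sumr -sumrB; apply: cabs_sum_le => t _.
set P := phi (mk3 (r : nat)%:Z (s : nat)%:Z (t : nat)%:Z).
rewrite !mxE !(tnth_nth 0)/=.
set T := S3 h n ((r : nat)%:R / X) ((s : nat)%:R / X) ((t : nat)%:R / X) f.
have -> : Z3 n (fun y => phi (mk3 ((r : nat)%:Z + q%:Z * y 0 0) ((s : nat)%:Z + q%:Z * y 0 1) ((t : nat)%:Z + q%:Z * y 0 2)) *
     (f (scale X (mk3 ((r : nat)%:Z + q%:Z * y 0 0) ((s : nat)%:Z + q%:Z * y 0 1) ((t : nat)%:Z + q%:Z * y 0 2))))%:C) =
   P * (h ^- 3 * T)%:C.
  have Th : h ^- 3 * T = \sum_(a <- zl n) \sum_(b <- zl n) \sum_(c <- zl n)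
      f (mk3 ((r : nat)%:R / X + h * a%:~R) ((s : nat)%:R / X + h * b%:~R) ((t : nat)%:R / X + h * c%:~R)).
    rewrite /T /S3 /S1 -mulr_sumr; under eq_bigr do rewrite -mulr_sumr.
    rewrite -mulr_sumr; move: (\sum_(a <- zl n) _) => W; field; exact: lt0r_neq0.
  rewrite Th /Z3 !rmorph_sum/= mulr_sumr; apply: eq_bigr => a _.
  rewrite rmorph_sum/= mulr_sumr; apply: eq_bigr => b _.
  rewrite rmorph_sum/= mulr_sumr; apply: eq_bigr => c _.
  rewrite !mxE !(tnth_nth 0)/=; congr (_ * (f _)%:C).
    by apply: (mod_periodic3_mk3 pphi); rewrite addrAC subrr add0r dvdz_mulr.
  apply/rowP => i; rewrite /scale !mxE.
  by case: i => -[|[|[|//]]] hi; rewrite !(tnth_nth 0)/= intrD intrM mulrDr mulrC; congr (_ + _); rewrite mulrA [X^-1 * _]mulrC.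
have -> : P * (h ^- 3 * T)%:C - (X ^+ 3 * I3 f)%:C * (q%:R ^- 3 * P) = P * (h ^- 3 * (T - I3 f))%:C.
  rewrite mulrBr [in RHS]rmorphB/= mulrBr; congr (_ - _).
  rewrite (_ : h ^- 3 * I3 f = q%:R ^- 3 * (X ^+ 3 * I3 f)); last first.
    by rewrite /h; field; rewrite !lt0r_neq0.
  by rewrite [in RHS]rmorphM/= fmorphV/= rmorphXn/= rmorph_nat; ring.
rewrite cabsM cabs_real normrM ger0_norm ?invr_ge0 ?exprn_ge0 ?(ltW h0)//.
have Eb : `|T - I3 f| <= E.
  have c (k : 'I_q) : 0 <= (k : nat)%:R / X <= h.
    by rewrite divr_ge0 ?(ltW X0)//= ler_wpM2r ?invr_ge0 ?(ltW X0)// ler_nat ltnW.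
  exact: (lattice3 B1 l0 hf h0 hn hn2 (c r) (c s) (c t)).
rewrite -[leRHS]mul1r; apply: ler_pM.
- exact: cabs_ge0.
- by rewrite mulr_ge0// invr_ge0 exprn_ge0// ltW.
- exact: bphi.
- by rewrite ler_wpM2l// invr_ge0 exprn_ge0// ltW.
Qed.

End WeightedSums.

(** * The truncated singular series as a trigonometric polynomial, and its averages *)

Section ArithmeticExpansion.
Context {R : realType}.
Implicit Types (r a : int).

(** Over a common denominator, s_a(K) is a trigonometric polynomial in a with coefficients [Gam],
    supported on the fractions of denominator at most K. *)
Lemma s_expansion (D K : nat) a : (0 < D)%N -> (forall n, (0 < n)%N -> (n <= K)%N -> (n %| D)%N) ->
  s_ a K = \sum_(r < D | (den D (r : nat)%:Z <= K)%N) Gam D (r : nat)%:Z * er D (- (r : nat)%:Z * a) :> R[i].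
Proof.
move=> D0 KD.
rewrite (@sum_den_pred _ D K (fun n => (n <= K)%N) (fun r => Gam D r * er D (- r * a)))//; last first.
  by move=> n n0 nK _; exact: KD.
rewrite /s_ [RHS]big_nat_cond big_nat; apply: congr_big => // n.
  by rewrite ltnS; case: (n <= K)%N; rewrite !(andbT, andbF).
move=> /andP[n0]; rewrite ltnS => nK; have nD := KD n n0 nK.
rewrite /T_ mulr_sumr; apply: eq_bigr => u _.
rewrite Gam_scale// -mulNr [X in er D X]mulrAC er_frac//.
under eq_bigr do rewrite /Fa mulrBr -mulNr erD.
rewrite -mulr_suml char_sum_cubic mulrA; congr (_ * _).
by rewrite /Gam expr_div_n mulrC.
Qed.

Lemma F0_sub_dvd (q : nat) (y z : 'rV[int]_3) :
  (forall i, (q%:Z %| (y 0 i - z 0 i)%R)%Z) -> (q%:Z %| (F0 y - F0 z)%R)%Z.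
Proof.
move=> h; rewrite /F0 -sumrB; apply: rpred_sum => i _; exact: dvdz_exp_sub.
Qed.

Lemma er_den_periodic (D : nat) r : (0 < D)%N ->
  mod_periodic (den D r) (fun a => er D (- r * a) : R[i]).
Proof.
move=> D0 a b /dvdzP[k E]; apply: er_eqmod; rewrite -mulrBr E mulNr dvdzE abszN -dvdzE.
rewrite mulrCA dvdz_mull// mulrC -den_dvd//.
Qed.

Definition cross_phase (D d : nat) r (y : 'rV[int]_3) : R[i] :=
  if (d%:Z %| F0 y)%Z then er D (- r * F0 y) else 0.

Lemma cross_phase_periodic D d r : (0 < D)%N -> mod_periodic3 (den D r * d) (cross_phase D d r).
Proof.
move=> D0 y z /F0_sub_dvd h; rewrite /cross_phase.
have hd : (d%:Z %| F0 y - F0 z)%Z by apply: dvdz_trans h; rewrite PoszM dvdz_mull.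
have hn : ((den D r)%:Z %| F0 y - F0 z)%Z by apply: dvdz_trans h; rewrite PoszM dvdz_mulr.
rewrite (er_den_periodic D0 hn) -[F0 y in LHS](subrK (F0 z)) rpredDl//.
Qed.

Lemma cross_phase_le1 D d r y : cabs (cross_phase D d r y) <= 1.
Proof. by rewrite /cross_phase; case: ifP => _; rewrite ?cabs_er ?cabs0. Qed.

Lemma cross_phase_average D d r : (0 < D)%N -> (0 < d)%N -> (d %| D)%N ->
  D%:R ^- 3 * sum3 D (cross_phase D d r) = d%:R^-1 * \sum_(b < d) Gam D (partner D d r b) :> R[i].
Proof.
move=> D0 d0 dD.
have := @restricted_char_sum R D D d (- r) D0 d0 (dvdnn D) dD.
rewrite divnn D0 mulr1 => E; transitivity (d%:R^-1 * \sum_(b < d) Gam D (- r + (b : nat)%:Z * (D %/ d)%N%:Z) : R[i]).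
  rewrite -E big_mkcond sum_mk3; congr (_ * _).
  apply: eq_bigr => s _; apply: eq_bigr => t _; apply: eq_bigr => u _.
  by rewrite /repZ map_mk3.
by congr (_ * _); apply: eq_bigr => b _; rewrite addrC.
Qed.

Definition square_phase (D d : nat) r1 r2 a : R[i] :=
  if (d%:Z %| a)%Z then er D (- r1 * a) * er D (- r2 * a) else 0.

Lemma square_phase_periodic D d r1 r2 : (0 < D)%N ->
  mod_periodic (den D r1 * den D r2 * d) (square_phase D d r1 r2).
Proof.
move=> D0 a b h; rewrite /square_phase.
have hd : (d%:Z %| a - b)%Z by apply: dvdz_trans h; rewrite PoszM dvdz_mull.
have h1 : ((den D r1)%:Z %| a - b)%Z by apply: dvdz_trans h; rewrite !PoszM -mulrA dvdz_mulr.
have h2 : ((den D r2)%:Z %| a - b)%Z by apply: dvdz_trans h; rewrite !PoszM mulrAC dvdz_mull.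
by rewrite (er_den_periodic D0 h1) (er_den_periodic D0 h2) -[a in LHS](subrK b) rpredDl.
Qed.

Lemma square_phase_le1 D d r1 r2 a : cabs (square_phase D d r1 r2 a) <= 1.
Proof. by rewrite /square_phase; case: ifP => _; rewrite ?cabsM ?cabs_er ?mulr1 ?cabs0. Qed.

(** Orthogonality of characters: only the r2 that are partners of r1 survive, each with weight
    1/d. *)
Lemma square_phase_average D d r1 r2 : (0 < D)%N -> (0 < d)%N -> (d %| D)%N ->
  D%:R^-1 * (\sum_(a < D) square_phase D d r1 r2 (a : nat)%:Z) =
  d%:R^-1 * \sum_(b < d) (if (D%:Z %| (partner D d r1 b - r2)%R)%Z then 1 else 0) :> R[i].
Proof.
move=> D0 d0 dD.
have DR : D%:R != 0 :> R[i] by rewrite pnatr_eq0 -lt0n.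
have E (a : 'I_D) : square_phase D d r1 r2 (a : nat)%:Z =
    d%:R^-1 * \sum_(b < d) er D ((partner D d r1 b - r2) * (a : nat)%:Z).
  rewrite /square_phase; transitivity ((if (d%:Z %| (a : nat)%:Z)%Z then 1 else 0 : R[i]) *
      (er D (- r1 * (a : nat)%:Z) * er D (- r2 * (a : nat)%:Z))).
    by case: ifP => _; rewrite ?mul1r ?mul0r.
  rewrite indicator_er// -mulrA; congr (_ * _); rewrite mulr_suml; apply: eq_bigr => b _.
  rewrite -(er_frac _ D0 dD) -!erD; congr er; rewrite /partner; ring.
under eq_bigr do rewrite E.
rewrite -mulr_sumr exchange_big/= mulrCA; congr (_ * _); rewrite mulr_sumr; apply: eq_bigr => b _.
by rewrite er_geom//; case: ifP => _; rewrite ?mulr0// mulVf.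
Qed.

Lemma sum_residue_class (V : nmodType) (D : nat) (f : int -> V) (p : int) : (0 < D)%N ->
  mod_periodic D f -> \sum_(r < D | (D%:Z %| (p - (r : nat)%:Z)%R)%Z) f (r : nat)%:Z = f p.
Proof.
move=> D0 pf; have pD : (`|(p %% D%:Z)%Z|%N < D)%N.
  by have := @ltz_pmod p D%:Z; have := @modz_ge0 p D%:Z; lia.
have pE : (`|(p %% D%:Z)%Z|%N)%:Z = (p %% D%:Z)%Z by have := @modz_ge0 p D%:Z; lia.
rewrite (big_pred1 (Ordinal pD)) /=.
  by apply: pf; rewrite pE {2}(divz_eq p D) opprD addrA addrAC subrr sub0r dvdzE abszN -dvdzE dvdz_mull.
move=> r /=; rewrite -val_eqE/=.
have Ed : (D%:Z %| p - (r : nat)%:Z)%Z = ((p %% D%:Z)%Z == (r : nat)%:Z).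
  rewrite -eqz_mod_dvd [X in _ == X]modz_small//=; exact: ltn_ord.
by rewrite Ed -{1}pE eqz_nat eq_sym.
Qed.

Lemma square_pairs_expand D d K : (0 < D)%N -> (0 < d)%N ->
  \sum_(r1 < D | (den D (r1 : nat)%:Z <= K)%N) \sum_(r2 < D | (den D (r2 : nat)%:Z <= K)%N)
    Gam D (r1 : nat)%:Z * Gam D (r2 : nat)%:Z *
    (d%:R^-1 * \sum_(b < d) (if (D%:Z %| (partner D d (r1 : nat)%:Z b - (r2 : nat)%:Z)%R)%Z then 1 else 0)) =
  pair_sum D d (square_pairs D d K) :> R[i].
Proof.
move=> D0 d0; rewrite /pair_sum mulr_sumr big_mkcond; apply: eq_bigr => r1 _.
rewrite /square_pairs; case: ifP => h1; last by rewrite big_pred0_eq mulr0.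
rewrite [in RHS]big_mkcond mulr_sumr.
transitivity (\sum_(b < d) d%:R^-1 * (Gam D (r1 : nat)%:Z *
   \sum_(r2 < D | (D%:Z %| (partner D d (r1 : nat)%:Z b - (r2 : nat)%:Z)%R)%Z)
     (if (den D (r2 : nat)%:Z <= K)%N then Gam D (r2 : nat)%:Z else 0)) : R[i]).
  rewrite big_mkcond.
  under [RHS]eq_bigr do rewrite big_mkcond !mulr_sumr.
  symmetry; rewrite exchange_big/=; symmetry; apply: eq_bigr => r2 _; case: ifP => _.
    rewrite !mulr_sumr; apply: eq_bigr => b _; case: ifP => _; ring.
  by rewrite big1// => b _; case: ifP; rewrite !mulr0.
apply: eq_bigr => b _; congr (_ * _).
rewrite (@sum_residue_class _ D (fun r => if (den D r <= K)%N then Gam D r else 0) _ D0).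
  by rewrite /=; case: ifP => _; rewrite ?mulr0.
by move=> a a' aa /=; rewrite (den_periodic D0 aa) (Gam_periodic aa).
Qed.

Lemma count_small_den (D K : nat) (c : R) : (0 < D)%N -> 0 <= c ->
  (forall n, (0 < n)%N -> (n <= K)%N -> (n %| D)%N) ->
  \sum_(r < D | (den D (r : nat)%:Z <= K)%N) c <= K%:R ^+ 2 * c.
Proof.
move=> D0 c0 KD.
rewrite (@sum_den_pred _ D K (fun n => (n <= K)%N) (fun=> c))//; last first.
  by move=> n n0 nK _; exact: KD.
apply: (@le_trans _ _ (\sum_(1 <= n < K.+1) K%:R * c)).
  rewrite big_nat_cond [leRHS]big_nat_cond; apply: (@le_trans _ _ (\sum_(1 <= i < K.+1 | (1 <= i < K.+1)%N && (i <= K)%N) K%:R * c)).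
    apply: ler_sum => n /andP[_ nK]; apply: (@le_trans _ _ (\sum_(u < n) c)).
      by rewrite [leRHS](bigID (fun u : 'I_n => coprime u n))/= lerDl sumr_ge0.
    rewrite sumr_const card_ord -[_ *+ _]mulr_natl ler_wpM2r// ler_nat//.
  rewrite le_eqVlt; apply/orP; left; apply/eqP; apply: congr_big => // n.
  by rewrite ltnS; case: (n <= K)%N; rewrite !(andbT, andbF).
rewrite sumr_const_nat subn1/= -[_ *+ _]mulr_natl expr2 mulrA//.
Qed.

End ArithmeticExpansion.

Ltac nonneg :=
  repeat first [done | exact: ler0n | apply: exprn_ge0 | rewrite invr_ge0 | apply: mulr_ge0 | apply: addr_ge0].

(** * Main terms of the cross and square sums *)

Section MainTerms.
Context {R : realType}.

Lemma Z3_lin (n : nat) (I : Type) (r : seq I) (P : pred I) (c : I -> R[i]) (g : I -> 'rV[int]_3 -> R[i]) :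
  Z3 n (fun y => \sum_(i <- r | P i) c i * g i y) = \sum_(i <- r | P i) c i * Z3 n (g i).
Proof.
rewrite /Z3; under [RHS]eq_bigr do rewrite mulr_sumr.
symmetry; rewrite exchange_big/=; apply: eq_bigr => a _.
under eq_bigr do rewrite mulr_sumr.
rewrite exchange_big/=; apply: eq_bigr => b _.
under eq_bigr do rewrite mulr_sumr.
by rewrite exchange_big.
Qed.

Lemma mem_zl_norm (a : int) (w : nat) : `|a| <= w%:Z -> a \in zl w.+1.
Proof. by rewrite mem_zl; lia. Qed.

Lemma scale_support (b X : nat) (f : 'rV[R]_3 -> R) (a1 a2 a3 : int) : (0 < X)%N ->
  (forall u, f u != 0 -> `|u| <= b%:R) ->
  f (scale X%:R (mk3 a1 a2 a3)) != 0 ->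
  [/\ a1 \in zl (b * X).+1, a2 \in zl (b * X).+1 & a3 \in zl (b * X).+1].
Proof.
move=> X0 sf /sf h.
have XR : 0 < X%:R :> R by rewrite ltr0n.
have H i : `|mk3 a1 a2 a3 0 i|%:~R <= (b * X)%N%:R :> R.
  have := le_trans (coord_le_norm _ i) h; rewrite /scale mxE [(map_mx _ _) _ _]mxE.
  by rewrite normrM normfV (ger0_norm (ltW XR)) mulrC ler_pdivrMr// -natrM intr_norm.
have C (a : int) : `|a|%:~R <= (b * X)%N%:R :> R -> a \in zl (b * X).+1.
  by rewrite -[(b * X)%N%:R]/((b * X)%N%:Z%:~R) ler_int; exact: mem_zl_norm.
have := H 0; have := H 1; have := H 2; rewrite !mxE !(tnth_nth 0)/=.
by move=> /C h3 /C h2 /C h1.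
Qed.

Lemma Z3_support (b X M M' : nat) (f : 'rV[R]_3 -> R) (phi : 'rV[int]_3 -> R[i]) : (0 < X)%N ->
  (forall u, f u != 0 -> `|u| <= b%:R) -> ((b * X).+1 <= M)%N -> ((b * X).+1 <= M')%N ->
  Z3 M (fun y => phi y * (f (scale X%:R y))%:C) = Z3 M' (fun y => phi y * (f (scale X%:R y))%:C).
Proof.
move=> X0 sf h h'.
have s a1 a2 a3 : phi (mk3 a1 a2 a3) * (f (scale X%:R (mk3 a1 a2 a3)))%:C != 0 ->
    [/\ a1 \in zl (b * X).+1, a2 \in zl (b * X).+1 & a3 \in zl (b * X).+1].
  move=> h0; apply: scale_support X0 sf _; apply: contraNneq h0 => ->.
  by rewrite mulr0.
by rewrite (Z3_widen h s) (Z3_widen h' s).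
Qed.

(** There is one Riemann sum for each of the at most K^2 fractions r/D. Its modulus is q = den(r) d
    <= Kd, so its mesh is at most Kd/X. *)
Lemma cross_close (b X K d D M : nat) (lam N : R) m (f : 'rV[R]_3 -> R) :
  (0 < b)%N -> 0 <= lam -> CC b%:R lam m.+1 N f -> (0 < X)%N -> (0 < d)%N -> (0 < D)%N ->
  (forall n, (0 < n)%N -> (n <= K * d)%N -> (n %| D)%N) -> (d %| D)%N ->
  (K * d <= X)%N -> ((b * X).+1 <= M)%N ->
  cabs (Z3 M (fun y => (if (d%:Z %| F0 y)%Z then s_ (F0 y) K else 0) * (f (scale X%:R y))%:C) -
        (X%:R ^+ 3 * I3 f)%:C * pair_sum D d (cross_pairs D K)) <=
  K%:R ^+ 2 * (X%:R ^+ 3 * (48 * (b%:R + 2) ^+ 3 * (lam ^+ m.+1 * N) * ((K * d)%N%:R / X%:R) ^+ m.+1)).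
Proof.
move=> b0 l0 hf X0 d0 D0 KD dD KX hM.
have B1 : 1 <= b%:R :> R by rewrite ler1n.
have B0 : 0 <= b%:R :> R by [].
have N0 := CC_ge0 B1 hf.
have XR : 0 < X%:R :> R by rewrite ltr0n.
have KD' n : (0 < n)%N -> (n <= K)%N -> (n %| D)%N.
  by move=> n0 nK; apply: KD => //; apply: leq_trans nK _; rewrite leq_pmulr.
set E0 := (X in _ <= _ * X).
have E00 : 0 <= E0.
  by rewrite /E0; nonneg.
apply: le_trans (count_small_den D0 E00 KD').
have -> : Z3 M (fun y => (if (d%:Z %| F0 y)%Z then s_ (F0 y) K else 0) * (f (scale X%:R y))%:C) =
    \sum_(r < D | (den D (r : nat)%:Z <= K)%N) Gam D (r : nat)%:Z *
      Z3 M (fun y => cross_phase D d (r : nat)%:Z y * (f (scale X%:R y))%:C).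
  rewrite -Z3_lin; apply: eq_Z3 => y; rewrite /cross_phase.
  case: ifP => _; last by rewrite mul0r big1// => r _; rewrite ?mul0r mulr0.
  by rewrite (s_expansion _ D0 KD') mulr_suml; apply: eq_bigr => r _; rewrite mulrA.
have -> : pair_sum D d (cross_pairs D K) =
    \sum_(r < D | (den D (r : nat)%:Z <= K)%N) Gam D (r : nat)%:Z *
      (D%:R ^- 3 * sum3 D (cross_phase D d (r : nat)%:Z)) :> R[i].
  rewrite /pair_sum mulr_sumr [RHS]big_mkcond; apply: eq_bigr => r _.
  rewrite cross_phase_average// /cross_pairs; case: ifP => _; last by rewrite big_pred0_eq mulr0.
  by rewrite !mulr_sumr; apply: eq_bigr => c _; ring.
rewrite mulr_sumr -sumrB; apply: cabs_sum_le => r rK.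
set q := (den D (r : nat)%:Z * d)%N.
have q0 : (0 < q)%N by rewrite muln_gt0 den_gt0.
have qK : (q <= K * d)%N by rewrite leq_mul2r rK orbT.
have qR : 0 < q%:R :> R by rewrite ltr0n.
have h0 : 0 < q%:R / X%:R :> R by rewrite divr_gt0.
have h1 : q%:R / X%:R <= 1 :> R by rewrite ler_pdivrMr// mul1r ler_nat (leq_trans qK).
have hn := steps_gt h0 B0; have hn2 := steps_le h0 B0.
set n := steps _ _ in hn hn2.
have hn3 : q%:R / X%:R * n%:R <= b%:R + 2 :> R by apply: le_trans hn2 _; lra.
have hq : ((b * X).+1 <= q * n)%N.
  by move: hn; rewrite mulrAC ltr_pdivlMr// -!natrM ltr_nat.
(* The weight lives on |y| <= bX, so the range of summation can be changed to a multiple of q. *)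
rewrite (Z3_support _ X0 _ hM hq); last by move=> u /(proj1 hf)/andP[].
have pp := @cross_phase_periodic R D d (r : nat)%:Z D0.
rewrite -(average_multiple3 q0 D0 (KD q q0 qK) pp) mulrCA -mulrBr cabsM.
rewrite -[leRHS]mul1r; apply: ler_pM; rewrite ?cabs_ge0 ?cabs_Gam_le1//.
apply: le_trans (weighted_sum3 B1 l0 hf q0 XR hn hn3 pp (cross_phase_le1 _ _ _)) _.
rewrite /E0; apply: ler_wpM2l; first by rewrite exprn_ge0.
apply: ler_wpM2l; first by nonneg.
apply: lerXn2r; rewrite ?nnegrE ?(ltW h0) ?divr_ge0//.
by rewrite ler_wpM2r ?invr_ge0// ler_nat.
Qed.

(** The variable is now a, on the scale X^3. At most K^4 pairs (r1, r2) occur, of modulus at most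
    K^2 d. *)
Lemma square_close m : exists2 c : R, 0 <= c &
  forall (b X K d D M : nat) (N : R) (f : 'rV[R]_3 -> R),
  (0 < b)%N -> CC b%:R (b%:R ^+ 7) (m + 8) N f -> (0 < X)%N -> (0 < d)%N -> (0 < D)%N ->
  (forall n, (0 < n)%N -> (n <= K * K * d)%N -> (n %| D)%N) -> (d %| D)%N ->
  (K * K * d <= X ^ 3)%N -> (3 * b ^ 3 * X ^ 3 < M)%N ->
  cabs (\sum_(a <- zl M) (if (d%:Z %| a)%Z then s_ a K ^+ 2 else 0) *
          (dens f 0 (a%:~R / X%:R ^+ 3) ^+ 2)%:C -
        (X%:R ^+ 3 * J f (dens f 0))%:C * pair_sum D d (square_pairs D d K)) <=
  K%:R ^+ 2 * (K%:R ^+ 2 * (X%:R ^+ 3 * (c * b%:R ^+ (67 + 13 * m) * N ^+ 2 *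
     ((K * K * d)%N%:R / X%:R ^+ 3) ^+ m))).
Proof.
have [c c0 H] := @density_square_lattice R m.
have [c1 _ Hc] := @density_chain R 0.
exists (16 * c); first exact: mulr_ge0.
move=> b X K d D M N f b0 hf X0 d0 D0 KD dD KX hM.
have B1 : 1 <= b%:R :> R by rewrite ler1n.
have B0 : 0 <= b%:R :> R by [].
have N0 := CC_ge0 B1 hf.
have XR : 0 < X%:R ^+ 3 :> R by rewrite exprn_gt0// ltr0n.
have sG t : dens f 0 t != 0 -> `|t| <= 3 * b%:R ^+ 3.
  have hf7 : CC b%:R (b%:R ^+ 7) (0 + 7) N f by apply: (CC_leK _ hf); exact: leq_trans (leq_addl m 8).
  by have [_ _ sG _] := Hc _ _ _ _ B1 (lexx _) hf7; exact: sG.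
have KD' n : (0 < n)%N -> (n <= K)%N -> (n %| D)%N.
  move=> n0 nK; apply: KD => //; apply: leq_trans nK _; rewrite -mulnA.
  by case: (K) => // K'; rewrite leq_pmulr// muln_gt0 d0.
set E0 := (X in _ <= _ * (_ * X)).
have E00 : 0 <= E0.
  by rewrite /E0; nonneg.
have E01 : 0 <= K%:R ^+ 2 * E0 by rewrite mulr_ge0// exprn_ge0.
apply: le_trans (count_small_den D0 E01 KD').
pose SP (r1 r2 : 'I_D) := \sum_(a <- zl M) square_phase D d (r1 : nat)%:Z (r2 : nat)%:Z a *
   (dens f 0 (a%:~R / X%:R ^+ 3) ^+ 2)%:C.
have -> : \sum_(a <- zl M) (if (d%:Z %| a)%Z then s_ a K ^+ 2 else 0) *
     (dens f 0 (a%:~R / X%:R ^+ 3) ^+ 2)%:C =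
   \sum_(r1 < D | (den D (r1 : nat)%:Z <= K)%N) \sum_(r2 < D | (den D (r2 : nat)%:Z <= K)%N)
     Gam D (r1 : nat)%:Z * Gam D (r2 : nat)%:Z * SP r1 r2.
  under [RHS]eq_bigr do under eq_bigr do rewrite mulr_sumr.
  under [RHS]eq_bigr do rewrite exchange_big/=.
  symmetry; rewrite exchange_big/=; symmetry; apply: eq_bigr => a _.
  rewrite /square_phase; case: ifP => _; last first.
    by rewrite mul0r big1// => r1 _; rewrite big1// => r2 _; rewrite ?mul0r mulr0.
  rewrite (s_expansion _ D0 KD') expr2 mulr_suml mulr_suml; apply: eq_bigr => r1 _.
  rewrite mulr_sumr mulr_suml; apply: eq_bigr => r2 _; ring.
rewrite -square_pairs_expand// [X in _ - X]mulr_sumr -sumrB; apply: cabs_sum_le => r1 r1K.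
apply: le_trans (count_small_den D0 E00 KD').
rewrite [X in _ - X]mulr_sumr -sumrB; apply: cabs_sum_le => r2 r2K.
have alg (p s x a : R[i]) : p * s - x * (p * a) = p * (s - x * a) by ring.
rewrite alg cabsM -[leRHS]mul1r; apply: ler_pM; rewrite ?cabs_ge0//.
  by rewrite cabsM -[leRHS]mul1r ler_pM ?cabs_ge0 ?cabs_Gam_le1.
set q := (den D (r1 : nat)%:Z * den D (r2 : nat)%:Z * d)%N.
have q0 : (0 < q)%N by rewrite !muln_gt0 !den_gt0.
have qK : (q <= K * K * d)%N by rewrite leq_mul2r leq_mul ?orbT.
have qR : 0 < q%:R :> R by rewrite ltr0n.
have h0 : 0 < q%:R / X%:R ^+ 3 :> R by rewrite divr_gt0.
have h1 : q%:R / X%:R ^+ 3 <= 1 :> R.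
  by rewrite ler_pdivrMr// mul1r -natrX ler_nat (leq_trans qK).
have A0 : 0 <= 3 * b%:R ^+ 3 :> R by rewrite mulr_ge0// exprn_ge0.
have hn := steps_gt h0 A0; have hn2 := steps_le h0 A0.
set n := steps _ _ in hn hn2.
have hn3 : q%:R / X%:R ^+ 3 * n%:R <= 4 * b%:R ^+ 3 :> R.
  apply: le_trans hn2 _; have : 1 <= b%:R ^+ 3 :> R by rewrite exprn_ege1.
  by move=> h; lra.
have hq : (3 * b ^ 3 * X ^ 3 < q * n)%N.
  move: hn; rewrite mulrAC ltr_pdivlMr// -!natrX -!natrM ltr_nat//.
have -> : SP r1 r2 = \sum_(a <- zl (q * n)) square_phase D d (r1 : nat)%:Z (r2 : nat)%:Z a *
   (dens f 0 (a%:~R / X%:R ^+ 3) ^+ 2)%:C.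
  have z (a : int) : a \notin zl (3 * b ^ 3 * X ^ 3).+1 ->
      square_phase D d (r1 : nat)%:Z (r2 : nat)%:Z a * (dens f 0 (a%:~R / X%:R ^+ 3) ^+ 2)%:C = 0.
    move=> az; have -> : dens f 0 (a%:~R / X%:R ^+ 3) = 0; last by rewrite expr0n mulr0.
    apply/eqP; apply: contraNT az => /sG.
    rewrite normrM normfV (ger0_norm (ltW XR)) ler_pdivrMr// -!natrX -!natrM.
    rewrite -intr_norm -[(3 * _ * _)%N%:R]/((3 * b ^ 3 * X ^ 3)%N%:Z%:~R) ler_int.
    exact: mem_zl_norm.
  by rewrite /SP (zl_widen hM z) (zl_widen hq z).
have avg := square_phase_average (r1 : nat)%:Z (r2 : nat)%:Z D0 d0 dD.
have pp := @square_phase_periodic R D d (r1 : nat)%:Z (r2 : nat)%:Z D0.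
rewrite -{}avg -(average_multiple q0 D0 (KD q q0 qK) pp).
apply: le_trans (weighted_sum1 (E := (q%:R / X%:R ^+ 3) ^+ m * (4 * (q%:R / X%:R ^+ 3 * n%:R) * (c * (b%:R ^+ (64 + 13 * m) * N ^+ 2)))) (g := fun t => dens f 0 t ^+ 2) q0 XR
  pp (square_phase_le1 _ _ _ _) _) _.
  by move=> x hx; exact: (H _ _ _ _ _ _ B1 hf h0 hn hx).
rewrite /E0; apply: ler_wpM2l; first exact: ltW.
rewrite mulrC; apply: ler_pM.
- have h00 := ltW h0; by nonneg.
- by rewrite exprn_ge0// ltW.
- rewrite (_ : (67 + 13 * m = 3 + (64 + 13 * m))%N)// [b%:R ^+ (3 + _)]exprD.
  set w := b%:R ^+ (64 + _); have w0 : 0 <= w by rewrite exprn_ge0.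
  rewrite (_ : 16 * c * _ * _ = 4 * (4 * b%:R ^+ 3) * (c * (w * N ^+ 2))); last by ring.
  by apply: ler_wpM2r; [nonneg|rewrite ler_pM2l].
apply: lerXn2r; rewrite ?nnegrE ?(ltW h0) ?divr_ge0 ?(ltW XR)//.
by rewrite ler_wpM2r ?invr_ge0 ?(ltW XR)// ler_nat.
Qed.

End MainTerms.

(** Turns the finitely supported sums of the definitions into sums over explicit lists. *)
Lemma fsum_seq (T : choiceType) (V : nmodType) (A : set T) (P : pred T) (r : seq T) (f : T -> V) :
  uniq r -> (forall i, A i <-> P i) -> (forall i, P i -> i \notin r -> f i = 0) ->
  \sum_(i \in A) f i = \sum_(i <- r) (if P i then f i else 0).
Proof.
move=> ur AP f0; rewrite fsbig_mkcond (fsbigE r)//.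
  rewrite big_mkcond; apply: eq_bigr => i _; rewrite (_ : (i \in [set: T]) = true) ?/patch; last exact: mem_set.
  case: ifPn => [/set_mem/AP ->//|/negP h]; case: ifP => // Pi; exfalso; apply: h.
  by apply: mem_set; exact/AP.
by move=> i _ ir; rewrite /patch; case: ifPn => // /set_mem/AP Pi; exact: f0.
Qed.

Definition L3 (n : nat) : seq 'rV[int]_3 :=
  [seq mk3 t.1 t.2.1 t.2.2 | t <- [seq (a, s) | a <- zl n, s <- [seq (b, c) | b <- zl n, c <- zl n]]].

Lemma L3_uniq n : uniq (L3 n).
Proof.
rewrite map_inj_uniq; last by move=> [a [b c]] [a' [b' c']] /= E; have [-> -> ->] := mk3_inj E.
apply: allpairs_uniq; first exact: zl_uniq.
  by apply: allpairs_uniq; [exact: zl_uniq|exact: zl_uniq|move=> [? ?] [? ?] _ _].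
by move=> [? ?] [? ?] _ _.
Qed.

Lemma mem_L3 n a b c : a \in zl n -> b \in zl n -> c \in zl n -> mk3 a b c \in L3 n.
Proof.
move=> an bn cn; apply/mapP; exists (a, (b, c)) => //.
by apply/allpairsP; exists (a, (b, c)); split=> //; apply/allpairsP; exists (b, c).
Qed.

Lemma sum_L3 (V : nmodType) n (f : 'rV[int]_3 -> V) : \sum_(y <- L3 n) f y = Z3 n f.
Proof.
rewrite /L3 big_map big_allpairs; apply: eq_bigr => a _.
by rewrite big_allpairs.
Qed.

(** * Opening the square *)

Section VarianceExpansion.
Context {R : realType}.
Variables (nu : 'rV[R]_3 -> R) (g : R -> R) (b X K d : nat).
Hypotheses (X0 : (0 < X)%N) (b0 : (0 < b)%N).
Hypothesis nub : forall u, nu u != 0 -> `|u| <= b%:R.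
Hypothesis gb : forall t, g t != 0 -> `|t| <= 3 * b%:R ^+ 3.
Hypothesis sg : forall a : int, sigma_inf_a a%:~R nu X%:R = g (a%:~R / X%:R ^+ 3).

(** One more than the support bound, because [zl] omits its right end; [M1] covers the values of F0
    on that cube. *)
Let M := (b * X).+1.
Let M1 := (3 * M ^ 3).+1.

Lemma nu_support y : nu (scale X%:R y) != 0 -> y \in L3 M.
Proof.
rewrite [y]mk3_eta => /(scale_support X0 nub)[h1 h2 h3]; exact: mem_L3.
Qed.

Lemma N_a_sum a : N_a a nu X%:R = Z3 M (fun y => if F0 y == a then nu (scale X%:R y) else 0).
Proof.
rewrite /N_a (@fsum_seq _ _ _ (fun y => F0 y == a) (L3 M)) ?L3_uniq ?sum_L3//.
  by move=> y; split => /eqP.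
by move=> y _; apply: contraNeq => /nu_support.
Qed.

Lemma F0_range a1 a2 a3 : a1 \in zl M -> a2 \in zl M -> a3 \in zl M -> F0 (mk3 a1 a2 a3) \in zl M1.
Proof.
have H a : a \in zl M -> `|a| <= M%:Z by rewrite mem_zl; lia.
move=> /H h1 /H h2 /H h3; apply: mem_zl_norm; rewrite F0_mk3.
have C a : `|a| <= M%:Z -> `|a ^+ 3| <= (M ^ 3)%N%:Z.
  by move=> h; rewrite normrX PoszX lerXn2r// nnegrE.
have := C _ h1; have := C _ h2; have := C _ h3; rewrite mulSn mulSn mul1n.
move: (M ^ 3)%N => w; move: (a1 ^+ 3) (a2 ^+ 3) (a3 ^+ 3) => p q r; lia.
Qed.

Lemma Z3_C (n : nat) (f : 'rV[int]_3 -> R) : (Z3 n f)%:C = Z3 n (fun y => (f y)%:C).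
Proof.
rewrite /Z3 rmorph_sum; apply: eq_bigr => a _; rewrite rmorph_sum; apply: eq_bigr => s _.
by rewrite rmorph_sum.
Qed.

Lemma sum_weighted_N_a (h : int -> R[i]) :
  \sum_(a <- zl M1) h a * (N_a a nu X%:R)%:C = Z3 M (fun y => h (F0 y) * (nu (scale X%:R y))%:C).
Proof.
transitivity (\sum_(a <- zl M1) Z3 M (fun y => if F0 y == a then h (F0 y) * (nu (scale X%:R y))%:C else 0)).
  apply: eq_bigr => a _; rewrite N_a_sum Z3_C /Z3 mulr_sumr; apply: eq_bigr => a1 _.
  rewrite mulr_sumr; apply: eq_bigr => a2 _; rewrite mulr_sumr; apply: eq_bigr => a3 _.
  by case: eqP => [->//|_]; rewrite mulr0.
rewrite /Z3 exchange_big; apply: eq_big_seq => a1 h1; rewrite exchange_big.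
apply: eq_big_seq => a2 h2; rewrite exchange_big; apply: eq_big_seq => a3 h3.
rewrite (bigD1_seq (F0 (mk3 a1 a2 a3))) ?zl_uniq ?F0_range//= eqxx big1 ?addr0// => a.
by rewrite eq_sym => /negPf ->.
Qed.

Lemma N_w_sum : (N_w (tensor2 nu) X%:R d)%:C =
  Z3 M (fun y => (if (d%:Z %| F0 y)%Z then (N_a (F0 y) nu X%:R)%:C else 0) * (nu (scale X%:R y))%:C).
Proof.
rewrite /N_w (@fsum_seq _ _ _ (fun x => [&& F0 x.2 == F0 x.1, (d%:Z %| F0 x.1)%Z & (d%:Z %| F0 x.2)%Z])
  [seq (y, z) | y <- L3 M, z <- L3 M]).
- rewrite big_allpairs sum_L3 Z3_C; apply: eq_Z3 => y; rewrite sum_L3 N_a_sum !Z3_C /=.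
  case: ifP => hd; last first.
    rewrite mul0r /Z3 big1// => a1 _; rewrite big1// => a2 _; rewrite big1// => a3 _.
    by rewrite andbF.
  rewrite mulrC /Z3 mulr_sumr; apply: eq_bigr => a1 _; rewrite mulr_sumr; apply: eq_bigr => a2 _.
  rewrite mulr_sumr; apply: eq_bigr => a3 _; case: eqP => [->|_] /=; last by rewrite mulr0.
  by rewrite hd /tensor2/= rmorphM.
- apply: allpairs_uniq; rewrite ?L3_uniq// => -[? ?] [? ?] _ _ //.
- move=> [y z]; rewrite /F/=; split => [[/eqP + h1 h2]|/and3P[/eqP -> h1 h2]].
    by rewrite subr_eq0 eq_sym => ->; rewrite h1 h2.
  by split=> //; rewrite subrr.
move=> [y z] _ yz; rewrite /tensor2/=; apply/eqP; apply: contraNT yz.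
rewrite mulf_eq0 negb_or => /andP[/nu_support hy /nu_support hz].
by apply/allpairsP; exists (y, z).
Qed.

Lemma F0_scale (y : 'rV[int]_3) : F0 (scale X%:R y) = (F0 y)%:~R / X%:R ^+ 3 :> R.
Proof.
rewrite /F0 rmorph_sum/= mulr_suml; apply: eq_bigr => i _.
by rewrite /scale !mxE exprMn rmorphXn/= exprVn mulrC.
Qed.

Lemma g_support (a : int) : a \notin zl M1 -> g (a%:~R / X%:R ^+ 3) = 0.
Proof.
have XR : 0 < X%:R ^+ 3 :> R by rewrite exprn_gt0// ltr0n.
move=> aM; apply/eqP; apply: contraNT aM => /gb.
rewrite normrM normfV (ger0_norm (ltW XR)) ler_pdivrMr// -!natrX -!natrM.
rewrite -intr_norm -[(3 * _ * _)%N%:R]/((3 * b ^ 3 * X ^ 3)%N%:Z%:~R) ler_int => h.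
apply: mem_zl_norm; apply: le_trans h _; rewrite lez_nat -mulnA -expnMn leq_mul2l/=.
by rewrite leq_exp2r// leqW.
Qed.

(** Outside [zl M1] both the count and the density vanish. In the two terms containing the count,
    the sum over a of the sum over y with F0 y = a collapses to a sum over y. *)
Lemma Var_expand : Var nu X K d =
  (N_w (tensor2 nu) X%:R d)%:C
  - 2 * Z3 M (fun y => (if (d%:Z %| F0 y)%Z then s_ (F0 y) K else 0) *
                       (nu (scale X%:R y) * g (F0 (scale X%:R y)))%:C)
  + \sum_(a <- zl M1) (if (d%:Z %| a)%Z then s_ a K ^+ 2 else 0) *
                      (g (a%:~R / X%:R ^+ 3) ^+ 2)%:C.
Proof.
rewrite /Var (@fsum_seq _ _ _ (fun a => (d%:Z %| a)%Z) (zl M1)) ?zl_uniq//; last first.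
  move=> a _ aM; rewrite sg g_support// mulr0 subr0 N_a_sum /Z3 big_seq big1 ?expr0n// => a1 h1.
  rewrite big_seq big1// => a2 h2; rewrite big_seq big1// => a3 h3.
  by case: eqP => // E; exfalso; move/negP: aM; apply; rewrite -E; exact: F0_range.
pose A a := if (d%:Z %| a)%Z then (N_a a nu X%:R)%:C else 0.
pose S a := if (d%:Z %| a)%Z then s_ a K * (g (a%:~R / X%:R ^+ 3))%:C else 0.
have EN := sum_weighted_N_a A; have ES := sum_weighted_N_a S.
rewrite N_w_sum -EN.
have -> : Z3 M (fun y => (if (d%:Z %| F0 y)%Z then s_ (F0 y) K else 0) *
    (nu (scale X%:R y) * g (F0 (scale X%:R y)))%:C) = \sum_(a <- zl M1) S a * (N_a a nu X%:R)%:C.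
  rewrite ES; apply: eq_Z3 => y; rewrite /S F0_scale rmorphM/=.
  by case: ifP => _; rewrite ?mul0r//; ring.
rewrite mulr_sumr -sumrB -big_split/=; apply: eq_bigr => a _; rewrite sg /A /S rmorphXn/=.
by case: ifP => _; rewrite ?mul0r ?mulr0 ?subr0 ?addr0//; ring.
Qed.

End VarianceExpansion.

(** * Exponent bookkeeping *)

Section FinalEstimates.
Context {R : realType}.

Lemma powR_exponent_nat (A X : nat) : (0 < X)%N -> A%:R <= X%:R `^ (9 / 10) :> R -> (A ^ 10 <= X ^ 9)%N.
Proof.
move=> X0 h; have XR : 0 <= X%:R :> R by [].
rewrite -(ler_nat R) !natrX; apply: (@le_trans _ _ ((X%:R `^ (9 / 10)) ^+ 10)).
  by rewrite lerXn2r ?nnegrE ?powR_ge0.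
rewrite -powR_mulrn ?powR_ge0// -powRrM (_ : 9 / 10 * 10%:R = 9%:R :> R) ?powR_mulrn//.
by field.
Qed.

(** Fifty factors A/X <= X^(-1/10) save X^5, which is exactly what K^2 X^3 can reach. *)
Lemma cross_error_le1 (K A X : nat) : (0 < X)%N -> (K <= X)%N -> (A ^ 10 <= X ^ 9)%N ->
  K%:R ^+ 2 * (X%:R ^+ 3 * (A%:R / X%:R) ^+ 50) <= 1 :> R.
Proof.
move=> X0 KX AX; have XR : 0 < X%:R :> R by rewrite ltr0n.
rewrite expr_div_n mulrA mulrA ler_pdivrMr ?exprn_gt0// mul1r -!natrX -!natrM ler_nat.
have E1 : (A ^ 50 = (A ^ 10) ^ 5)%N by rewrite -expnM.
have E2 : (X ^ 50 = X ^ 2 * X ^ 3 * (X ^ 9) ^ 5)%N by rewrite -expnM -!expnD.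
have h1 : ((A ^ 10) ^ 5 <= (X ^ 9) ^ 5)%N by rewrite leq_exp2r.
have h2 : (K ^ 2 <= X ^ 2)%N by rewrite leq_exp2r.
by rewrite E1 E2; exact: leq_mul (leq_mul h2 (leqnn (X ^ 3))) h1.
Qed.

(** Here Q/X^3 <= X^(9/5 - 3) = X^(-6/5), so ten factors save X^12 against K^4 X^3 <= X^7. *)
Lemma square_error_le1 (K A Q X : nat) : (0 < X)%N -> (K <= X)%N -> (A ^ 10 <= X ^ 9)%N ->
  (Q <= A * A)%N -> K%:R ^+ 2 * (K%:R ^+ 2 * (X%:R ^+ 3 * (Q%:R / X%:R ^+ 3) ^+ 10)) <= 1 :> R.
Proof.
move=> X0 KX AX QA; have XR : 0 < X%:R :> R by rewrite ltr0n.
rewrite expr_div_n 3!mulrA ler_pdivrMr ?exprn_gt0// mul1r -!natrX -!natrM ler_nat.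
apply: (@leq_trans (X ^ 2 * X ^ 2 * X ^ 3 * (X ^ 9 * X ^ 9))).
  have h2 : (K ^ 2 <= X ^ 2)%N by rewrite leq_exp2r.
  apply: leq_mul; first exact: leq_mul (leq_mul h2 h2) (leqnn (X ^ 3)).
  apply: (@leq_trans ((A * A) ^ 10)); first by rewrite leq_exp2r.
  by rewrite expnMn leq_mul.
by rewrite -!expnM -!expnD leq_pexp2l.
Qed.

(** The power of d on the left is at most 2/3, hence below 5/3. Capping eps by 1/2 meets the range
    of the tail bounds and only lowers the power of K. *)
Lemma power_saving (K d : nat) (eps : R) : (0 < K)%N -> (0 < d)%N -> 0 < eps ->
  (K%:R / d%:R) `^ (- (2 / 3) + Num.min eps (1 / 2)) <=
  d%:R `^ (5 / 3) * K%:R `^ (- (2 / 3) + eps).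
Proof.
move=> K0 d0 e0; set ep := Num.min _ _.
have ep0 : 0 < ep by rewrite lt_min e0/= divr_gt0.
have e1 : ep <= eps by rewrite ge_min lexx.
have K1 : 1 <= K%:R :> R by rewrite ler1n.
have d1 : 1 <= d%:R :> R by rewrite ler1n.
rewrite powRM ?invr_ge0// mulrC; apply: ler_pM; rewrite ?powR_ge0//.
  rewrite -powR_inv1// -powRrM; apply: ler_powR => //; lra.
by apply: ler_powR => //; rewrite lerD2l.
Qed.

(** 785 = 3 + 15 * 50 + 32, and 1296 = 48 * 27 from b + 2 <= 3 b. *)
Lemma cross_constant_bound (b c N P : R) : 1 <= b -> 0 <= c -> b ^+ 785 <= P ->
  48 * (b + 2) ^+ 3 * ((b ^+ 15) ^+ 50 * (c * (b ^+ 32 * N ^+ 2))) <= 1296 * c * (N ^+ 2 * P).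
Proof.
move=> b1 c0 bP; have b0 : 0 <= b by exact: le_trans b1.
have h : (b + 2) ^+ 3 <= (3 * b) ^+ 3.
  by apply: lerXn2r; rewrite ?nnegrE ?addr_ge0 ?mulr_ge0//; lra.
have E : b ^+ 785 = b ^+ 3 * ((b ^+ 15) ^+ 50 * b ^+ 32) by rewrite -exprM -!exprD.
rewrite {}E in bP.
move: ((b ^+ 15) ^+ 50) (exprn_ge0 50 (exprn_ge0 15 b0)) bP => u u0.
move: (b ^+ 32) (exprn_ge0 32 b0) => v v0 bP.
apply: (@le_trans _ _ (48 * (3 * b) ^+ 3 * (u * (c * (v * N ^+ 2))))).
  apply: ler_wpM2r; last by rewrite ler_pM2l.
  by do 3 (apply: mulr_ge0 => //); exact: sqr_ge0.
rewrite (_ : _ * _ = 1296 * c * (N ^+ 2 * (b ^+ 3 * (u * v)))); last by ring.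
by apply: (ler_wpM2l (mulr_ge0 (ler0n R 1296) c0)); apply: (ler_wpM2l (sqr_ge0 N)); exact: bP.
Qed.

End FinalEstimates.

Theorem theorem2p13 (R : realType) :
  exists C2 : R, forall eps : R, 0 < eps -> exists C1 : R,
  forall (nu : 'rV[R]_3 -> R) (X K d : nat),
    smooth_compact_supp nu -> ~ Supp nu 0 ->
    (1 <= X)%N -> (1 <= K)%N -> (1 <= d)%N ->
    (K * d)%:R <= X%:R `^ (9 / 10) :> R ->
    `|Var nu X K d -
      ((N_w (tensor2 nu) X%:R d)%:C -
       sing_series d * (sigma_inf (tensor2 nu))%:C * X%:R ^+ 3)|
    <= (C1 * `|d%:R `^ (5 / 3) * K%:R `^ (- (2 / 3) + eps) *
               sigma_inf (tensor2 nu) * X%:R ^+ 3|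
        + C2 * `|Cnorm 100 nu ^+ 2 *
                 (least_supp_bound nu)%:R ^+ 5000|)%:C.
Proof.
(* The orders 50 and 10 are those consumed by [cross_error_le1] and [square_error_le1]. They ask for
   57 and 18 derivatives of [nu], within the 100 of the norm. *)
have [cw cw0 HW] := @density_weight R 50.
have [cs cs0 HS] := @square_close R 10.
have [c1 c10 Hc] := @density_chain R 0.
(* 2592 is twice 1296: the cross term enters with the factor 2. *)
exists (2592 * cw + cs) => eps eps0.
pose ep := Num.min eps (1 / 2).
have ep0 : 0 < ep by rewrite lt_min eps0/= divr_gt0.
have ep1 : ep <= 1 / 2 by rewrite ge_min lexx orbT.
have [C3 C30 H3] := @sing_series_close R ep ep0 ep1.
have [C4 C40 H4] := @cross_square_bound R ep ep0 ep1.
exists (C3 + C4) => nu X K d hnu nS0 X0 K0 d0 hK.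
have AX := powR_exponent_nat X0 hK.
have KdX : (K * d <= X)%N.
  rewrite -(@leq_exp2r _ _ 10)//; apply: leq_trans AX _; exact: leq_pexp2l.
have KX : (K <= X)%N by apply: leq_trans KdX; exact: leq_pmulr.
have KKd : (K * K * d <= (K * d) * (K * d))%N.
  by rewrite mulnACA leq_mul2l leq_pmulr ?orbT.
have KKX : (K * K * d <= X ^ 3)%N.
  by apply: leq_trans KKd (leq_trans (leq_mul KdX KdX) _); rewrite mulnn leq_pexp2l.
have [b1 _] := least_supp_boundP hnu nS0.
set b := least_supp_bound nu in b1 *; set N := Cnorm 100 nu.
have B1 : 1 <= b%:R :> R by rewrite ler1n.
have B0 : 0 <= b%:R :> R by [].
have l1 : 1 <= b%:R ^+ 7 :> R by rewrite exprn_ege1.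
have hC k : (k <= 100)%N -> CC b%:R (b%:R ^+ 7) k N nu := fun k100 => smooth_CC hnu nS0 l1 k100.
have N0 : 0 <= N := CC_ge0 B1 (hC 0%N isT).
pose G := dens nu 0.
have sgE (a : int) : sigma_inf_a a%:~R nu X%:R = G (a%:~R / X%:R ^+ 3).
  exact: (sigma_inf_aE B1 (lexx _) _ _ (hC 4%N isT)).
have SE : sigma_inf (tensor2 nu) = J nu G := sigma_infE B1 (lexx _) (hC 5%N isT).
have nub u : nu u != 0 -> `|u| <= b%:R by move=> /(proj1 (hC 0%N isT))/andP[].
have gb t : G t != 0 -> `|t| <= 3 * b%:R ^+ 3.
  by have [_ _ s _] := Hc _ _ _ _ B1 (lexx _) (hC 7%N isT); exact: s.
have hW := HW _ _ _ B1 (hC 57%N isT).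
(* A multiple of every modulus that occurs; the largest, up to K^2 d, come from the pairs in the
   square term. *)
pose D := (K * K * d)`!%N.
have D0 : (0 < D)%N by exact: fact_gt0.
have KD n : (0 < n)%N -> (n <= K * K * d)%N -> (n %| D)%N.
  by move=> n0 nK; apply: dvdn_fact; rewrite n0.
have KdKK : (K * d <= K * K * d)%N by rewrite leq_mul2r leq_pmulr ?orbT.
have KD' n : (0 < n)%N -> (n <= K * d)%N -> (n %| D)%N.
  by move=> n0 nK; apply: KD => //; exact: leq_trans KdKK.
have dD : (d %| D)%N by apply: KD' => //; exact: leq_pmull.
have e1 := cross_close b1 (exprn_ge0 15 B0) hW X0 d0 D0 KD' dD KdX (leqnn _).
have M1 : (3 * b ^ 3 * X ^ 3 < (3 * (b * X).+1 ^ 3).+1)%N.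
  by rewrite ltnS -mulnA -expnMn leq_mul2l/= leq_exp2r.
have e2 := HS _ _ _ _ _ _ _ _ b1 (hC 18%N isT) X0 d0 D0 KD dD KKX M1.
have b3 := H3 K d D K0 d0 D0 dD KD'.
have b4 := H4 K d D K0 d0 D0 dD.
have ps := power_saving K0 d0 eps0.
rewrite (Var_expand K d X0 b1 nub gb sgE) SE -/G.
rewrite -[I3 _]/(J nu G) in e1.
set CS := Z3 _ _ in e1 *; set SQ := \sum_(a <- _) _ in e2 *.
set C := pair_sum D d (cross_pairs D K) in e1 b3 b4 *.
set Q := pair_sum D d (square_pairs D d K) in e2 b4 *.
set S := sing_series d in b3 *; set Nw := (N_w _ _ _)%:C.
set sig := J nu G in e1 e2 *.
set x3 := X%:R ^+ 3 in e1 e2 *.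
set Y := _ `^ _ in b3 b4 ps.
set Z := _ `^ _ * _ `^ _ in ps *.
have x30 : 0 <= x3 by rewrite /x3 exprn_ge0.
have XC : X%:R ^+ 3 = x3%:C :> R[i] by rewrite /x3 rmorphXn/= rmorph_nat.
rewrite XC normcE' lecR.
(* With the sums replaced by their main terms, what is left is S - 2 C + Q = (S - C) - (C - Q), and
   both differences are tails. *)
have -> : Nw - 2 * CS + SQ - (Nw - S * sig%:C * x3%:C) =
   (x3 * sig)%:C * ((S - C) - (C - Q)) + (SQ - (x3 * sig)%:C * Q) - 2 * (CS - (x3 * sig)%:C * C).
  by rewrite [(x3 * sig)%:C]rmorphM/=; ring.
apply: le_trans (cabsB _ _) _; apply: le_trans (lerD (cabsD _ _) (lexx _)) _.
rewrite !cabsM cabs_real cabs_nat.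
(* The power is hidden behind a variable, so that no later step expands the exponent 5000. *)
have [P EP] : exists P : R, P = b%:R ^+ 5000 by eexists.
have bb k : (k <= 5000)%N -> b%:R ^+ k <= P by move=> k5; rewrite EP ler_weXn2l.
have P0 : 0 <= P by rewrite EP exprn_ge0.
rewrite -EP {EP}.
have t1 : `|x3 * sig| * cabs (S - C - (C - Q)) <= (C3 + C4) * `|Z * sig * x3|.
  have Z0 : 0 <= Z by rewrite mulr_ge0// powR_ge0.
  have h : cabs (S - C - (C - Q)) <= (C3 + C4) * Z.
    apply: le_trans (cabsB _ _) _; apply: le_trans (lerD b3 b4) _.
    by rewrite -mulrDl ler_wpM2l ?addr_ge0.
  apply: le_trans (ler_wpM2l (normr_ge0 _) h) _.
  rewrite le_eqVlt; apply/orP; left; apply/eqP.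
  rewrite [`|x3 * sig|]normrM [`|Z * sig * x3|]normrM [`|Z * sig|]normrM.
  have alg (p q r s : R) : p * q * (r * s) = r * (s * q * p) by ring.
  by rewrite (ger0_norm Z0) (ger0_norm x30) alg.
have N2 : 0 <= N ^+ 2 by rewrite exprn_ge0.
have t2 : cabs (SQ - (x3 * sig)%:C * Q) <= cs * (N ^+ 2 * P).
  apply: le_trans e2 _.
  have s1 := @square_error_le1 R K (K * d) (K * K * d) X X0 KX AX KKd; rewrite -/x3 in s1.
  set u := K%:R ^+ 2 * (K%:R ^+ 2 * (x3 * (_ / x3) ^+ 10)) in s1.
  rewrite (_ : K%:R ^+ 2 * _ = u * (cs * (N ^+ 2 * b%:R ^+ (67 + 13 * 10)))); last by rewrite /u; ring.
  rewrite -[leRHS]mul1r; apply: ler_pM => //.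
  - rewrite /u; nonneg.
  - nonneg.
  - by rewrite !ler_wpM2l// bb.
have t3 : cabs (CS - (x3 * sig)%:C * C) <= 1296 * cw * (N ^+ 2 * P).
  apply: le_trans e1 _.
  have s1 := @cross_error_le1 R K (K * d) X X0 KX AX; rewrite -/x3 in s1.
  set u := K%:R ^+ 2 * (x3 * (_ / _) ^+ 50) in s1.
  rewrite (_ : K%:R ^+ 2 * _ = u * (48 * (b%:R + 2) ^+ 3 * ((b%:R ^+ 15) ^+ 50 * (cw * (b%:R ^+ 32 * N ^+ 2))))); last by rewrite /u; ring.
  rewrite -[leRHS]mul1r; apply: ler_pM => //.
  - rewrite /u; nonneg.
  - nonneg.
  by apply: cross_constant_bound => //; exact: bb.
rewrite [`|N ^+ 2 * _|]ger0_norm; last by nonneg.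
apply: le_trans (lerD (lerD t1 t2) (ler_wpM2l _ t3)) _ => //.
by rewrite le_eqVlt; apply/orP; left; apply/eqP; ring.
Qed.
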